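(* Let $d\ge1$ and $C_{DG}^-\ge1$. There exist constants $\iota\in(0,1)$, $M>1$ and $\varepsilon_{0,s}\in(0,1)$, depending only on $d$ and $C_{DG}^-$, such that, if $u\in\mathrm{DG}^-(B_4,S)$ (with constant $C_{DG}^-$) with $\|S\|_{L^\infty(B_4)}\le\varepsilon_{0,s}$ and $u\ge0$ a.e. in $B_4$, then $$|\{u\ge M\}\cap B_1|\ge(1-\iota)|B_1|\quad\Longrightarrow\quad u\ge1\ \text{ a.e. in }B_1,$$ or equivalently, $$\inf_{B_1}u\le1\quad\Longrightarrow\quad|\{u\ge M\}\cap B_1|<(1-\iota)|B_1|.$$
   Context: $B_r(x_0)$ is the open ball of $\mathbb{R}^d$, $B_r=B_r(0)$; $a_-=\max(-a,0)$; $\inf$ is the essential infimum. Elliptic De Giorgi class: for an open ball $B$ and $S\in L^2(B)$, $u\in\mathrm{DG}^-(B,S)$ with constant $C_{DG}^-\ge1$ if $u\in H^1(B)$ and for every ball $B_R(x_0)\subset B$, $\kappa\in\mathbb{R}$, $r\in(0,R)$, $$\int_{B_r(x_0)}|\nabla_x(u-\kappa)_-|^2dx\le\frac{C_{DG}^-}{(R-r)^2}\int_{B_R(x_0)}(u-\kappa)_-^2dx+C_{DG}^-\int_{B_R(x_0)}|S|(u-\kappa)_-dx.$$ *)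

(* Defs.v *)
(* A point of R^d is a row vector ['rV[R]_d].  The library has neither d-dimensional Lebesgue measure, nor Euclidean balls
   (the norm of ['rV[R]_d] is the sup norm), nor Sobolev spaces. *)
From HB Require Import structures.
From mathcomp Require Import all_boot all_order all_algebra.
From mathcomp Require Import all_classical all_reals all_analysis ess_sup_inf.

Set Implicit Arguments.
Unset Strict Implicit.
Unset Printing Implicit Defensive.

Import Order.TTheory GRing.Theory Num.Theory.
Import numFieldNormedType.Exports.

Local Open Scope classical_set_scope.
Local Open Scope ring_scope.

(* The sigma-algebra on T^n generated by the coordinates; on R^n it is the Borel
   one, and every Lebesgue measurable function is a.e. equal to a Borel one. *)
Section measurable_row.
Context {d} {T : measurableType d}.
Variable n : nat.

Let coors : 'I_n -> 'rV[T]_n -> T := fun i x => x ord0 i.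

Let row_set0 : g_sigma_preimage coors set0.
Proof. exact: sigma_algebra0. Qed.

Let row_setC A : g_sigma_preimage coors A -> g_sigma_preimage coors (~` A).
Proof. exact: sigma_algebraC. Qed.

Let row_bigcup (F : (set 'rV[T]_n)^nat) :
  (forall i, g_sigma_preimage coors (F i)) ->
  g_sigma_preimage coors (\bigcup_i (F i)).
Proof. exact: sigma_algebra_bigcup. Qed.

HB.instance Definition _ := @isMeasurable.Build (measure_tuple_display d)
  'rV[T]_n (g_sigma_preimage coors) row_set0 row_setC row_bigcup.

End measurable_row.

Section measurable_row_theory.
Context d1 d2 (T1 : measurableType d1) (T2 : measurableType d2).

Lemma measurable_coord n (i : 'I_n) :
  measurable_fun [set: 'rV[T2]_n] (fun x : 'rV[T2]_n => x ord0 i).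
Proof.
move=> _ Y mY; rewrite setTI; apply: sub_sigma_algebra => /=.
rewrite -bigcup_seq/=; exists i => /=; first by rewrite mem_index_enum.
by exists Y => //; rewrite setTI.
Qed.

Lemma measurable_fun_row n (f : T1 -> 'rV[T2]_n) :
  (forall i, measurable_fun [set: T1] (fun x => f x ord0 i)) ->
  measurable_fun [set: T1] f.
Proof.
move=> mf _ A mA; rewrite setTI.
pose F := [set B : set 'rV[T2]_n | measurable (f @^-1` B)].
suff : F A by [].
apply: (smallest_sub _ _ mA).
  split=> /=; first by rewrite /F/= preimage_set0.
  - move=> B mB; rewrite /F/= setTD preimage_setC; exact: measurableC.
  - move=> B mB; rewrite /F/= preimage_bigcup.
    by apply: bigcup_measurable => k _; exact: mB.
rewrite -bigcup_seq; apply: bigcup_sub => i _ B [Y mY <-].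
rewrite /F/= setTI -[X in measurable X]setTI; exact: mf.
Qed.

End measurable_row_theory.

Section lebesgue_row.
Context {R : realType}.

Definition row_cons n (p : measurableTypeR R * 'rV[R]_n) : 'rV[R]_n.+1 :=
  \row_i oapp (p.2 ord0) (p.1 : R) (unlift ord0 i).

Definition row_uncons n (x : 'rV[R]_n.+1) : measurableTypeR R * 'rV[R]_n :=
  (x ord0 ord0, \row_j x ord0 (lift ord0 j)).

Lemma row_consK n : cancel (@row_cons n) (@row_uncons n).
Proof.
move=> [a v]; rewrite /row_uncons mxE unlift_none /=; congr pair.
by apply/rowP => j; rewrite !mxE liftK.
Qed.

Lemma row_unconsK n : cancel (@row_uncons n) (@row_cons n).
Proof.
move=> x; apply/rowP => i; rewrite mxE.
by have [j ->|->] := unliftP ord0 i => //=; rewrite mxE.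
Qed.

Lemma measurable_row_cons n : measurable_fun setT (@row_cons n).
Proof.
apply: measurable_fun_row => i; have [j ->|->] := unliftP ord0 i.
- rewrite (_ : (fun _ => _) = (fun v : 'rV[R]_n => v ord0 j) \o snd).
    by apply: measurableT_comp => //; exact: measurable_coord.
  by apply/funext => p; rewrite mxE liftK.
- rewrite (_ : (fun _ => _) = fst); first exact: measurable_fst.
  by apply/funext => p; rewrite mxE unlift_none.
Qed.

Lemma measurable_row_uncons n : measurable_fun setT (@row_uncons n).
Proof.
apply/measurable_fun_pairP; split; first exact: measurable_coord.
apply: measurable_fun_row => j; rewrite (_ : (fun _ => _) =
  fun x : 'rV[R]_n.+1 => x ord0 (lift ord0 j)); first exact: measurable_coord.
by apply/funext => x; rewrite mxE.
Qed.

Section step.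
Local Open Scope ereal_scope.
Variables (n : nat) (m : {sigma_finite_measure set 'rV[R]_n -> \bar R}).

Definition lebesgue_rowS : set 'rV[R]_n.+1 -> \bar R :=
  pushforward (@lebesgue_measure R \x m) (@row_cons n).

Let lebesgue_rowS0 : lebesgue_rowS set0 = 0.
Proof. by rewrite /lebesgue_rowS /pushforward preimage_set0 measure0. Qed.

Let lebesgue_rowS_ge0 A : 0 <= lebesgue_rowS A.
Proof. by rewrite /lebesgue_rowS /pushforward; exact: measure_ge0. Qed.

Let mpre (A : set 'rV[R]_n.+1) : measurable A -> measurable (@row_cons n @^-1` A).
Proof.
by move=> mA; rewrite -[X in measurable X]setTI; exact: measurable_row_cons.
Qed.

Let lebesgue_rowS_sigma_additive : semi_sigma_additive lebesgue_rowS.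
Proof.
move=> F mF tF mUF; rewrite /lebesgue_rowS /pushforward preimage_bigcup.
apply: measure_semi_sigma_additive.
- by move=> k; exact: mpre.
- apply/trivIsetP => /= i j _ _ ij; rewrite -preimage_setI.
  by move/trivIsetP : tF => /(_ _ _ _ _ ij) ->//; rewrite preimage_set0.
- by rewrite -preimage_bigcup; exact: mpre.
Qed.

HB.instance Definition _ := isMeasure.Build _ _ _ lebesgue_rowS
  lebesgue_rowS0 lebesgue_rowS_ge0 lebesgue_rowS_sigma_additive.

Let lebesgue_rowS_sigma_finite : sigma_finite setT lebesgue_rowS.
Proof.
have /sigma_finiteP[F [TF ndF Foo]] := sigma_finiteT (@lebesgue_measure R).
have /sigma_finiteP[G [TG ndG Goo]] := sigma_finiteT m.
exists (fun k => @row_uncons n @^-1` (F k `*` G k)).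
  rewrite -preimage_bigcup -[LHS](preimage_setT (@row_uncons n)).
  congr (_ @^-1` _); apply/seteqP; split=> // -[x y] _.
  have [k _ Fkx] : (\bigcup_i F i) x by rewrite -TF.
  have [l _ Gly] : (\bigcup_i G i) y by rewrite -TG.
  exists (maxn k l) => //; split=> /=.
    by move: x Fkx; exact/subsetPset/ndF/leq_maxl.
  by move: y Gly; exact/subsetPset/ndG/leq_maxr.
move=> k; have [mFk Fkoo] := Foo k; have [mGk Gkoo] := Goo k; split.
  rewrite -[X in measurable X]setTI; apply: measurable_row_uncons => //.
  exact: measurableX.
rewrite /lebesgue_rowS /pushforward -comp_preimage.
rewrite (_ : _ \o _ = id); last by apply/funext => p /=; exact: row_consK.
by rewrite preimage_id product_measure1E// lte_mul_pinfty// ge0_fin_numE.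
Qed.

HB.instance Definition _ := Measure_isSigmaFinite.Build _ _ _ lebesgue_rowS
  lebesgue_rowS_sigma_finite.

End step.

(* Iterated product of the one-dimensional Lebesgue measure; the value on boxes
   is [lebesgue_row_box] below. *)
Fixpoint lebesgue_row n : {sigma_finite_measure set 'rV[R]_n -> \bar R} :=
  if n is n'.+1 then lebesgue_rowS (lebesgue_row n') else dirac (0 : 'rV[R]_0).

End lebesgue_row.

Lemma lebesgue_row_box (R : realType) n (a b : 'rV[R]_n) :
  (forall i, a ord0 i <= b ord0 i) ->
  lebesgue_row n [set x | forall i, a ord0 i < x ord0 i <= b ord0 i] =
  (\prod_(i < n) (b ord0 i - a ord0 i))%:E.
Proof.
elim: n a b => [|n IH] a b ab.
  rewrite big_ord0 /= diracE mem_set//.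
  by case=> k k0; exfalso; rewrite ltn0 in k0.
rewrite big_ord_recl.
pose a' : 'rV[R]_n := \row_j a ord0 (lift ord0 j).
pose b' : 'rV[R]_n := \row_j b ord0 (lift ord0 j).
pose A := [set x : 'rV[R]_n.+1 | forall i, a ord0 i < x ord0 i <= b ord0 i].
pose A' := [set x : 'rV[R]_n | forall i, a' ord0 i < x ord0 i <= b' ord0 i].
rewrite -/A; transitivity
  ((@lebesgue_measure R \x lebesgue_row n)%E (@row_cons R n @^-1` A)) => //.
have -> : @row_cons R n @^-1` A = `]a ord0 ord0, b ord0 ord0]%classic `*` A'.
  apply/seteqP; split=> [p /= H|p /= [H1 H2] i].
    split; first by have := H ord0; rewrite !mxE unlift_none in_itv.
    by move=> i; have := H (lift ord0 i); rewrite !mxE liftK.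
  have [j ->|->] := unliftP ord0 i; rewrite !mxE ?liftK ?unlift_none.
    by have := H2 j; rewrite !mxE.
  by move: H1; rewrite in_itv.
rewrite product_measure1E //=; last first.
  rewrite (_ : A' = \bigcap_(i in [set: 'I_n])
     ((fun x : 'rV[R]_n => x ord0 i) @^-1` `]a' ord0 i, b' ord0 i]%classic)).
    apply: fin_bigcap_measurable => // i _; rewrite -[X in measurable X]setTI.
    by apply: measurable_coord => //; exact: measurable_itv.
  apply/seteqP; split=> x /= H i; first by move=> _; rewrite /= in_itv /=; exact: H.
  by have := H i I; rewrite /= in_itv.
rewrite /A' IH; last by move=> i; rewrite !mxE.
rewrite lebesgue_measure_itv /= lte_fin.
have -> : (\prod_(i < n) (b' ord0 i - a' ord0 i) =
    \prod_(i < n) (b ord0 (lift ord0 i) - a ord0 (lift ord0 i))).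
  by apply: eq_bigr => i _; rewrite !mxE.
case: ifPn => [_|]; first by rewrite -EFinB -EFinM.
rewrite -leNgt => ba; have -> : b ord0 ord0 = a ord0 ord0.
  by apply/eqP; rewrite eq_le ba ab.
by rewrite subrr mul0r mul0e.
Qed.

Section de_giorgi_class.
Context {R : realType} {d : nat}.
Implicit Types (x : 'rV[R]_d) (r : R) (B : set 'rV[R]_d) (u f : 'rV[R]_d -> R).

Local Notation mu := (@lebesgue_row R d).

Definition eball x r : set 'rV[R]_d :=
  [set y | Num.sqrt (\sum_(i < d) (y ord0 i - x ord0 i) ^+ 2) < r].

Definition partial (i : 'I_d) f : 'rV[R]_d -> R := 'D_(delta_mx ord0 i) f.

(* [foldr partial f s] is an arbitrary iterated partial derivative of [f]. *)
Definition smooth f := forall s : seq 'I_d,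
  continuous (foldr partial f s) /\
  forall i x, derivable (foldr partial f s) x (delta_mx ord0 i).

Definition test_function B f :=
  [/\ smooth f, compact (closure [set x | f x != 0]) &
      closure [set x | f x != 0] `<=` B].

Definition L2 B f :=
  measurable_fun B f /\ (\int[mu]_(x in B) (f x ^+ 2)%:E < +oo)%E.

Definition weak_gradient B u (G : 'I_d -> 'rV[R]_d -> R) :=
  [/\ L2 B u, forall i, L2 B (G i) &
    forall f, test_function B f -> forall i,
      (\int[mu]_(x in B) (u x * partial i f x)%:E =
       - \int[mu]_(x in B) (G i x * f x)%:E)%E].

Definition H1 B u := exists G, weak_gradient B u G.

(* The essential supremum (resp. infimum) over [B] is taken on the whole space,
   after extending the function by 0 (resp. by +oo) outside [B]. *)
Definition Linfty_norm B f : \bar R := ('N[mu]_+oo [EFin \o (f \_ B)])%E.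

Definition essinf_on B f : \bar R := ess_inf mu (patch (cst +oo%E) B (EFin \o f)).

(* [^\-] is the negative part.  The gradient of [(u - k)_-] is its weak gradient
   [G], which exists because [u] is in H^1 and is unique almost everywhere, so
   that the quantification over [G] only names it. *)
Definition DG_minus (C : R) B (S u : 'rV[R]_d -> R) :=
  [/\ L2 B S, H1 B u &
    forall (x0 : 'rV[R]_d) (rho k r : R), 0 < rho -> eball x0 rho `<=` B ->
      0 < r < rho ->
    let w := ((fun x => u x - k)^\-)%R in
    forall G, weak_gradient B w G ->
      (\int[mu]_(x in eball x0 r) (\sum_(i < d) G i x ^+ 2)%:E <=
       (C / (rho - r) ^+ 2)%:E * \int[mu]_(x in eball x0 rho) (w x ^+ 2)%:E
       + C%:E * \int[mu]_(x in eball x0 rho) (`|S x| * w x)%:E)%E].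

End de_giorgi_class.

(* Main.v *)
Require Import Defs.
From HB Require Import structures.
From mathcomp Require Import all_boot all_order all_algebra.
From mathcomp Require Import all_classical all_reals all_analysis ess_sup_inf measurable_realfun.
From mathcomp Require Import ring lra.
Import Order.TTheory GRing.Theory Num.Theory.
Import numFieldNormedType.Exports.
Local Open Scope classical_set_scope.
Local Open Scope ring_scope.

Set Implicit Arguments.
Unset Strict Implicit.
Unset Printing Implicit Defensive.

(** The statement holds with iota = eps = 1/2, and it is a form of the weak Harnack
    inequality of De Giorgi; the proof even gives u >= 2 almost everywhere in the
    unit ball.  Let w_k = (u - k)_-.  As u >= 0 and |S| <= 1, for every level k >= 1 the
    defining inequality bounds the energy of w_k on a ball by a multiple of k^2 times
    the measure of the set {u < k} in a larger ball ([level_energy]).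

    First the measure of {u < 4} in the ball of radius 2 is made as small as desired
    by choosing M large.  If u passes from above k to below k / 2, then it takes the
    values in between on a set whose measure is bounded below in terms of the energy
    ([isoperimetric]).  The hypothesis says that {u >= M} fills half of the unit ball,
    and the sets {M / 2^(j+1) < u < M / 2^j} are disjoint, so that after many dyadic
    levels little measure is left for {u < M / 2^J} ([level_step], [level_sum]).

    Then small measure is converted into a pointwise bound by an iteration over radii
    shrinking from 2 to 1 and levels decreasing from 4 to 2: the measure of the n-th
    sublevel set satisfies a superlinear recursion ([sublevel_measure_step]) and tends
    to 0 geometrically if it is small at the start ([de_giorgi_iteration]).

    Both parts use the energy only through translations: the L^2 norm of w(. + h) - w
    is at most a multiple of |h| times the L^2 norm of the gradient
    ([translation_estimate]).  Integrating over h, with Fubini and the translation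
    invariance of the Lebesgue measure ([integral_correlation]), replaces the Sobolev
    and Poincare inequalities.

    The translation estimate itself follows from the fundamental theorem of calculus
    along almost every line parallel to an axis ([difference_identity]), which is read
    off the definition of the weak gradient by testing it with translated products of
    smooth bumps.  The same identity shows that w_k has weak gradient -1_{u < k} grad u
    ([weak_gradient_truncation]), so that the defining inequality can be applied to
    this gradient.  The second implication of the statement is the contrapositive of
    the first one, applied to the bound u >= 2. *)

(** * Open sets, boxes and measurability *)

Definition openbox {R : realType} {d} (a b : 'rV[R]_d) : set 'rV[R]_d :=
  [set x | forall i, a ord0 i < x ord0 i < b ord0 i].

Definition closedbox {R : realType} {d} (a b : 'rV[R]_d) : set 'rV[R]_d :=
  [set x | forall i, a ord0 i <= x ord0 i <= b ord0 i].

Section row_topology.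
Context {R : realType} {d : nat}.
Implicit Types (a b x y : 'rV[R]_d).

Lemma openbox_bigcap a b : openbox a b =
  \bigcap_(i in [set: 'I_d])
    ((fun x : 'rV[R]_d => x ord0 i) @^-1` `]a ord0 i, b ord0 i[%classic).
Proof.
apply/seteqP; split => x /=.
  by move=> xab i _ /=; rewrite in_itv/=; exact: xab.
by move=> xab i; have := xab i I; rewrite /= in_itv.
Qed.

Lemma measurable_openbox a b : measurable (openbox a b).
Proof.
rewrite openbox_bigcap; apply: fin_bigcap_measurable => // i _.
by rewrite -[X in measurable X]setTI; exact: measurable_coord.
Qed.

Lemma closedbox_closed a b : closed (closedbox a b).
Proof.
rewrite (_ : closedbox a b = \bigcap_(i in [set: 'I_d])
    ((fun x : 'rV[R]_d => x ord0 i) @^-1` `[a ord0 i, b ord0 i]%classic)).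
  apply: closed_bigI => i _; apply: preimage_closed.
    by move=> x _; exact: coord_continuous.
  exact: itv_closed.
apply/seteqP; split => x /=.
  by move=> xab i _ /=; rewrite in_itv/=; exact: xab.
by move=> xab i; have := xab i I; rewrite /= in_itv.
Qed.

Lemma closedbox_compact a b : compact (closedbox a b).
Proof.
rewrite (_ : closedbox a b =
    [set v | forall i, (`[a ord0 i, b ord0 i]%classic : set R) (v ord0 i)]).
  by apply: (@rV_compact R d (fun i => `[a ord0 i, b ord0 i]%classic)) => i;
     exact: segment_compact.
by apply/seteqP; split => x xab i; have := xab i; rewrite /= in_itv.
Qed.

Lemma openbox_sub_closedbox a b : openbox a b `<=` closedbox a b.
Proof. by move=> x xab i; have /andP[/ltW -> /ltW ->] := xab i. Qed.

Lemma open_openbox_nbhs (O : set 'rV[R]_d) x : open O -> O x ->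
  exists2 e : R, 0 < e & forall y, (forall i, `|y ord0 i - x ord0 i| < e) -> O y.
Proof.
rewrite openE => /[apply]; move/nbhs_ballP => [e /= e0 xeO]; exists e => // y yx.
by apply: xeO; split=> // i j; rewrite (ord1 i); rewrite /ball/= distrC; exact: yx.
Qed.

(** Rational boxes make every statement about open sets a countable one. *)
Lemma open_rational_box (O : set 'rV[R]_d) x : open O -> O x ->
  exists p : 'rV[rat]_d * 'rV[rat]_d,
    openbox (map_mx ratr p.1) (map_mx ratr p.2) x /\
    closedbox (map_mx ratr p.1) (map_mx ratr p.2) `<=` O.
Proof.
move=> oO Ox; have [e e0 eO] := open_openbox_nbhs oO Ox.
have rat_lo i : exists q : rat, x ord0 i - e < ratr q < x ord0 i.
  have : x ord0 i - e < x ord0 i by rewrite ltrBlDr ltrDl.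
  by move=> /rat_in_itvoo[q]; rewrite in_itv/=; exists q.
have rat_hi i : exists q : rat, x ord0 i < ratr q < x ord0 i + e.
  have : x ord0 i < x ord0 i + e by rewrite ltrDl.
  by move=> /rat_in_itvoo[q]; rewrite in_itv/=; exists q.
have [lo lo_in] := choice rat_lo.
have [hi hi_in] := choice rat_hi.
exists (\row_i lo i, \row_i hi i); split => [i|y yx] /=.
  by rewrite !mxE; have /andP[_ ->] := lo_in i; have /andP[-> _] := hi_in i.
apply: eO => i; rewrite ltr_norml; have := yx i; rewrite !mxE/= => /andP[y1 y2].
have /andP[l1 l2] := lo_in i; have /andP[h1 h2] := hi_in i.
by apply/andP; split; lra.
Qed.

Definition rational_box (p : 'rV[rat]_d * 'rV[rat]_d) : set 'rV[R]_d :=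
  openbox (map_mx ratr p.1) (map_mx ratr p.2).

Lemma open_bigcup_box (O : set 'rV[R]_d) : open O ->
  O = \bigcup_(p in [set p : 'rV[rat]_d * 'rV[rat]_d |
        closedbox (map_mx ratr p.1) (map_mx ratr p.2) `<=` O]) rational_box p.
Proof.
move=> oO; apply/seteqP; split=> [x Ox|x [p pO] /openbox_sub_closedbox/pO//].
by have [p [xp pO]] := open_rational_box oO Ox; exists p.
Qed.

Lemma open_measurable_row (O : set 'rV[R]_d) : open O -> measurable O.
Proof.
move=> /open_bigcup_box ->; rewrite bigcup_mkcond.
apply: countable_bigcupT_measurable; first exact: countableP.
by move=> p; case: ifP => // _; exact: measurable_openbox.
Qed.

Lemma continuous_measurable_row (f : 'rV[R]_d -> R) :
  continuous f -> measurable_fun setT f.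
Proof.
move=> cf; apply: (measurability _ (RGenOpens.measurableE R)) => //.
move=> _ [_ [a [b ->] <-]]; rewrite setTI; apply: open_measurable_row.
by apply: open_comp => [x _|]; [exact: cf|exact: interval_open].
Qed.

End row_topology.

Section box_generate.
Context {R : realType} {d : nat}.

Definition boxes : set (set 'rV[R]_d) := [set openbox ab.1 ab.2 | ab in setT].

Lemma openboxI (a b a' b' : 'rV[R]_d) : openbox a b `&` openbox a' b' =
  openbox (\row_i Num.max (a ord0 i) (a' ord0 i))
          (\row_i Num.min (b ord0 i) (b' ord0 i)).
Proof.
apply/seteqP; split => [x [xab xab'] i|x xab].
  rewrite !mxE gt_max lt_min; have /andP[-> ->] := xab i.
  by have /andP[-> ->] := xab' i.
split=> i; have := xab i; rewrite !mxE gt_max lt_min -!andbA.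
  by case/and4P => -> _ ->.
by case/and4P => _ -> _ ->.
Qed.

Lemma setI_closed_boxes : setI_closed boxes.
Proof.
move=> _ _ [[a b] _ <-] [[a' b'] _ <-] /=; rewrite openboxI.
by set p := (X in openbox X _); set q := (X in openbox _ X); exists (p, q).
Qed.

Let coord (i : 'I_d) (x : g_sigma_algebraType boxes) : R :=
  (x : 'rV[R]_d) ord0 i.

Let measurable_coord_boxes i : measurable_fun setT (coord i).
Proof.
apply: (measurability _ (RGenOpens.measurableE R)) => //.
move=> _ [_ [p [q ->] <-]]; rewrite setTI.
pose a k : 'rV[R]_d := \row_j (if j == i then p else - k%:R).
pose b k : 'rV[R]_d := \row_j (if j == i then q else k%:R).
rewrite (_ : _ @^-1` _ = \bigcup_k openbox (a k) (b k)).
  apply: bigcup_measurable => k _; apply: sub_sigma_algebra.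
  by exists (a k, b k).
apply/seteqP; split=> x; rewrite /= in_itv/=; last first.
  by move=> [k _ /(_ i)]; rewrite !mxE eqxx.
move=> xpq; pose s := \sum_j `|(x : 'rV[R]_d) ord0 j|.
exists (Num.bound s) => // j; rewrite !mxE; case: eqP => [->//|_].
rewrite -ltr_norml (@le_lt_trans _ _ s)//.
  by rewrite /s (bigD1 j)//= lerDl sumr_ge0.
by rewrite archi_boundP// sumr_ge0.
Qed.

(** The coordinates are measurable for the sigma-algebra that the boxes generate:
    a strip is a countable union of boxes.  This makes the pi-lambda theorem
    applicable to boxes. *)
Lemma measurable_boxesE : @measurable _ 'rV[R]_d = <<s boxes >>.
Proof.
apply/seteqP; split; last first.
  apply: smallest_sub; first exact: sigma_algebra_measurable.
  by move=> _ [[a b] _ <-]; exact: measurable_openbox.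
apply: smallest_sub; first exact: smallest_sigma_algebra.
rewrite -bigcup_seq; apply: bigcup_sub => i _ _ [Y mY <-].
exact: measurable_coord_boxes.
Qed.

End box_generate.

Section ae_eq_boxes.
Context {R : realType} {d : nat}.
Local Notation mu := (@lebesgue_row R d).
Local Open Scope ereal_scope.
Implicit Types (f g : 'rV[R]_d -> \bar R).

Lemma integral_setC_sub f (D A : set 'rV[R]_d) : measurable D -> measurable A ->
  mu.-integrable D f ->
  \int[mu]_(x in ~` A `&` D) f x =
  \int[mu]_(x in D) f x - \int[mu]_(x in A `&` D) f x.
Proof.
move=> mD mA fD.
have mAD : measurable (A `&` D) by exact: measurableI.
have mCD : measurable (~` A `&` D) by apply: measurableI => //; exact: measurableC.
have fA : \int[mu]_(x in A `&` D) f x \is a fin_num.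
  by apply: integrable_fin_num => //; apply: integrableS fD => //; exact: subIsetr.
have DE : D = (~` A `&` D) `|` (A `&` D) by rewrite -setIUl setUC setUv setTI.
rewrite [in X in _ = X - _]DE integral_setU//.
- by rewrite addeK.
- by rewrite -DE; exact: measurable_int fD.
- by rewrite disj_set2E setIACA setICl set0I.
Qed.

(** Boxes form a pi-system, so integrals that agree on boxes agree on every
    measurable subset. *)
Lemma ae_eq_openbox f g (a b : 'rV[R]_d) :
  mu.-integrable (openbox a b) f -> mu.-integrable (openbox a b) g ->
  (forall a' b' : 'rV[R]_d,
    (forall i, a ord0 i <= a' ord0 i /\ b' ord0 i <= b ord0 i)%R ->
    \int[mu]_(x in openbox a' b') f x = \int[mu]_(x in openbox a' b') g x) ->
  ae_eq mu (openbox a b) f g.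
Proof.
move=> fi gi fg; have mab := measurable_openbox a b.
have box_fg A : <<s boxes >> A ->
    \int[mu]_(x in A `&` openbox a b) f x = \int[mu]_(x in A `&` openbox a b) g x.
  have fg_ab : \int[mu]_(x in openbox a b) f x = \int[mu]_(x in openbox a b) g x.
    exact: fg.
  apply: (@dynkin_induction _ _ boxes
    (fun A => \int[mu]_(x in A `&` openbox a b) f x =
              \int[mu]_(x in A `&` openbox a b) g x)
    measurable_boxesE setI_closed_boxes).
  - by rewrite setTI.
  - move=> _ [[a' b'] _ <-] /=.
    rewrite openboxI; apply: fg => i; rewrite !mxE.
    by split; [rewrite le_max lexx orbT|rewrite ge_min lexx orbT].
  - by move=> S mS fgS; rewrite !integral_setC_sub// fgS fg_ab.
  - move=> F mF tF fgF; rewrite setI_bigcupl.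
    have mFab n : measurable (F n `&` openbox a b) by exact: measurableI.
    have tFab : trivIset setT (fun n => F n `&` openbox a b).
      by apply: trivIset_setIr.
    rewrite !integral_bigcup//; first exact: eq_eseriesr.
    + by apply: integrableS gi => //; [exact: bigcupT_measurable|
        move=> x [n _ []]].
    + by apply: integrableS fi => //; [exact: bigcupT_measurable|
        move=> x [n _ []]].
apply: integral_ae_eq => //; first exact: measurable_int gi.
move=> E Eab mE; have := box_fg E; rewrite -measurable_boxesE => /(_ mE).
by rewrite (setIidl Eab).
Qed.

(** Countably many rational boxes exhaust O, so the exceptional null sets add up to
    a null set. *)
Lemma ae_eq_open f g (O : set 'rV[R]_d) : open O ->
  mu.-integrable O f -> mu.-integrable O g ->
  (forall a b, closedbox a b `<=` O ->
    \int[mu]_(x in openbox a b) f x = \int[mu]_(x in openbox a b) g x) ->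
  ae_eq mu O f g.
Proof.
move=> oO fi gi fg; have mO := open_measurable_row oO.
pose P (p : 'rV[rat]_d * 'rV[rat]_d) : Prop :=
  closedbox (map_mx ratr p.1) (map_mx ratr p.2) `<=` O.
have ae_p p : {ae mu, forall x, P p -> rational_box p x -> f x = g x}.
  have [Pp|nP] := pselect (P p); last by apply: aeW.
  have pO : rational_box p `<=` O by move=> x /openbox_sub_closedbox/Pp.
  have mp : measurable (rational_box p : set 'rV[R]_d) by exact: measurable_openbox.
  have : ae_eq mu (rational_box p) f g.
    apply: ae_eq_openbox.
    - exact: integrableS fi.
    - exact: integrableS gi.
    - move=> a' b' ab'; apply: fg => x xab; apply: Pp => i.
      have /andP[ax xb] := xab i; have [aa' bb'] := ab' i.
      by rewrite (le_trans aa')//= (le_trans xb).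
  by apply: filterS => x fgx _ px; exact: fgx.
have : {ae mu, forall x, forall p, P p -> rational_box p x -> f x = g x}.
  have : {ae mu, forall x, forall n,
      if pickle_inv n is Some p then P p -> rational_box p x -> f x = g x
      else True}.
    by apply: ae_foralln => n; case: pickle_inv => [p|]; [exact: ae_p|exact: aeW].
  by apply: filterS => x fgx p; have := fgx (pickle p); rewrite pickleK_inv.
apply: filterS => x fgx Ox; have [p [px pO]] := open_rational_box oO Ox.
exact: fgx px.
Qed.

End ae_eq_boxes.

(** * Translation invariance of the Lebesgue measure *)

Section translation.
Context {R : realType}.

Lemma lebesgue_measure_shift (h : R) (A : set R) : measurable A ->
  @lebesgue_measure R ((fun x : measurableTypeR R => x + h : measurableTypeR R) @^-1` A) =
  @lebesgue_measure R A.
Proof.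
move=> mA; have mh : measurable_fun setT
    (fun x : measurableTypeR R => x + h : measurableTypeR R).
  by apply: measurable_funD => //; exact: measurable_cst.
apply/esym; rewrite -[RHS]/(pushforward (@lebesgue_measure R)
  (fun x : measurableTypeR R => x + h : measurableTypeR R) A).
apply: (@lebesgue_measure_unique R (pushforward (@lebesgue_measure R)
  (fun x : measurableTypeR R => x + h : measurableTypeR R))) => //.
move=> _ [[a b] _ <-] /=; rewrite /pushforward.
rewrite (_ : _ @^-1` _ = `]a - h, b - h]%classic); last first.
  by apply/seteqP; split => x; rewrite /= !in_itv/= ltrBlDr lerBrDr.
rewrite !lebesgue_measure_itv/= !lte_fin ltrD2r; case: ifP => // _.
by rewrite -!EFinB; congr _%:E; ring.
Qed.

Lemma measurable_row_shift d (h : 'rV[R]_d) :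
  measurable_fun setT (fun x : 'rV[R]_d => x + h).
Proof.
apply: measurable_fun_row => i; rewrite (_ : (fun _ => _) =
    fun x : 'rV[R]_d => x ord0 i + h ord0 i).
  by apply: measurable_funD => //; exact: measurable_coord.
by apply/funext => x; rewrite mxE.
Qed.

(** Induction on the dimension: a translation acts separately on the first
    coordinate and on the others. *)
Lemma lebesgue_row_shift d (h : 'rV[R]_d) (A : set 'rV[R]_d) : measurable A ->
  lebesgue_row d ((fun x => x + h) @^-1` A) = lebesgue_row d A.
Proof.
elim: d h A => [|d IH] h A mA.
  congr (lebesgue_row 0 _); apply/seteqP; split=> x /=;
    by rewrite (_ : x + h = x)//; apply/rowP => -[].
rewrite -[LHS]/((@lebesgue_measure R \x lebesgue_row d)%E
  (@row_cons R d @^-1` ((fun x => x + h) @^-1` A))).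
rewrite -[RHS]/((@lebesgue_measure R \x lebesgue_row d)%E
  (@row_cons R d @^-1` A)).
pose h' : 'rV[R]_d := \row_j h ord0 (lift ord0 j).
pose T (p : measurableTypeR R * 'rV[R]_d) : measurableTypeR R * 'rV[R]_d :=
  (p.1 + h ord0 ord0, p.2 + h').
have mT : measurable_fun setT T.
  apply/measurable_fun_pairP; split.
    apply: (@measurable_funD _ _ _ _ (fst : measurableTypeR R * 'rV[R]_d -> R)
      (cst (h ord0 ord0))) => //; exact: measurable_fst.
  by apply: (measurableT_comp (measurable_row_shift h')); exact: measurable_snd.
have mA' : measurable (@row_cons R d @^-1` A).
  by rewrite -[X in measurable X]setTI; exact: measurable_row_cons.
rewrite (_ : _ @^-1` (_ @^-1` _) = T @^-1` (@row_cons R d @^-1` A)); last first.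
  apply/seteqP; split => p; rewrite /= (_ : row_cons p + h = row_cons (T p))//;
  by apply/rowP => i; rewrite !mxE; case: unliftP => [j ->|->] //=; rewrite !mxE.
rewrite -[LHS]/(pushforward (@lebesgue_measure R \x lebesgue_row d)%E T _).
apply/esym; apply: (@product_measure_unique _ _ _ _ _ (@lebesgue_measure R)
  (lebesgue_row d) (pushforward (@lebesgue_measure R \x lebesgue_row d)%E T)) => //.
move=> X Y mX mY; rewrite /pushforward.
transitivity ((@lebesgue_measure R \x lebesgue_row d)%E
  (((fun x : measurableTypeR R => x + h ord0 ord0 : measurableTypeR R) @^-1` X)
    `*` ((fun x => x + h') @^-1` Y))); first by [].
rewrite product_measure1E; last 2 first.
- by rewrite -[X in measurable X]setTI; apply: measurable_funD => //;
    exact: measurable_cst.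
- by rewrite -[X in measurable X]setTI; exact: measurable_row_shift.
by rewrite IH//; congr (_ * _)%E; exact: lebesgue_measure_shift.
Qed.

Context {d : nat}.
Local Notation mu := (@lebesgue_row R d).
Local Open Scope ereal_scope.

Lemma ge0_integral_shift (h : 'rV[R]_d) (f : 'rV[R]_d -> \bar R) :
  measurable_fun setT f -> (forall x, 0 <= f x) ->
  \int[mu]_x f (x + h)%R = \int[mu]_x f x.
Proof.
move=> mf f0; have msh := measurable_row_shift h.
transitivity (\int[pushforward mu (fun x => x + h)%R]_x f x).
  by rewrite ge0_integral_pushforward// => x _; exact: f0.
apply: eq_measure_integral => A mA _; exact: lebesgue_row_shift.
Qed.

Lemma integrable_shift (h : 'rV[R]_d) (f : 'rV[R]_d -> \bar R) :
  mu.-integrable setT f -> mu.-integrable setT (fun x => f (x + h)%R).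
Proof.
move=> /integrableP[mf fi]; apply/integrableP; split.
  by apply: (measurableT_comp mf); exact: measurable_row_shift.
rewrite (ge0_integral_shift h (f := fun x => `|f x|))//.
exact: measurableT_comp.
Qed.

Lemma integral_shift (h : 'rV[R]_d) (f : 'rV[R]_d -> \bar R) :
  mu.-integrable setT f -> \int[mu]_x f (x + h)%R = \int[mu]_x f x.
Proof.
move=> fi; have mf := measurable_int _ fi.
have msh := measurable_row_shift h.
rewrite integralE [RHS]integralE.
rewrite -(@ge0_integral_shift h (fun x => f^\+ x))//; last first.
  exact: measurable_funepos.
rewrite -(@ge0_integral_shift h (fun x => f^\- x))//; last exact: measurable_funeneg.
by congr (_ - _); apply: eq_integral => x _; rewrite ?funeposE ?funenegE.
Qed.

End translation.

(** * Euclidean balls centred at the origin *)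

Section euclidean_ball.
Context {R : realType} {d : nat}.
Local Notation mu := (@lebesgue_row R d).
Implicit Types (x y h : 'rV[R]_d) (r s : R).

Definition enorm x : R := Num.sqrt (\sum_(i < d) x ord0 i ^+ 2).

Lemma enorm_ge0 x : 0 <= enorm x. Proof. exact: sqrtr_ge0. Qed.

Lemma enorm_sqr x : enorm x ^+ 2 = \sum_(i < d) x ord0 i ^+ 2.
Proof. by rewrite sqr_sqrtr// sumr_ge0// => i _; exact: sqr_ge0. Qed.

Lemma eball0E r : eball (0 : 'rV[R]_d) r = [set x | enorm x < r].
Proof.
apply/funext => x; rewrite /eball /enorm /=.
by congr (is_true (Num.sqrt _ < r)); apply: eq_bigr => i _; rewrite mxE subr0.
Qed.

Lemma coord_le_enorm x i : `|x ord0 i| <= enorm x.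
Proof.
rewrite -(@ler_pXn2r _ 2) ?nnegrE ?enorm_ge0// enorm_sqr real_normK ?num_real//.
by rewrite (bigD1 i)//= lerDl sumr_ge0// => j _; exact: sqr_ge0.
Qed.

Lemma dot_le_enorm x y :
  \sum_(i < d) x ord0 i * y ord0 i <= enorm x * enorm y.
Proof.
have [/eqP x0|x0] := boolP (enorm x == 0).
  rewrite x0 mul0r big1// => i _; have := coord_le_enorm x i.
  by rewrite x0 normr_le0 => /eqP ->; rewrite mul0r.
have [/eqP y0|y0] := boolP (enorm y == 0).
  rewrite y0 mulr0 big1// => i _; have := coord_le_enorm y i.
  by rewrite y0 normr_le0 => /eqP ->; rewrite mulr0.
have X0 : 0 < enorm x by rewrite lt_neqAle eq_sym x0 enorm_ge0.
have Y0 : 0 < enorm y by rewrite lt_neqAle eq_sym y0 enorm_ge0.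
(* weighted Young inequality, with the weight that balances both terms *)
have young i : x ord0 i * y ord0 i <= (enorm y / enorm x) / 2 * x ord0 i ^+ 2
    + (enorm x / enorm y) / 2 * y ord0 i ^+ 2.
  rewrite -subr_ge0 (_ : _ - _ = (enorm y * x ord0 i - enorm x * y ord0 i) ^+ 2
    / (2 * enorm x * enorm y)); last by field; rewrite x0 y0.
  by rewrite divr_ge0 ?sqr_ge0// !mulr_ge0// ltW.
apply: (le_trans (ler_sum _ (fun i _ => young i))).
rewrite big_split/= -!mulr_sumr -!enorm_sqr le_eqVlt; apply/orP; left; apply/eqP.
by field; rewrite x0 y0.
Qed.

Lemma enormD x y : enorm (x + y) <= enorm x + enorm y.
Proof.
rewrite -(@ler_pXn2r _ 2) ?nnegrE ?addr_ge0 ?enorm_ge0// sqrrD !enorm_sqr.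
under eq_bigr do rewrite mxE sqrrD.
by rewrite !big_split/= -mulr2n lerD2r lerD2l lerMn2r dot_le_enorm.
Qed.

Lemma enormZ (t : R) x : enorm (t *: x) = `|t| * enorm x.
Proof.
rewrite /enorm -sqrtr_sqr -sqrtrM ?sqr_ge0//; congr Num.sqrt.
by rewrite mulr_sumr; apply: eq_bigr => i _; rewrite mxE exprMn.
Qed.

Lemma enormN x : enorm (- x) = enorm x.
Proof. by rewrite -scaleN1r enormZ normrN normr1 mul1r. Qed.

Lemma enorm_le_sum x : enorm x <= \sum_(i < d) `|x ord0 i|.
Proof.
have s0 : 0 <= \sum_(i < d) `|x ord0 i| by apply: sumr_ge0.
rewrite -(@ler_pXn2r _ 2) ?nnegrE ?enorm_ge0// enorm_sqr expr2 mulr_suml.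
apply: ler_sum => i _; rewrite -(real_normK (num_real (x ord0 i))) expr2.
by rewrite ler_wpM2l// (bigD1 i)//= lerDl sumr_ge0.
Qed.

Lemma eball0S r s : r <= s -> eball (0 : 'rV[R]_d) r `<=` eball 0 s.
Proof. by move=> rs x; rewrite !eball0E /= => /lt_le_trans; exact. Qed.

Lemma eball0D r s x h : enorm h <= s -> eball 0 r x -> eball 0 (r + s) (x + h).
Proof.
by move=> hs; rewrite !eball0E /= => xr; rewrite (le_lt_trans (enormD _ _))// ltr_leD.
Qed.

Lemma eball0_convex r x y (t : R) : 0 <= t <= 1 ->
  eball 0 r x -> eball 0 r y -> eball 0 r (x + t *: (y - x)).
Proof.
move=> /andP[t0 t1]; rewrite !eball0E /= => xr yr.
rewrite (_ : _ + _ = (1 - t) *: x + t *: y); last first.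
  by apply/rowP => i; rewrite !mxE; ring.
rewrite (le_lt_trans (enormD _ _))// !enormZ !ger0_norm ?subr_ge0//.
have [->|tn0] := eqVneq t 0; first by rewrite subr0 mul1r mul0r addr0.
rewrite (@le_lt_trans _ _ ((1 - t) * r + t * enorm y))//.
  by rewrite lerD2r ler_wpM2l ?subr_ge0// ltW.
rewrite (@lt_le_trans _ _ ((1 - t) * r + t * r))//.
  by rewrite ltrD2l ltr_pM2l// lt_neqAle eq_sym tn0.
by rewrite -mulrDl subrK mul1r.
Qed.

Lemma enorm_continuous : continuous enorm.
Proof.
move=> x; apply: continuous_comp; last exact: sqrt_continuous.
have -> : (fun x : 'rV[R]_d => \sum_(i < d) x ord0 i ^+ 2) =
    \sum_(i < d) (fun x : 'rV[R]_d => x ord0 i ^+ 2).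
  by apply/funext => y; rewrite fct_sumE.
apply: (@big_ind _ (fun f : 'rV[R]_d -> R => {for x, continuous f})).
- exact: cst_continuous.
- by move=> f g cf cg; exact: continuousD.
- move=> i _; rewrite (_ : (fun _ => _) =
    (fun x : 'rV[R]_d => x ord0 i * x ord0 i)); last by apply/funext.
  by apply: continuousM; exact: coord_continuous.
Qed.

Lemma eball0_open r : open (eball (0 : 'rV[R]_d) r).
Proof.
rewrite eball0E (_ : mkset _ = enorm @^-1` `]-oo, r[%classic); last first.
  by apply/seteqP; split => x; rewrite /= in_itv.
by apply: open_comp => [x _|]; [exact: enorm_continuous|exact: interval_open].
Qed.

Lemma measurable_eball0 r : measurable (eball (0 : 'rV[R]_d) r).
Proof. by apply: open_measurable_row; exact: eball0_open. Qed.

Lemma eball0_sub_closedbox r :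
  eball (0 : 'rV[R]_d) r `<=` closedbox (const_mx (- r)) (const_mx r).
Proof.
move=> x; rewrite eball0E /= => xr i; rewrite !mxE -ler_norml.
by rewrite (le_trans (coord_le_enorm x i))// ltW.
Qed.

(** Half-open boxes are the sets whose measure [lebesgue_row_box] computes. *)
Definition halfbox (a b : 'rV[R]_d) : set 'rV[R]_d :=
  [set x | forall i, a ord0 i < x ord0 i <= b ord0 i].

Lemma measurable_halfbox a b : measurable (halfbox a b).
Proof.
rewrite (_ : halfbox a b = \bigcap_(i in [set: 'I_d])
    ((fun x : 'rV[R]_d => x ord0 i) @^-1` `]a ord0 i, b ord0 i]%classic)).
  apply: fin_bigcap_measurable => // i _.
  by rewrite -[X in measurable X]setTI; exact: measurable_coord.
apply/seteqP; split => x /=.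
  by move=> xab i _ /=; rewrite in_itv/=; exact: xab.
by move=> xab i; have := xab i I; rewrite /= in_itv.
Qed.

Lemma lebesgue_cube (e : R) : 0 <= e ->
  mu (halfbox 0 (const_mx e)) = (e ^+ d)%:E.
Proof.
move=> e0; rewrite [LHS]lebesgue_row_box; last by move=> i; rewrite !mxE.
by under eq_bigr do rewrite !mxE subr0; rewrite prodr_const card_ord.
Qed.

Lemma eball0_lty r : (mu (eball 0 r) < +oo)%E.
Proof.
have [r0|r0] := ltP r 0.
  rewrite (_ : eball 0 r = set0) ?measure0//; apply/seteqP; split => // x.
  by rewrite eball0E/= => /(le_lt_trans (enorm_ge0 _)) /lt_trans/(_ r0); rewrite ltxx.
have rr i : const_mx (- r - 1) ord0 i <= (const_mx r : 'rV[R]_d) ord0 i.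
  by rewrite !mxE; lra.
apply: (@le_lt_trans _ _ (mu (halfbox (const_mx (- r - 1)) (const_mx r)))).
  apply: le_measure; rewrite ?inE//; first exact: measurable_eball0.
    exact: measurable_halfbox.
  move=> x /eball0_sub_closedbox xr i; have := xr i; rewrite !mxE => /andP[? ->].
  by rewrite andbT; lra.
by rewrite [X in (X < _)%E]lebesgue_row_box// ltry.
Qed.

Lemma cube_sub_eball0 r : 0 < r ->
  halfbox 0 (const_mx (r / (d.+1)%:R)) `<=` eball (0 : 'rV[R]_d) r.
Proof.
move=> r0 x xr; rewrite eball0E/= (le_lt_trans (enorm_le_sum x))//.
apply: (@le_lt_trans _ _ (\sum_(i < d) r / (d.+1)%:R)).
  apply: ler_sum => i _; have := xr i; rewrite !mxE => /andP[x0 x1].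
  by rewrite gtr0_norm.
rewrite sumr_const card_ord -[ltLHS]mulr_natr -mulrA gtr_pMr//.
by rewrite mulrC ltr_pdivrMr ?ltr0n// mul1r ltr_nat.
Qed.

Lemma eball0_gt0 r : 0 < r -> (0 < mu (eball 0 r))%E.
Proof.
move=> r0; have e0 : 0 < r / (d.+1)%:R by rewrite divr_gt0.
apply: (@lt_le_trans _ _ (mu (halfbox 0 (const_mx (r / (d.+1)%:R))))).
  by rewrite lebesgue_cube ?ltW// lte_fin exprn_gt0.
apply: le_measure; rewrite ?inE//; first exact: measurable_halfbox.
  exact: measurable_eball0.
exact: cube_sub_eball0.
Qed.

End euclidean_ball.

(** * Smooth bump functions *)

Section smooth_one_variable.
Context {R : realType}.
Implicit Types (f g : R -> R) (n m : nat).

Fixpoint ndiff n f : Prop :=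
  if n is n'.+1 then
    exists2 f', (forall x : R, is_derive x (1 : R) f (f' x)) & ndiff n' f'
  else True.

Lemma ndiffW n f : ndiff n.+1 f -> ndiff n f.
Proof.
elim: n f => [//|n IH] f /= [f' df [f'' df' nf'']].
by exists f' => //; apply: IH; exists f''.
Qed.

Lemma ndiff_lin n (a b : R) f g : ndiff n f -> ndiff n g ->
  ndiff n (fun x => a * f x + b * g x).
Proof.
elim: n f g => [//|n IH] f g /= [f' df nf'] [g' dg ng'].
exists (fun x => a * f' x + b * g' x); last exact: IH.
move=> x; have dfx := df x; have dgx := dg x.
by rewrite (_ : (fun x => _) = a \*: f + b \*: g); [exact: is_deriveD|exact/funext].
Qed.

Lemma ndiffM n f g : ndiff n f -> ndiff n g -> ndiff n (fun x => f x * g x).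
Proof.
elim: n f g => [//|n IH] f g nf ng; have nf1 := ndiffW nf; have ng1 := ndiffW ng.
case: nf ng => [f' df nf'] [g' dg ng'] /=.
exists (fun x => 1 * (f x * g' x) + 1 * (g x * f' x)).
  by move=> x; rewrite !mul1r; have dfx := df x; have dgx := dg x; exact: is_deriveM.
by apply: ndiff_lin; exact: IH.
Qed.

Lemma ndiff_affine n (c b : R) f : ndiff n f -> ndiff n (fun x => f (c * x + b)).
Proof.
elim: n f => [//|n IH] f /= [f' df nf'].
exists (fun x => c * f' (c * x + b) + 0 * f' (c * x + b)).
  move=> x; rewrite mul0r addr0 [c * f' _]mulrC.
  have daff : is_derive x (1 : R) (fun x : R => c * x + b) c.
    rewrite (_ : (fun x => _) = c \*: id + cst b); last exact/funext.
    by apply: is_derive_eq; rewrite addr0 /GRing.scale/= mulr1.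
  have dfx := df (c * x + b).
  exact: (@is_derive1_comp _ f (fun x => c * x + b) x _ _ dfx daff).
by apply: ndiff_lin; exact: IH.
Qed.

(** The functions x^-m exp(-1/x) span a space that is stable under
    differentiation; this is how smoothness at 0 propagates to all orders. *)
Definition expinv m : R -> R :=
  fun x => if 0 < x then x^-1 ^+ m * expR (- x^-1) else 0.

(** Quadratic smallness at 0, from exp(y) >= y^(m+2) / (m+2)!, gives the derivative
    at the gluing point. *)
Lemma expinv_sqr_bound m (x : R) : `|expinv m x| <= (m.+2)`!%:R * x ^+ 2.
Proof.
rewrite /expinv; case: ifPn => x0; last by rewrite normr0 mulr_ge0 ?sqr_ge0.
have y0 : 0 < x^-1 by rewrite invr_gt0.
rewrite ger0_norm; last by rewrite mulr_ge0 ?expR_ge0// exprn_ge0// ltW.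
rewrite expRN ler_pdivrMr ?expR_gt0//.
have := @expR_ge1Dxn R _ m.+1 (ltW y0).
set f := (m.+2)`!%:R; have f0 : 0 < f :> R by rewrite ltr0n fact_gt0.
move=> e1; have {}e1 : x^-1 ^+ m.+2 <= f * expR x^-1.
  by rewrite -ler_pdivrMl// mulrC (le_trans _ e1)// lerDr.
rewrite mulrAC -ler_pdivrMr ?exprn_gt0// -exprVn -exprD addn2.
exact: e1.
Qed.

Lemma is_derive_expinv m (x : R) :
  is_derive x (1 : R) (expinv m) (1 * expinv m.+2 x + (- m%:R) * expinv m.+1 x).
Proof.
have [x0|x0|->] := ltgtP x 0.
- apply: (@near_eq_is_derive _ _ _ (cst 0)); last first.
    apply: is_derive_eq.
    by rewrite /expinv ltNge (ltW x0)/= !mulr0 addr0.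
  by near=> y; rewrite /expinv ltNge (_ : y <= 0)//; apply: ltW; near: y;
    exact: lt_nbhsl.
- apply: (@near_eq_is_derive _ _ _ (fun y : R => y^-1 ^+ m * expR (- y^-1))).
    near=> y; rewrite /expinv (_ : 0 < y)//; near: y; exact: lt_nbhsr.
  rewrite /expinv x0.
  have dinv : is_derive x (1 : R) (fun y : R => y^-1) (- x^-1 ^+ 2).
    have xn0 : (id x : R) != 0 by rewrite gt_eqF.
    apply: (is_derive_eq (is_deriveV xn0 _)).
    by rewrite /GRing.scale/= mulr1 exprVn.
  have dX : is_derive x (1 : R) (fun y : R => y^-1 ^+ m)
      ((m%:R * x^-1 ^+ m.-1) *: - x^-1 ^+ 2).
    rewrite -(exprfctE (fun y : R => y^-1) m).
    exact: (@is_deriveX _ _ (fun y : R => y^-1) m).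
  have dE : is_derive x (1 : R) (fun y : R => expR (- y^-1))
      (expR (- x^-1) * (- (- x^-1 ^+ 2))).
    exact: (@is_derive1_comp _ expR (fun y => - y^-1) x).
  apply: (is_derive_eq (is_deriveM dX dE)).
  rewrite /GRing.scale/=; case: m {dX} => [|m] /=; first by ring.
  by rewrite !exprS; ring.
- have -> : 1 * expinv m.+2 0 + - m%:R * expinv m.+1 0 = 0 :> R.
    by rewrite /expinv ltxx !mulr0 addr0.
  have lim0 : h^-1 *: ((expinv m \o shift 0) (h *: 1) - expinv m 0) @[h --> 0^']
      --> (0 : R).
    apply: (@cvg_to_0_linear _ _ (m.+2)`!%:R 1) => // r /andP[r0 _].
    rewrite /= /expinv ltxx subr0 addr0 /GRing.scale/= mulr1 -/(expinv m r).
    rewrite normrM normfV ler_pdivrMl// mulrCA -expr2 real_normK ?num_real//.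
    exact: expinv_sqr_bound.
  apply: DeriveDef; first by apply/cvg_ex; exists 0.
  by apply/cvg_lim.
Unshelve. all: by end_near. Qed.

Lemma ndiff_expinv n m : ndiff n (expinv m).
Proof.
elim: n m => [//|n IH] m /=.
exists (fun x => 1 * expinv m.+2 x + (- m%:R) * expinv m.+1 x).
  exact: is_derive_expinv.
by apply: ndiff_lin; exact: IH.
Qed.

End smooth_one_variable.

Section bump.
Context {R : realType}.

Definition smooth1 (f : R -> R) := forall n, ndiff n f.

Lemma smooth1_derive (f : R -> R) : smooth1 f ->
  exists2 f', (forall x, is_derive x (1 : R) f (f' x)) & smooth1 f'.
Proof.
move=> sf; have [f' df _] := sf 1%N; exists f' => // n.
have [g dg ng] := sf n.+1; rewrite (_ : f' = g)//; apply/funext => x.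
by have dfx := df x; have dgx := dg x; rewrite -(derive_val (df := f' x))
  (derive_val (df := g x)).
Qed.

Lemma smooth1_continuous (f : R -> R) : smooth1 f -> continuous f.
Proof.
move=> /smooth1_derive[f' df _] x; have dfx := df x.
by apply: differentiable_continuous; apply/derivable1_diffP.
Qed.

(** As n grows these bumps increase to the indicator of the interval. *)
Definition smooth_bump (a b : R) n : R -> R :=
  fun s => expinv 0 (n.+1%:R * s + - (n.+1%:R * a)) *
           expinv 0 (- n.+1%:R * s + n.+1%:R * b).

Lemma smooth1_smooth_bump a b n : smooth1 (smooth_bump a b n).
Proof. by move=> k; apply: ndiffM; apply: ndiff_affine; exact: ndiff_expinv. Qed.

Lemma expinv0_itv (x : R) : 0 <= expinv 0 x <= 1.
Proof.
rewrite /expinv; case: ifPn => x0; last by rewrite lexx ler01.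
by rewrite expr0 mul1r expR_ge0 expR_le1 oppr_le0 invr_ge0 ltW.
Qed.

Lemma smooth_bump_itv a b n s : 0 <= smooth_bump a b n s <= 1.
Proof.
rewrite /smooth_bump; have /andP[x0 x1] := expinv0_itv (n.+1%:R * s + - (n.+1%:R * a)).
have /andP[y0 y1] := expinv0_itv (- n.+1%:R * s + n.+1%:R * b).
by rewrite mulr_ge0//= -[leRHS]mulr1 ler_pM.
Qed.

Lemma smooth_bumpE a b n s : smooth_bump a b n s =
  expinv 0 (n.+1%:R * (s - a)) * expinv 0 (n.+1%:R * (b - s)).
Proof. by rewrite /smooth_bump; congr (expinv _ _ * expinv _ _); ring. Qed.

Lemma smooth_bump_eq0 a b n s : ~~ (a < s < b) -> smooth_bump a b n s = 0.
Proof.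
rewrite smooth_bumpE /expinv !pmulr_rgt0// !subr_gt0 negb_and => /orP[/negbTE->|/negbTE->];
  by rewrite ?mul0r ?mulr0.
Qed.

Lemma expinv0_cvg (c : R) : 0 < c -> expinv 0 (n.+1%:R * c) @[n --> \oo] --> (1 : R).
Proof.
move=> c0.
rewrite (_ : (fun n => _) = (fun n => expR (- (n.+1%:R^-1 * c^-1)))); last first.
  by apply/funext => n; rewrite /expinv mulr_gt0// expr0 mul1r invfM.
have : expR (- (n.+1%:R^-1 * c^-1)) @[n --> \oo] --> (expR (- (0 * c^-1)) : R).
  apply: continuous_cvg; first exact: continuous_expR.
  by apply: cvgN; apply: cvgMr_tmp; exact: cvg_harmonic.
by rewrite mul0r oppr0 expR0.
Qed.

Lemma smooth_bump_cvg a b s :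
  smooth_bump a b n s @[n --> \oo] --> ((a < s < b)%R%:R : R).
Proof.
have [sab|nsab] := boolP (a < s < b); last first.
  under eq_fun do rewrite smooth_bump_eq0//; exact: cvg_cst.
case/andP: sab => sa sb; under eq_fun do rewrite smooth_bumpE.
have : expinv 0 (n.+1%:R * (s - a)) * expinv 0 (n.+1%:R * (b - s)) @[n --> \oo]
    --> (1 * 1 : R) by apply: cvgM; apply: expinv0_cvg; rewrite subr_gt0.
by rewrite mulr1.
Qed.

End bump.

Section product_test_function.
Context {R : realType} {d : nat}.
Implicit Types (g : 'I_d -> R -> R) (a b x : 'rV[R]_d).

Definition prodfun g : 'rV[R]_d -> R := fun x => \prod_(j < d) g j (x ord0 j).

Lemma is_derive_prodfun g (i : 'I_d) (gi' : R -> R) x :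
  (forall s, is_derive s (1 : R) (g i) (gi' s)) ->
  is_derive x (delta_mx ord0 i) (prodfun g)
    (prodfun (fun j => if j == i then gi' else g j) x).
Proof.
move=> dgi; pose c := \prod_(j < d | j != i) g j (x ord0 j).
have -> : prodfun (fun j => if j == i then gi' else g j) x = c * gi' (x ord0 i).
  rewrite /prodfun (bigD1 i)//= eqxx mulrC; congr (_ * _).
  by apply: eq_bigr => j /negbTE ->.
have quotient : (fun h : R => h^-1 *: ((prodfun g \o shift x)
      (h *: delta_mx ord0 i) - prodfun g x)) =
    (fun h => c * (h^-1 *: ((g i \o shift (x ord0 i)) (h *: 1) - g i (x ord0 i)))).
  have prodE y : prodfun g y =
      g i (y ord0 i) * \prod_(j < d | j != i) g j (y ord0 j).
    by rewrite /prodfun (bigD1 i).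
  apply/funext => h; rewrite /= !prodE !mxE !eqxx/= mulr1.
  rewrite /GRing.scale/= mulr1 [RHS]mulrCA; congr (_ * _).
  rewrite mulrBr [c * _]mulrC [c * g i _]mulrC; congr (_ * _ - _).
  by apply: eq_bigr => j /negbTE ji; rewrite !mxE ji andbF mulr0 add0r.
have dgix := dgi (x ord0 i).
have lim_quotient : c * (h^-1 *: ((g i \o shift (x ord0 i)) (h *: 1)
    - g i (x ord0 i))) @[h --> 0^'] --> c * gi' (x ord0 i).
  apply: cvgMl_tmp; rewrite -(derive_val (df := gi' (x ord0 i))).
  exact: (ex_derive (df := gi' (x ord0 i))).
by apply: DeriveDef; rewrite /derivable ?/derive quotient;
  [apply/cvg_ex; eexists; exact: lim_quotient|apply/cvg_lim].
Qed.

Lemma prodfun_continuous g : (forall j, continuous (g j)) -> continuous (prodfun g).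
Proof.
move=> cg x; rewrite (_ : prodfun g =
    \prod_(j < d) (fun x : 'rV[R]_d => g j (x ord0 j))); last first.
  by apply/funext => y; rewrite fct_prodE.
apply: (@big_ind _ (fun f : 'rV[R]_d -> R => {for x, continuous f})).
- exact: cst_continuous.
- by move=> f h cf ch; exact: continuousM.
- by move=> j _; apply: continuous_comp; [exact: coord_continuous|exact: cg].
Qed.

Lemma smooth_prodfun g : (forall j, smooth1 (g j)) -> smooth (prodfun g).
Proof.
move=> sg s.
have [g' [sg' ->]] : exists g', (forall j, smooth1 (g' j)) /\
    foldr partial (prodfun g) s = prodfun g'.
  elim: s => [|i s [g' [sg' IH]]] /=; first by exists g.
  have [gi' dgi sgi'] := smooth1_derive (sg' i).
  exists (fun j => if j == i then gi' else g' j); split.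
    by move=> j; case: ifP.
  by rewrite IH; apply/funext => x; have dx := is_derive_prodfun x dgi;
    exact: derive_val.
split; first by apply: prodfun_continuous => j; exact: smooth1_continuous.
move=> i x; have [gi' dgi _] := smooth1_derive (sg' i).
by have dx := is_derive_prodfun x dgi; exact: ex_derive.
Qed.

(** Products of bumps are the only test functions that will be inserted in the
    definition of the weak gradient; they suffice because they approximate the
    indicators of boxes. *)
Lemma test_function_prodfun g a b (B : set 'rV[R]_d) :
  (forall j, smooth1 (g j)) ->
  (forall j s, ~~ (a ord0 j < s < b ord0 j) -> g j s = 0) ->
  closedbox a b `<=` B -> test_function B (prodfun g).
Proof.
move=> sg g0 abB; have sub : closure [set x | prodfun g x != 0] `<=` closedbox a b.
  rewrite [X in _ `<=` X](closure_id _).1; last exact: closedbox_closed.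
  apply: closure_subset => x /= gx.
  apply: openbox_sub_closedbox => j; apply: contraNT gx => /g0 gj0.
  by rewrite /prodfun (bigD1 j)//= gj0 mul0r.
split; [exact: smooth_prodfun| |exact: subset_trans abB].
by apply: subclosed_compact sub; [exact: closed_closure|exact: closedbox_compact].
Qed.

End product_test_function.

(** * Integrability on the product with the line *)

Section integrability_criteria.
Local Open Scope ereal_scope.

Lemma ge0_integrable d (T : measurableType d) (R : realType)
    (mu : {measure set T -> \bar R}) (D : set T) (f : T -> \bar R) :
  measurable_fun D f -> (forall x, D x -> 0 <= f x) ->
  \int[mu]_(x in D) f x < +oo -> mu.-integrable D f.
Proof.
move=> mf f0 foo; apply/integrableP; split => //.
by under eq_integral => x /set_mem Dx do rewrite gee0_abs ?f0//.
Qed.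

Lemma integrable_fubini_G d1 d2 (T1 : measurableType d1) (T2 : measurableType d2)
    (R : realType) (m1 : {sigma_finite_measure set T1 -> \bar R})
    (m2 : {sigma_finite_measure set T2 -> \bar R}) (f : T1 * T2 -> \bar R) :
  (m1 \x m2).-integrable setT f ->
  m2.-integrable setT (fun y => \int[m1]_x f (x, y)).
Proof.
move=> fi; have mf := measurable_int _ fi.
apply/integrableP; split; first exact: (measurable_fubini_G fi).
apply: le_lt_trans ((integrable21ltyP _ _ mf).1 fi).
apply: ge0_le_integral => //.
- by apply: measurableT_comp => //; exact: (measurable_fubini_G fi).
- apply: (measurable_fun_fubini_tonelli_G (abse \o f)) => //=.
  exact: measurableT_comp.
- move=> y _; apply: le_abse_integral => //; exact: measurableT_comp.
Qed.

End integrability_criteria.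

Section integrability.
Context {R : realType} {d : nat}.
Local Notation mu := (@lebesgue_row R d).
Local Notation lam := (@lebesgue_measure R).
Implicit Types (u f g : 'rV[R]_d -> R) (B : set 'rV[R]_d).

Lemma integrable_dominated f g (k : R) :
  measurable_fun setT f -> mu.-integrable setT (EFin \o g) ->
  (forall x, `|f x| <= k * `|g x|) -> mu.-integrable setT (EFin \o f).
Proof.
move=> mf ig fg.
have ikg : mu.-integrable setT (fun x => (k%:E * (g x)%:E)%E) by exact: integrableZl.
apply: (le_integrable _ _ _ ikg) => //; first exact/measurable_EFinP.
move=> x _; rewrite -EFinM !abse_EFin lee_fin (le_trans (fg x))// normrM.
by rewrite ler_wpM2r// ler_norm.
Qed.

Lemma L2_restrict_sqr_integrable B u : measurable B -> L2 B u ->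
  mu.-integrable setT (fun x => ((u \_ B) x ^+ 2)%:E).
Proof.
move=> mB [mu_ uoo]; have mU : measurable_fun setT (u \_ B).
  by apply/(measurable_restrictT _ mB).
apply/integrableP; split.
  by apply/measurable_EFinP; exact: measurable_funX.
rewrite integral_mkcond in uoo; apply: le_lt_trans uoo.
rewrite le_eqVlt; apply/orP; left; apply/eqP; apply: eq_integral => x _.
rewrite gee0_abs ?lee_fin ?sqr_ge0// /patch; case: ifP => // _.
by rewrite expr0n.
Qed.

Lemma integrable_indicator B : measurable B -> (mu B < +oo)%E ->
  mu.-integrable setT (EFin \o (\1_B : 'rV[R]_d -> R)).
Proof.
move=> mB Boo; apply/integrableP; split; first exact/measurable_EFinP.
rewrite (eq_integral (fun x => (\1_B x)%:E)) ?integral_indic ?setIT//.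
by move=> x _; rewrite /= ger0_norm.
Qed.

Lemma L2_restrict_integrable B u : measurable B -> (mu B < +oo)%E -> L2 B u ->
  mu.-integrable setT (EFin \o (u \_ B)).
Proof.
move=> mB Boo uB; have [mu_ _] := uB.
have mU : measurable_fun setT (u \_ B) by by apply/(measurable_restrictT _ mB).
have i1 : mu.-integrable setT
    (fun x => ((\1_B x)%:E + ((u \_ B) x ^+ 2)%:E)%E).
  by apply: integrableD => //; [exact: integrable_indicator|
    exact: L2_restrict_sqr_integrable].
apply: (le_integrable _ _ _ i1) => //; first exact/measurable_EFinP.
move=> x _; rewrite -EFinD /= lee_fin /patch indicE.
case: ifPn => xB; last by rewrite normr0.
rewrite [leRHS]ger0_norm ?addr_ge0 ?sqr_ge0// -[in leRHS]real_normK ?num_real//.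
have := sqr_ge0 (`|u x| - 1/2); rewrite /= mulr1n; nra.
Qed.

Lemma measurable_row_translate (e : 'rV[R]_d) :
  measurable_fun setT (fun p : 'rV[R]_d * measurableTypeR R => p.1 + (p.2 : R) *: e).
Proof.
apply: measurable_fun_row => i; rewrite (_ : (fun _ => _) =
    (fun p : 'rV[R]_d * measurableTypeR R => p.1 ord0 i + p.2 * e ord0 i)); last first.
  by apply/funext => p; rewrite !mxE.
apply: measurable_funD.
  by apply: (measurableT_comp (measurable_coord i)); exact: measurable_fst.
apply: measurable_funM; last exact: measurable_cst.
exact: measurable_snd.
Qed.

Lemma measurable_translate (e : 'rV[R]_d) f : measurable_fun setT f ->
  measurable_fun setT (fun p : 'rV[R]_d * measurableTypeR R => f (p.1 + (p.2 : R) *: e)).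
Proof. by move=> mf; apply: (measurableT_comp mf); exact: measurable_row_translate. Qed.

Lemma measurable_slice (e x : 'rV[R]_d) f : measurable_fun setT f ->
  measurable_fun setT (fun t : measurableTypeR R => f (x + (t : R) *: e)).
Proof.
move=> mf; have mline : measurable_fun setT
    (fun t : measurableTypeR R => x + (t : R) *: e).
  apply: measurable_fun_row => i; rewrite (_ : (fun _ => _) =
      (fun t : measurableTypeR R => x ord0 i + (t : R) * e ord0 i)); last first.
    by apply/funext => t; rewrite !mxE.
  apply: measurable_funD; first exact: measurable_cst.
  by apply: measurable_funM; [exact: measurable_id|exact: measurable_cst].
exact: (measurableT_comp mf mline).
Qed.

(** Integrals over [0, h] are written as integrals over the whole line with this
    weight, so that Fubini is applied to a product of whole spaces. *)
Definition I0 (h : R) : R -> R := \1_(`[0, h]%classic).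

Lemma I0E (h t : R) : I0 h t = (0 <= t <= h)%R%:R.
Proof. by rewrite /I0 indicE mem_setE in_itv. Qed.

Lemma I0_ge0 (h t : R) : 0 <= I0 h t.
Proof. by rewrite /I0 indicE. Qed.

Lemma measurable_I0 h :
  measurable_fun setT (fun p : 'rV[R]_d * measurableTypeR R => I0 h (p.2 : R)).
Proof.
have mI0 : measurable_fun setT (I0 h : measurableTypeR R -> R).
  by apply: measurable_indic; exact: measurable_itv.
by apply: (measurableT_comp mI0); exact: measurable_snd.
Qed.

Lemma integral_I0 (h : R) : 0 <= h -> (\int[lam]_t (I0 h t)%:E = h%:E)%E.
Proof.
move=> h0; transitivity (lam `[0%R, h]%classic).
  by rewrite integral_indic ?setIT//; exact: measurable_itv.
rewrite lebesgue_measure_itv/= lte_fin.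
by rewrite sube0; case: ltgtP h0 => // <-.
Qed.

Lemma integrable_translate (h : R) (e : 'rV[R]_d) f : 0 <= h ->
  mu.-integrable setT (EFin \o f) ->
  (mu \x lam)%E.-integrable setT
    (fun p => (f (p.1 + (p.2 : R) *: e) * I0 h p.2)%:E).
Proof.
move=> h0 fi; have /measurable_EFinP mf := measurable_int _ fi.
apply/integrable21ltyP.
  apply/measurable_EFinP; apply: measurable_funM; first exact: measurable_translate.
  exact: measurable_I0.
have slice t : (\int[mu]_x `|(f (x + (t : R) *: e) * I0 h t)%:E| =
    (I0 h t)%:E * \int[mu]_x `|(f x)%:E|)%E.
  rewrite (eq_integral (fun x : 'rV[R]_d =>
      ((I0 h t)%:E * `|(f (x + t *: e))%:E|)%E)); last first.
    move=> x _; rewrite /= normrM EFinM muleC; congr (_ * _)%E.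
    by rewrite ger0_norm.
  rewrite ge0_integralZl//; last 2 first.
  - apply: measurableT_comp => //; apply/measurable_EFinP.
    by apply: (measurableT_comp mf); exact: measurable_row_shift.
  - by rewrite lee_fin.
  rewrite (@ge0_integral_shift R d (t *: e) (fun x => `|(f x)%:E|%E))//.
  by apply: measurableT_comp => //; exact/measurable_EFinP.
under eq_integral do rewrite slice.
move/integrableP : fi => [_ fi].
have c0 : (0 <= \int[mu]_x `|(f x)%:E|)%E by exact: integral_ge0.
rewrite ge0_integralZr//; last 2 first.
- apply/measurable_EFinP; apply: measurable_indic; exact: measurable_itv.
- by move=> t _; rewrite lee_fin.
by rewrite integral_I0// lte_mul_pinfty// ltry.
Qed.

Lemma integrable_mul_translate (h k : R) (e : 'rV[R]_d) f g : 0 <= h ->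
  mu.-integrable setT (EFin \o g) -> measurable_fun setT f ->
  (forall x, `|f x| <= k) ->
  (mu \x lam)%E.-integrable setT
    (fun p => (f p.1 * (g (p.1 + (p.2 : R) *: e) * I0 h p.2))%:E).
Proof.
move=> h0 gi mf fk; have /measurable_EFinP mg := measurable_int _ gi.
have i0 : (mu \x lam)%E.-integrable setT
    (fun p => (k%:E * (g (p.1 + (p.2 : R) *: e) * I0 h p.2)%:E)%E).
  by apply: integrableZl => //; exact: integrable_translate.
apply: (le_integrable _ _ _ i0) => //.
  apply/measurable_EFinP; apply: measurable_funM.
    by apply: (measurableT_comp mf); exact: measurable_fst.
  by apply: measurable_funM; [exact: (measurable_translate e mg)|exact: measurable_I0].
move=> p _; rewrite /= lee_fin normrM [leRHS]normrM ler_wpM2r//.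
by rewrite (le_trans (fk _))// ler_norm.
Qed.

Lemma integrable_prod_bounded (h k : R) f
    (psi : 'rV[R]_d * measurableTypeR R -> R) : 0 <= h ->
  mu.-integrable setT (EFin \o f) -> measurable_fun setT psi ->
  (forall x t, f x != 0 -> 0 <= t <= h -> `|psi (x, t)| <= k) ->
  (mu \x lam)%E.-integrable setT (fun p => (f p.1 * psi p * I0 h p.2)%:E).
Proof.
move=> h0 fi mpsi psik; have /measurable_EFinP mf := measurable_int _ fi.
have i0 : (mu \x lam)%E.-integrable setT
    (fun p => (k%:E * (f (p.1 + (p.2 : R) *: 0) * I0 h p.2)%:E)%E).
  by apply: integrableZl => //; exact: integrable_translate.
apply: (le_integrable _ _ _ i0) => //.
  apply/measurable_EFinP; apply: measurable_funM; last exact: measurable_I0.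
  apply: measurable_funM => //; apply: (measurableT_comp mf); exact: measurable_fst.
move=> [x t] _ /=; rewrite lee_fin scaler0 addr0 /I0 indicE mem_setE in_itv/=.
have [th|_] := boolP (0 <= t <= h); last by rewrite !mulr0 normr0.
rewrite !mulr1 !normrM mulrC.
have [->|fx0] := eqVneq (f x) 0; first by rewrite !normr0 !mulr0.
by rewrite ler_wpM2r// (le_trans (psik _ _ fx0 th))// ler_norm.
Qed.

End integrability.

(** * Increments of a function as line integrals of its weak gradient *)

Section difference_identity.
Context {R : realType} {d : nat}.
Local Notation mu := (@lebesgue_row R d).
Local Notation lam := (@lebesgue_measure R).
Local Notation delta := (delta_mx ord0).

Lemma integral_mul_I0 (f : R -> R) (h : R) :
  (\int[lam]_t (f t * I0 h t)%:E = \int[lam]_(t in `[0%R, h]) (f t)%:E)%E.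
Proof.
rewrite [RHS]integral_mkcond; apply: eq_integral => t _.
by rewrite /I0 indicE /patch; case: ifP => _; rewrite ?mulr1 ?mulr0.
Qed.

Lemma integral_derivative_slice (f f' : R -> R) (s h : R) : 0 < h ->
  (forall x, is_derive x (1 : R) f (f' x)) -> continuous f' ->
  (\int[lam]_t (f' (s - t) * I0 h t)%:E = (f s - f (s - h))%:E)%E.
Proof.
move=> h0 df cf'; rewrite (integral_mul_I0 (fun t => f' (s - t))).
pose F t := - f (s - t).
have cs : continuous (fun t : R => s - t).
  by move=> x; apply: continuousB; [exact: cst_continuous|exact: cvg_id].
have dF t : is_derive t (1 : R) F (f' (s - t)).
  have ds : is_derive t (1 : R) (fun t : R => s - t) (- 1).
    rewrite (_ : (fun t => _) = cst s - id); last exact/funext.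
    by apply: is_derive_eq; rewrite sub0r.
  have dfs := df (s - t).
  have dc := @is_derive1_comp _ f (fun t : R => s - t) t _ _ dfs ds.
  have : is_derive t (1 : R) (- (f \o (fun t : R => s - t))) (- (f' (s - t) * -1)).
    exact: is_deriveN.
  by rewrite mulrN1 opprK.
have cF : continuous F.
  by move=> t; apply: differentiable_continuous; apply/derivable1_diffP; have := dF t;
    move=> dFt; exact: ex_derive.
rewrite (@continuous_FTC2 _ (fun t => f' (s - t)) F)//.
- by rewrite /F subr0 -EFinB opprK addrC.
- by apply: continuous_subspaceT => x; apply: continuous_comp; [exact: cs|exact: cf'].
- split; first by move=> x _; have dFx := dF x; exact: ex_derive.
  + exact/cvg_at_right_filter/cF.
  + exact/cvg_at_left_filter/cF.
- by move=> x _; have dFx := dF x; rewrite derive1E; exact: derive_val.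
Qed.

Lemma prodfun_update_slice (g : 'I_d -> R -> R) (f : R -> R) i (x : 'rV[R]_d) t :
  prodfun (fun j => if j == i then f else g j) (x + t *: delta i) =
  (\prod_(j < d | j != i) g j (x ord0 j)) * f (x ord0 i + t).
Proof.
rewrite /prodfun (bigD1 i)//= eqxx mulrC !mxE !eqxx mulr1; congr (_ * _).
by apply: eq_bigr => j /negbTE ji; rewrite ji !mxE ji andbF mulr0 addr0.
Qed.

Lemma prodfun_slice (g : 'I_d -> R -> R) i (x : 'rV[R]_d) t :
  prodfun g (x + t *: delta i) =
  (\prod_(j < d | j != i) g j (x ord0 j)) * g i (x ord0 i + t).
Proof.
rewrite -prodfun_update_slice; apply: eq_bigr => j _.
by case: eqP => [->|].
Qed.

Lemma enorm_delta (t : R) i : enorm (t *: delta i : 'rV[R]_d) = `|t|.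
Proof.
rewrite enormZ /enorm (bigD1 i)//= big1 => [|j /negbTE ji].
  by rewrite !mxE !eqxx addr0 expr1n sqrtr1 mulr1.
by rewrite !mxE ji andbF expr0n.
Qed.

Lemma integral_restrict_mul (B : set 'rV[R]_d) (u f : 'rV[R]_d -> R) :
  (\int[mu]_(x in B) (u x * f x)%:E = \int[mu]_x ((u \_ B) x * f x)%:E)%E.
Proof.
rewrite integral_mkcond; apply: eq_integral => x _.
by rewrite /patch; case: ifP => // _; rewrite mul0r.
Qed.

Variables (r0 h r : R) (u : 'rV[R]_d -> R) (G : 'I_d -> 'rV[R]_d -> R) (i : 'I_d).
Hypotheses (uG : weak_gradient (eball 0 r0) u G) (h0 : 0 < h) (rhr : r + h <= r0).

Let B : set 'rV[R]_d := eball 0 r0.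
Let U := u \_ B.
Let D := G i \_ B.

Let mB : measurable B. Proof. exact: measurable_eball0. Qed.

Let Boo : (mu B < +oo)%E. Proof. exact: eball0_lty. Qed.

Let U_int : mu.-integrable setT (EFin \o U).
Proof. by have [uL2 _ _] := uG; exact: L2_restrict_integrable. Qed.

Let D_int : mu.-integrable setT (EFin \o D).
Proof. by have [_ GL2 _] := uG; exact: L2_restrict_integrable. Qed.

Let mU : measurable_fun setT U.
Proof. by have /measurable_EFinP := measurable_int _ U_int. Qed.

Let mD : measurable_fun setT D.
Proof. by have /measurable_EFinP := measurable_int _ D_int. Qed.

Section tested.
Variables (g : 'I_d -> R -> R) (a b : 'rV[R]_d) (gi' : R -> R).
Hypotheses (sg : forall j, smooth1 (g j))
  (g01 : forall j s, 0 <= g j s <= 1)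
  (g0 : forall j s, ~~ (a ord0 j < s < b ord0 j) -> g j s = 0)
  (abr : closedbox a b `<=` eball 0 r)
  (dgi : forall s, is_derive s (1 : R) (g i) (gi' s)) (cgi' : continuous gi').

Let f := prodfun g.
Let f' := prodfun (fun j => if j == i then gi' else g j).

(* Moving the bump by t <= h keeps its support in the ball since r + h <= r0. *)
Let weak_shifted (t : R) : 0 <= t <= h ->
  (\int[mu]_x (U x * f' (x - t *: delta i))%:E =
   - \int[mu]_x (D x * f (x - t *: delta i))%:E)%E.
Proof.
move=> /andP[t0 th].
pose gt j s := if j == i then g i (s - t) else g j s.
have sgt j : smooth1 (gt j).
  rewrite /gt; case: eqP => _ // n.
  have := @ndiff_affine R n 1 (- t) _ (sg i n).
  by under eq_fun do rewrite mul1r.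
have ftE : prodfun gt = fun x => f (x - t *: delta i).
  apply/funext => x; rewrite /f -scaleNr prodfun_slice /prodfun (bigD1 i)//= mulrC.
  rewrite /gt eqxx; congr (_ * _); apply: eq_bigr => j /negbTE ji.
  by rewrite ji.
have dgti s : is_derive s (1 : R) (gt i) (gi' (s - t)).
  rewrite (_ : gt i = g i \o (fun s : R => s - t)); last first.
    by apply/funext => s'; rewrite /gt eqxx.
  have ds : is_derive s (1 : R) (fun s : R => s - t) 1.
    rewrite (_ : (fun s => _) = id - cst t); last exact/funext.
    by apply: is_derive_eq; rewrite subr0.
  have dgs := dgi (s - t).
  by have := @is_derive1_comp _ (g i) (fun s : R => s - t) s _ _ dgs ds; rewrite mulr1.
have [_ _ /(_ (prodfun gt))] := uG.
have tst : test_function (eball 0 r0) (prodfun gt).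
  apply: (@test_function_prodfun R d gt (a + t *: delta i) (b + t *: delta i)) => //.
    move=> j s; rewrite /gt !mxE eqxx/=; case: eqP => [->|_].
      rewrite mulr1 => st; apply: g0; apply: contra st => /andP[? ?].
      by apply/andP; split; lra.
    by rewrite mulr0 !addr0; exact: g0.
  move=> x xab; have : closedbox a b (x - t *: delta i).
    move=> j; have := xab j; rewrite !mxE; move: (t * _) => c.
    by rewrite lerBrDr lerBlDr.
  move/abr => xr; have rtr0 : r + t <= r0 by rewrite (le_trans _ rhr)// lerD2l.
apply: (eball0S rtr0).
  rewrite -(subrK (t *: delta i) x); apply: eball0D => //.
  by rewrite enorm_delta ger0_norm.
move=> /(_ tst i).
have -> : partial i (prodfun gt) = fun x => f' (x - t *: delta i).
  apply/funext => x; have dx := is_derive_prodfun x dgti.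
  rewrite [LHS](derive_val (is_derive := dx)) /f' -scaleNr prodfun_update_slice.
  rewrite /prodfun (bigD1 i)//= eqxx mulrC; congr (_ * _).
  by apply: eq_bigr => j /negbTE ji; rewrite ji /gt ji.
by rewrite ftE (integral_restrict_mul _ u) (integral_restrict_mul _ (G i)).
Qed.

Let f_bound x : `|f x| <= 1.
Proof.
rewrite /f /prodfun normr_prod; apply: prodr_ile1 => j _.
by have /andP[g0' g1] := g01 j (x ord0 j); rewrite ger0_norm// g0' g1.
Qed.

Let cf : continuous f.
Proof. by apply: prodfun_continuous => j; exact: smooth1_continuous. Qed.

Let cf' : continuous f'.
Proof. by apply: prodfun_continuous => j; case: eqP => // _; exact: smooth1_continuous. Qed.

Let mf : measurable_fun setT f. Proof. exact: continuous_measurable_row. Qed.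

Let mf' : measurable_fun setT f'. Proof. exact: continuous_measurable_row. Qed.

Let f'_bound : exists k, forall x (t : R), U x != 0 -> 0 <= t <= h ->
  `|f' (x - t *: delta i)| <= k.
Proof.
have [k kf'] : exists k, forall x,
    closedbox (const_mx (- (r0 + h))) (const_mx (r0 + h)) x -> `|f' x| <= k.
  have /compact_bounded : compact (f' @` (closedbox (const_mx (- (r0 + h)))
      (const_mx (r0 + h)))).
    apply: continuous_compact; last exact: closedbox_compact.
    exact: continuous_subspaceT.
  move=> [k [_ kf']]; exists (k + 1) => x xr; apply: (kf' (k + 1)); first by lra.
  by exists x.
exists k => x t; rewrite /U /patch; case: ifPn; last by rewrite eqxx.
rewrite inE => xB _ /andP[t0 th]; apply: kf'; apply: eball0_sub_closedbox.
by apply: eball0D => //; rewrite -scaleNr enorm_delta normrN ger0_norm.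
Qed.

(** Integrate the weak identity for the shifted test functions over t in [0, h].  On
    the side of U the t-integral of the derivative of f is a difference of values of
    f; on the side of D the shift is moved from f to D. *)
Lemma tested_difference :
  (\int[mu]_x ((U (x + h *: delta i) - U x) * f x)%:E =
   \int[mu]_x \int[lam]_t (f x * (D (x + t *: delta i) * I0 h t))%:E)%E.
Proof.
have h0' := ltW h0.
have [k kf'] := f'_bound.
pose F1 (p : 'rV[R]_d * measurableTypeR R) :=
  (U p.1 * f' (p.1 - (p.2 : R) *: delta i) * I0 h p.2)%:E.
pose F2 (p : 'rV[R]_d * measurableTypeR R) :=
  (f p.1 * (D (p.1 + (p.2 : R) *: delta i) * I0 h p.2))%:E.
have iF1 : (mu \x lam)%E.-integrable setT F1.
  apply: (@integrable_prod_bounded R d h k U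
    (fun p => f' (p.1 - (p.2 : R) *: delta i))) => //.
  have := measurable_translate (- delta i : 'rV[R]_d) mf'.
  by under eq_fun do rewrite scalerN.
have iF2 : (mu \x lam)%E.-integrable setT F2 by exact: integrable_mul_translate.
have slices t : (\int[mu]_x F1 (x, t) = - \int[mu]_x F2 (x, t))%E.
  rewrite /F1 /F2 /=; have [th|nth] := boolP (0 <= (t : R) <= h); last first.
    have I0t : I0 h t = 0 by rewrite /I0 indicE mem_setE in_itv/= (negbTE nth).
    under eq_integral do rewrite I0t mulr0.
    by under [in RHS]eq_integral do rewrite I0t !mulr0; rewrite integral0 oppe0.
  have I0t : I0 h t = 1 by rewrite /I0 indicE mem_setE in_itv/= th.
  under eq_integral do rewrite I0t mulr1; rewrite weak_shifted//; congr (- _)%E.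
  have Df : mu.-integrable setT (fun x => (D x * f (x - (t : R) *: delta i))%:E).
    apply: (@integrable_dominated R d _ D 1) => //.
      apply: measurable_funM => //; apply: (measurableT_comp mf).
      exact: measurable_row_shift.
    by move=> x; rewrite normrM mulrC ler_wpM2r.
  rewrite -(integral_shift ((t : R) *: delta i) Df); apply: eq_integral => x _.
  by rewrite addrK I0t mulr1 mulrC.
have := Fubini iF1; under [in RHS]eq_integral do rewrite slices.
rewrite (integralN (integrable_add_def measurableT (integrable_fubini_G iF2))).
rewrite -(Fubini iF2) => fub.
have lhs x : (\int[lam]_t F1 (x, t) = (U x * f x - U x * f (x - h *: delta i))%:E)%E.
  pose c := \prod_(j < d | j != i) g j (x ord0 j).
  have dcg s : is_derive s (1 : R) (fun s => U x * c * g i s) (U x * c * gi' s).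
    have dgs := dgi s; rewrite (_ : (fun s => _) = (U x * c) \*: g i); last exact/funext.
    exact: is_deriveZ.
  have cgc : continuous (fun s => U x * c * gi' s).
    by move=> s; apply: cvgMl_tmp; exact: cgi'.
  have fh : f (x - h *: delta i) = c * g i (x ord0 i - h).
    by rewrite /f -scaleNr prodfun_slice.
  have f0 : f x = c * g i (x ord0 i) by rewrite /f /prodfun (bigD1 i)//= mulrC.
  rewrite fh f0 !mulrA -(integral_derivative_slice (x ord0 i) h0 dcg cgc).
  apply: eq_integral => t _; rewrite /F1/= /f' -scaleNr prodfun_update_slice -/c.
  by rewrite !mulrA.
move: fub; under eq_integral do rewrite lhs.
have iUf : mu.-integrable setT (fun x => (U x * f x)%:E).
  apply: (@integrable_dominated R d _ U 1) => //; first exact: measurable_funM.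
  by move=> x; rewrite normrM mulrC ler_wpM2r.
have iUf' : mu.-integrable setT (fun x => (U x * f (x - h *: delta i))%:E).
  apply: (@integrable_dominated R d _ U 1) => //.
    apply: measurable_funM => //; apply: (measurableT_comp mf).
    exact: measurable_row_shift.
  by move=> x; rewrite normrM mulrC ler_wpM2r.
have iUhf : mu.-integrable setT (fun x => (U (x + h *: delta i) * f x)%:E).
  have := integrable_shift (h *: delta i) iUf'.
  by apply: eq_integrable => // x _; rewrite addrK.
under eq_integral do rewrite EFinB.
rewrite integralB// -(integral_shift (h *: delta i) iUf').
under [X in (_ - X)%E]eq_integral do rewrite addrK.
under [in X in _ -> X]eq_integral do rewrite mulrBl EFinB.
rewrite (integralB measurableT iUhf iUf) => fub.
have fin1 := integrable_fin_num measurableT iUf.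
have fin2 := integrable_fin_num measurableT iUhf.
apply: oppe_inj; rewrite -[RHS]fub; move: fin1 fin2; clear.
move: (\int[mu]_x (U x * f x)%:E)%E (\int[mu]_x (U (x + h *: delta i) * f x)%:E)%E.
by move=> p q p_fin q_fin; rewrite fin_num_oppeB// addeC.
Qed.

End tested.

Let V (x : 'rV[R]_d) : R := U (x + h *: delta i) - U x.

Let K (x : 'rV[R]_d) : \bar R := (\int[lam]_t (D (x + (t : R) *: delta i) * I0 h t)%:E)%E.

Let Kr (x : 'rV[R]_d) : R := fine (K x).

Let V_int : mu.-integrable setT (EFin \o V).
Proof.
have := integrableB measurableT (integrable_shift (h *: delta i) U_int) U_int.
by apply: eq_integrable => // x _; rewrite /= -EFinB.
Qed.

Let DI_int := integrable_translate (delta i : 'rV[R]_d) (ltW h0) D_int.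

Let K_int : mu.-integrable setT K.
Proof. exact: (integrable_fubini_F DI_int). Qed.

Let mK : measurable_fun setT K. Proof. exact: measurable_int K_int. Qed.

Let Kr_int : mu.-integrable setT (EFin \o Kr).
Proof.
apply: (le_integrable _ _ _ K_int) => //.
  by apply/measurable_EFinP; apply: (measurableT_comp _ mK).
by move=> x _; rewrite /Kr /=; case: (K x) => [s| |] //=; rewrite normr0 leey.
Qed.

Let K_fin : {ae mu, forall x, K x = (Kr x)%:E}.
Proof.
have := integrable_ae measurableT K_int; apply: filterS => x /(_ I) Kx.
by rewrite /Kr fineK.
Qed.

Let boxbump (a b : 'rV[R]_d) n : 'rV[R]_d -> R :=
  prodfun (fun j : 'I_d => smooth_bump (a ord0 j) (b ord0 j) n).

Let boxbump_le1 (a b : 'rV[R]_d) n x : `|boxbump a b n x| <= 1.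
Proof.
rewrite normr_prod; apply: prodr_ile1 => j _.
have /andP[g0' g1] := smooth_bump_itv (a ord0 j) (b ord0 j) n (x ord0 j).
by rewrite ger0_norm// g0' g1.
Qed.

Let measurable_boxbump (a b : 'rV[R]_d) n : measurable_fun setT (boxbump a b n).
Proof.
apply: continuous_measurable_row; apply: prodfun_continuous => j.
by apply: smooth1_continuous; exact: smooth1_smooth_bump.
Qed.

Let tested_fine (a b : 'rV[R]_d) n : closedbox a b `<=` eball 0 r ->
  let f := boxbump a b n in
  (\int[mu]_x (V x * f x)%:E = \int[mu]_x (Kr x * f x)%:E)%E.
Proof.
move=> abr f; have [gi' dgi sgi'] := smooth1_derive
  (@smooth1_smooth_bump R (a ord0 i) (b ord0 i) n).
have sg j := @smooth1_smooth_bump R (a ord0 j) (b ord0 j) n.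
have mf : measurable_fun setT f by exact: measurable_boxbump.
have := @tested_difference _ a b gi' sg (fun j s => smooth_bump_itv (a ord0 j) (b ord0 j) n s)
  (fun j s => @smooth_bump_eq0 R (a ord0 j) (b ord0 j) n s) abr dgi (smooth1_continuous sgi').
rewrite -/f => ->.
have iKf : mu.-integrable setT (fun x => (Kr x * f x)%:E).
  apply: (@integrable_dominated R d _ Kr 1) => //.
    apply: measurable_funM => //; exact: (measurableT_comp _ mK).
  by move=> x; rewrite normrM mulrC ler_wpM2r// boxbump_le1.
have fKf : {ae mu, forall x, (\int[lam]_t
    (f x * (D (x + (t : R) *: delta i) * I0 h t))%:E = (Kr x * f x)%:E)%E}.
  have := ae_integrable1 DI_int; apply: filterS2 K_fin => x Kx ix /=.
  transitivity ((f x)%:E * K x)%E; last by rewrite Kx -EFinM mulrC.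
  by rewrite -(integralZl measurableT ix); apply: eq_integral => t _; rewrite -?EFinM.
apply: ae_eq_integral => //.
- have iF := integrable_mul_translate (delta i) (ltW h0) D_int mf
    (boxbump_le1 a b n).
  exact: (measurable_int _ (integrable_fubini_F iF)).
- exact: measurable_int iKf.
- by apply: filterS fKf => x + _.
Qed.

Let box_limit (f : 'rV[R]_d -> R) (a b : 'rV[R]_d) :
  mu.-integrable setT (EFin \o f) ->
  (\int[mu]_x (f x * boxbump a b n x)%:E)%E
    @[n --> \oo] --> (\int[mu]_(x in openbox a b) (f x)%:E)%E.
Proof.
move=> fi; have /measurable_EFinP mf := measurable_int _ fi.
have [||||| _ _] := @dominated_convergence _ _ _ mu setT measurableT
  (fun n x => (f x * boxbump a b n x)%:E)
  (fun x => (f x * \1_(openbox a b) x)%:E) (fun x => `|(f x)%:E|%E).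
- by move=> n; apply/measurable_EFinP; apply: measurable_funM.
- apply/measurable_EFinP; apply: measurable_funM => //; apply: measurable_indic.
  exact: measurable_openbox.
- apply: aeW => x _; apply: cvg_EFin; first by near=> n.
  apply: cvgMl_tmp; rewrite indicE.
  have -> : (x \in openbox a b)%:R =
      \prod_(j < d) (a ord0 j < x ord0 j < b ord0 j)%R%:R :> R.
    have [/set_mem xab|/negP xab] := boolP (x \in openbox a b).
      by rewrite big1// => j _; rewrite xab.
    have [/forallP all|/forallPn[j xj]] :=
      boolP [forall j, a ord0 j < x ord0 j < b ord0 j].
      by exfalso; apply: xab; rewrite inE.
    by rewrite (bigD1 j)//= (negbTE xj) mul0r.
  rewrite /boxbump /prodfun; elim: (index_enum _) => [|j s IH].
    by under eq_fun do rewrite big_nil; rewrite big_nil; exact: cvg_cst.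
  under eq_fun do rewrite big_cons; rewrite big_cons; apply: cvgM => //.
  exact: smooth_bump_cvg.
- exact: integrable_abse.
- by apply: aeW => x n _; rewrite /= lee_fin normrM ler_piMr// boxbump_le1.
rewrite [X in _ --> X -> _](_ : _ = \int[mu]_(x in openbox a b) (f x)%:E)%E//.
rewrite [RHS]integral_mkcond; apply: eq_integral => x _.
by rewrite indicE /patch; case: ifP => _; rewrite ?mulr1 ?mulr0.
Unshelve. all: by end_near. Qed.

(** The fundamental theorem of calculus along an axis, for almost every starting
    point.  Both sides have the same integral against every product of bumps, hence
    over every box, so that no representative of U that is absolutely continuous on
    lines has to be constructed. *)
Lemma difference_identity : {ae mu, forall x, eball 0 r x ->
  (U (x + h *: delta i) - U x)%:E =
  (\int[lam]_t (D (x + (t : R) *: delta i) * I0 h t)%:E)%E}.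
Proof.
have VK : ae_eq mu (eball 0 r) (EFin \o V) (EFin \o Kr).
  apply: ae_eq_open; first exact: eball0_open.
  - by apply: integrableS V_int => //; exact: measurable_eball0.
  - by apply: integrableS Kr_int => //; exact: measurable_eball0.
  - move=> a b abr; have limV := @box_limit V a b V_int; have limK := @box_limit Kr a b Kr_int.
    rewrite -(cvg_lim _ limV)// -(cvg_lim _ limK)//.
    by under eq_fun do rewrite tested_fine//.
by apply: filterS2 VK K_fin => x VKx Kx xr; have := VKx xr; rewrite /= -Kx.
Qed.

End difference_identity.

(** * Translations and the Dirichlet energy *)

Section translation_estimate.
Context {R : realType} {d : nat}.
Local Notation mu := (@lebesgue_row R d).
Local Notation lam := (@lebesgue_measure R).
Local Notation delta := (delta_mx ord0).

Lemma cauchy_schwarz_interval (g : R -> R) (h c : R) : 0 < h ->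
  measurable_fun setT g -> (c%:E = \int[lam]_t (g t * I0 h t)%:E)%E ->
  ((c ^+ 2)%:E <= h%:E * \int[lam]_t (g t ^+ 2 * I0 h t)%:E)%E.
Proof.
move=> h0 mg cE; have mI0 : measurable_fun setT (I0 h : measurableTypeR R -> R).
  by apply: measurable_indic; exact: measurable_itv.
have I00 t : 0 <= I0 h t by rewrite /I0 indicE.
have g2 : (0 <= \int[lam]_t (g t ^+ 2 * I0 h t)%:E)%E.
  by apply: integral_ge0 => t _; rewrite lee_fin mulr_ge0// sqr_ge0.
have mg2 : measurable_fun setT (fun t => (g t ^+ 2 * I0 h t)%:E).
  by apply/measurable_EFinP; apply: measurable_funM => //; exact: measurable_funX.
have [goo|gfin] := eqVneq (\int[lam]_t (g t ^+ 2 * I0 h t)%:E)%E +oo%E.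
  by rewrite goo gt0_muley ?lte_fin// leey.
have ig2 : lam.-integrable setT (fun t => (g t ^+ 2 * I0 h t)%:E).
  apply: ge0_integrable => //; last by rewrite ltey.
  by move=> t _; rewrite lee_fin mulr_ge0// sqr_ge0.
have iI0 : lam.-integrable setT (fun t => (I0 h t)%:E).
  apply: ge0_integrable; first exact/measurable_EFinP.
    by move=> t _; rewrite lee_fin.
  by rewrite integral_I0 ?ltry// ltW.
have ig : lam.-integrable setT (fun t => (g t * I0 h t)%:E).
  apply: (le_integrable _ _ _ (integrableD measurableT ig2 iI0)) => //.
    by apply/measurable_EFinP; exact: measurable_funM.
  move=> t _; rewrite -EFinD /= lee_fin normrM [leRHS]ger0_norm; last first.
    by rewrite addr_ge0// mulr_ge0// sqr_ge0.
  rewrite (ger0_norm (I00 t)) -[X in _ + X]mul1r -mulrDl ler_wpM2r//.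
  by rewrite -real_normK ?num_real//; have := sqr_ge0 (`|g t| - 1); nra.
(* integrate 2 l g <= g^2 + l^2 with l the mean value c / h *)
pose l := c / h.
have : (\int[lam]_t ((2 * l)%:E * (g t * I0 h t)%:E) <=
    \int[lam]_t ((g t ^+ 2 * I0 h t)%:E + (l ^+ 2)%:E * (I0 h t)%:E))%E.
  apply: le_integral => //.
  - exact: integrableZl.
  - by apply: integrableD => //; exact: integrableZl.
  - move=> t _; rewrite -!EFinM -EFinD lee_fin mulrA -mulrDl ler_wpM2r//.
    by have := sqr_ge0 (g t - l); nra.
rewrite integralZl// -cE integralD//; last exact: integrableZl.
rewrite integralZl// integral_I0 ?(ltW h0)//.
move: gfin g2; case: (\int[lam]_t (g t ^+ 2 * I0 h t)%:E)%E => [s| |]// _ _.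
rewrite -!EFinM -EFinD !lee_fin /l => le_s.
have -> : c ^+ 2 = h * (2 * (c / h) * c - (c / h) ^+ 2 * h) by field; rewrite gt_eqF.
by rewrite ler_pM2l// lerBlDr.
Qed.

Lemma sum_sqr_le (a : 'I_d -> R) :
  (\sum_i a i) ^+ 2 <= d%:R * \sum_i a i ^+ 2.
Proof.
have bound (b : 'I_d -> R) :
    \sum_i b i <= enorm (\row_i b i : 'rV[R]_d) * Num.sqrt d%:R.
  have := dot_le_enorm (\row_i b i) (const_mx 1 : 'rV[R]_d).
  under eq_bigr do rewrite !mxE mulr1.
  congr (_ <= _ * _); rewrite /enorm; congr Num.sqrt.
  by under eq_bigr do rewrite mxE expr1n; rewrite sumr_const card_ord.
have na : \row_i (- a i) = - \row_i a i :> 'rV[R]_d.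
  by apply/rowP => i; rewrite !mxE.
have : `|\sum_i a i| <= enorm (\row_i a i : 'rV[R]_d) * Num.sqrt d%:R.
  rewrite ler_norml bound andbT lerNl -sumrN (le_trans (bound _))//.
  by rewrite na enormN.
rewrite -(@ler_pXn2r _ 2) ?nnegrE ?mulr_ge0 ?enorm_ge0 ?sqrtr_ge0//.
rewrite real_normK ?num_real// exprMn enorm_sqr sqr_sqrtr// mulrC.
by under [X in _ <= _ * X -> _]eq_bigr do rewrite mxE.
Qed.

Variables (r0 : R) (u : 'rV[R]_d -> R) (G : 'I_d -> 'rV[R]_d -> R).
Hypothesis uG : weak_gradient (eball 0 r0) u G.

Let B : set 'rV[R]_d := eball 0 r0.
Let U := u \_ B.
Let D i := G i \_ B.

Let mB : measurable B. Proof. exact: measurable_eball0. Qed.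

Let mU : measurable_fun setT U.
Proof. by have [[mu_ _] _ _] := uG; apply/(measurable_restrictT _ mB). Qed.

Let mD i : measurable_fun setT (D i).
Proof. by have [_ /(_ i)[mG _] _] := uG; apply/(measurable_restrictT _ mB). Qed.

Let increment (h x : 'rV[R]_d) : R := (U (x + h) - U x) ^+ 2.

Let mincrement h : measurable_fun setT (increment h).
Proof.
apply: measurable_funX; apply: measurable_funB => //.
by apply: (measurableT_comp mU); exact: measurable_row_shift.
Qed.

Let increment_shift (h k : 'rV[R]_d) (r s : R) : enorm k <= s ->
  (\int[mu]_(x in eball 0 r) (increment h (x + k))%:E <=
   \int[mu]_(x in eball 0 (r + s)) (increment h x)%:E)%E.
Proof.
move=> ks; rewrite integral_mkcond [leRHS]integral_mkcond.
pose F x := (((fun x => (increment h x)%:E) \_ (eball 0 (r + s))) x)%E.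
have mF : measurable_fun setT F.
  apply/(measurable_restrictT _ (measurable_eball0 _)).
  by apply/measurable_EFinP; exact: measurable_funTS.
have F0 x : (0 <= F x)%E by rewrite /F /patch; case: ifP => // _; rewrite lee_fin sqr_ge0.
rewrite -/F -(@ge0_integral_shift R d k F)//; apply: ge0_le_integral => //.
- by move=> x _; rewrite /patch; case: ifP => // _; rewrite lee_fin sqr_ge0.
- apply/(measurable_restrictT _ (measurable_eball0 _)); apply/measurable_EFinP.
  apply: measurable_funTS; apply: (measurableT_comp (mincrement h)).
  exact: measurable_row_shift.
- by apply: (measurableT_comp mF); exact: measurable_row_shift.
- move=> x _; rewrite {1}/patch; case: ifPn => [|_]; last exact: F0.
  by rewrite inE /F /patch => xr; rewrite mem_set//; exact: eball0D.
Qed.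

Let increment_positive (h r : R) i : 0 < h -> r + h <= r0 ->
  (\int[mu]_(x in eball 0 r) (increment (h *: delta i) x)%:E <=
   (h ^+ 2)%:E * \int[mu]_(x in eball 0 (r + h)) (G i x ^+ 2)%:E)%E.
Proof.
move=> h0 rhr; have mr := measurable_eball0 r : measurable (eball (0 : 'rV[R]_d) r).
pose Er x : \bar R := (((D i x) ^+ 2)%:E * (\1_(eball 0 (r + h)) x)%:E)%E.
have mEr : measurable_fun setT Er.
  apply: emeasurable_funM; apply/measurable_EFinP; first exact: measurable_funX.
  by apply: measurable_indic; exact: measurable_eball0.
pose F (p : 'rV[R]_d * measurableTypeR R) : \bar R :=
  ((D i (p.1 + (p.2 : R) *: delta i) ^+ 2 * I0 h p.2 * \1_(eball 0 r) p.1)%R)%:E.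
have mF : measurable_fun setT F.
  apply/measurable_EFinP; apply: measurable_funM; last first.
    have m1 : measurable_fun setT (\1_(eball 0 r) : 'rV[R]_d -> R).
      exact: measurable_indic.
    by apply: (measurableT_comp m1); exact: measurable_fst.
  apply: measurable_funM; last exact: measurable_I0.
  by apply: measurable_funX; exact: (measurable_translate (delta i) (mD i)).
have F0 p : (0 <= F p)%E.
  rewrite /F lee_fin; apply: mulr_ge0; last by rewrite indicE.
  by apply: mulr_ge0; [exact: sqr_ge0|exact: I0_ge0].
apply: (@le_trans _ _ (\int[mu]_x (h%:E * \int[lam]_t F (x, t)))%E).
  rewrite integral_mkcond; apply: ae_ge0_le_integral => //.
  - by move=> x _; rewrite /patch; case: ifP => // _; rewrite lee_fin sqr_ge0.
  - by apply/(measurable_restrictT _ mr)/measurable_EFinP; exact: measurable_funTS.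
  - move=> x _; rewrite mule_ge0 ?lee_fin ?(ltW h0)//; exact: integral_ge0.
  - apply: emeasurable_funM; first exact: measurable_cst.
    exact: measurable_fun_fubini_tonelli_F.
  have := difference_identity i uG h0 rhr; apply: filterS => x dx _.
  rewrite /patch; case: ifPn => [/set_mem xr|_]; last first.
    by rewrite mule_ge0 ?lee_fin ?(ltW h0)//; exact: integral_ge0.
  have mDx : measurable_fun setT (fun t : measurableTypeR R => D i (x + (t : R) *: delta i)).
    exact: (measurable_slice (delta i) x (mD i)).
  apply: (le_trans (cauchy_schwarz_interval h0 mDx (dx xr))).
  rewrite lee_wpmul2l ?lee_fin ?(ltW h0)// le_eqVlt; apply/orP; left; apply/eqP.
  by apply: eq_integral => t _; rewrite /F/= indicE mem_set// mulr1.
rewrite ge0_integralZl//; last 3 first.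
- exact: measurable_fun_fubini_tonelli_F.
- by move=> x _; exact: integral_ge0.
- by rewrite lee_fin ltW.
rewrite expr2 EFinM -muleA lee_wpmul2l ?lee_fin ?(ltW h0)//.
rewrite fubini_tonelli//.
have ErE : (\int[mu]_(x in eball 0 (r + h)) (G i x ^+ 2)%:E = \int[mu]_x Er x)%E.
  rewrite integral_mkcond; apply: eq_integral => x _; rewrite /Er indicE /patch.
  case: ifPn => [/set_mem xrh|_]; last by rewrite mule0.
  by rewrite mule1 /D /patch mem_set//; exact: (eball0S rhr).
rewrite ErE.
have Er0 x : (0 <= Er x)%E by rewrite mule_ge0// lee_fin ?sqr_ge0// indicE.
apply: (@le_trans _ _ (\int[lam]_t ((I0 h t)%:E * \int[mu]_x Er x))%E).
  apply: ge0_le_integral => //.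
  - by move=> t _; exact: integral_ge0.
  - exact: measurable_fun_fubini_tonelli_G.
  - apply: emeasurable_funM; last exact: measurable_cst.
    by apply/measurable_EFinP; apply: measurable_indic; exact: measurable_itv.
  - move=> t _; rewrite -(@ge0_integral_shift R d ((t : R) *: delta i) Er)//.
    rewrite -ge0_integralZl//; last 2 first.
    + by apply: (measurableT_comp mEr); exact: measurable_row_shift.
    + by rewrite lee_fin /I0 indicE.
    apply: ge0_le_integral => //.
    + by apply: (measurableT_comp mF); exact: measurable_pair2.
    + apply: emeasurable_funM; first exact: measurable_cst.
      by apply: (measurableT_comp mEr); exact: measurable_row_shift.
    + move=> x _; rewrite /F /Er I0E !indicE /=.
      have [th|_] := boolP (0 <= (t : R) <= h); last by rewrite mulr0 mul0r mul0e.
      rewrite mulr1 mul1e; have [xr|_] := boolP (x \in eball 0 r); last first.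
        by rewrite mulr0 mule_ge0// lee_fin ?sqr_ge0.
      rewrite mulr1 (_ : (_ \in _) = true) ?mule1//; apply/mem_set.
      apply: eball0D; last exact/set_mem.
      by case/andP: th => t0 th; rewrite enorm_delta ger0_norm.
rewrite ge0_integralZr//; last 3 first.
- by apply/measurable_EFinP; apply: measurable_indic; exact: measurable_itv.
- by move=> t _; rewrite lee_fin /I0 indicE.
- exact: integral_ge0.
by rewrite integral_I0// ltW.
Qed.

Let energy i (rho : R) : \bar R := (\int[mu]_(x in eball 0 rho) (G i x ^+ 2)%:E)%E.

Let le_energy i (r s : R) : r <= s -> s <= r0 -> (energy i r <= energy i s)%E.
Proof.
move=> rs sr0; apply: ge0_subset_integral => //.
- exact: measurable_eball0.
- exact: measurable_eball0.
- have [_ /(_ i)[mG _] _] := uG; apply/measurable_EFinP/measurable_funX.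
  by apply: measurable_funS mG => //; exact: eball0S.
- by move=> x _; rewrite lee_fin sqr_ge0.
- exact: eball0S.
Qed.

Let energy_ge0 i r : (0 <= energy i r)%E.
Proof. by apply: integral_ge0 => x _; rewrite lee_fin sqr_ge0. Qed.

Let increment_coord (h eta r : R) i : `|h| <= eta -> r + eta + eta <= r0 ->
  (\int[mu]_(x in eball 0 r) (increment (h *: delta i) x)%:E <=
   (eta ^+ 2)%:E * energy i (r + eta + eta))%E.
Proof.
move=> heta rer; have eta0 : 0 <= eta by rewrite (le_trans _ heta).
have h2 : h ^+ 2 <= eta ^+ 2 by rewrite -real_normK ?num_real// ler_pXn2r ?nnegrE.
have [h0|h0|->] := ltgtP h 0.
- have nh0 : 0 < - h by rewrite oppr_gt0.
  move: heta; rewrite ltr0_norm// => heta.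
  rewrite (eq_integral (fun x : 'rV[R]_d => (increment ((- h) *: delta i) (x + h *: delta i))%:E)).
    apply: (le_trans (@increment_shift _ (h *: delta i) r eta _)).
      by rewrite enorm_delta ltr0_norm.
    apply: (le_trans (increment_positive i nh0 _)); first by lra.
    rewrite sqrrN lee_pmul ?lee_fin ?sqr_ge0 ?energy_ge0//.
    by apply: le_energy => //; lra.
  by move=> x _; rewrite /increment scaleNr addrK -sqrrN opprB.
- move: heta; rewrite gtr0_norm// => heta.
  apply: (le_trans (increment_positive i h0 _)); first by lra.
  rewrite lee_pmul ?lee_fin ?sqr_ge0 ?energy_ge0//.
  by apply: le_energy => //; lra.
- rewrite (eq_integral (cst 0%E)) ?integral0 ?mule_ge0 ?lee_fin ?sqr_ge0 ?energy_ge0//.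
  by move=> x _; rewrite /increment scale0r addr0 subrr expr0n.
Qed.

(** Moving along the coordinate directions one at a time, each elementary
    increment is controlled by one component of the gradient. *)
Lemma translation_estimate (h : 'rV[R]_d) (eta r rho : R) :
  (forall i, `|h ord0 i| <= eta) -> 0 <= eta ->
  r + d.+2%:R * eta <= rho -> rho <= r0 ->
  (\int[mu]_(x in eball 0 r) ((U (x + h) - U x) ^+ 2)%:E <=
   (d%:R * eta ^+ 2)%:E *
     \int[mu]_(x in eball 0 rho) (\sum_(i < d) G i x ^+ 2)%:E)%E.
Proof.
move=> heta eta0 rrho rhor0.
pose H k : 'rV[R]_d := \row_i (if (i < k)%N then h ord0 i else 0).
have HS (k : 'I_d) : H k.+1 = H k + h ord0 k *: delta k.
  apply/rowP => j; rewrite !mxE/= ltnS leq_eqVlt -[(j == k :> nat)]/(j == k).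
  by have [->|_] := eqVneq j k; rewrite ?ltnn ?mulr1 ?add0r//= mulr0 addr0.
have H_le k : enorm (H k) <= d%:R * eta.
  apply: (le_trans (enorm_le_sum _)); rewrite mulr_natl -[d in eta *+ d]card_ord.
  rewrite -sumr_const; apply: ler_sum => i _; rewrite mxE; case: ifP => // _.
  by rewrite normr0.
have telescope x : U (x + h) - U x =
    \sum_(k < d) (U (x + H k + h ord0 k *: delta k) - U (x + H k)).
  under eq_bigr => k _ do rewrite -addrA -HS.
  rewrite -(big_mkord xpredT (fun k => U (x + H k.+1) - U (x + H k))).
  rewrite telescope_sumr//; congr (U (x + _) - U _).
    by apply/rowP => i; rewrite mxE ltn_ord.
  by apply/rowP => i; rewrite !mxE addr0.
have mr := measurable_eball0 r : measurable (eball (0 : 'rV[R]_d) r).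
have minc k : measurable_fun (eball 0 r)
    (fun x => (increment (h ord0 k *: delta k) (x + H k))%:E).
  apply/measurable_EFinP; apply: measurable_funTS.
  by apply: (measurableT_comp (mincrement _)); exact: measurable_row_shift.
apply: (@le_trans _ _ (\int[mu]_(x in eball 0 r)
  (d%:R%:E * \sum_(k < d) (increment (h ord0 k *: delta k) (x + H k))%:E))%E).
  apply: ge0_le_integral => //.
  - by move=> x _; rewrite lee_fin sqr_ge0.
  - by apply/measurable_EFinP; apply: measurable_funTS; exact: (mincrement h).
  - by apply: emeasurable_funM; [exact: measurable_cst|exact: emeasurable_sum].
  - by move=> x _; rewrite telescope sumEFin -EFinM lee_fin sum_sqr_le.
rewrite ge0_integralZl//; last 2 first.
- exact: emeasurable_sum.
- by move=> x _; apply: sume_ge0 => k _; rewrite lee_fin sqr_ge0.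
rewrite EFinM -muleA lee_wpmul2l ?lee_fin//.
rewrite ge0_integral_sum//; last by move=> k x _; rewrite lee_fin sqr_ge0.
under [in leRHS]eq_integral do rewrite -sumEFin.
rewrite ge0_integral_sum//; last 3 first.
- exact: measurable_eball0.
- move=> i; have [_ /(_ i)[mG _] _] := uG; apply/measurable_EFinP/measurable_funX.
  by apply: measurable_funS mG => //; exact: eball0S.
- by move=> i x _; rewrite lee_fin sqr_ge0.
rewrite ge0_sume_distrr; last by move=> i _; exact: energy_ge0.
apply: lee_sum => k _.
apply: (le_trans (@increment_shift _ (H k) r (d%:R * eta) _)) => //.
have rho_eq : r + d%:R * eta + eta + eta <= rho.
  by move: rrho; rewrite -natr1 -natr1 !mulrDl mul1r !addrA.
apply: (le_trans (increment_coord k (heta k) _)); first exact: le_trans rho_eq _.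
by rewrite lee_wpmul2l ?lee_fin ?sqr_ge0//; exact: le_energy.
Qed.

End translation_estimate.

(** * Difference quotients of test functions *)

Section test_function_facts.
Context {R : realType} {d : nat}.
Local Notation mu := (@lebesgue_row R d).
Local Notation delta := (delta_mx ord0).

Lemma closedbox_bounded (f : 'rV[R]_d -> R) (s : R) : continuous f ->
  exists2 M : R, 0 <= M & forall x, eball 0 s x -> `|f x| <= M.
Proof.
move=> cf; have : compact (f @` (closedbox (const_mx (- s)) (const_mx s))).
  apply: continuous_compact; last exact: closedbox_compact.
  exact: continuous_subspaceT.
move=> /compact_bounded[k [_ kf]]; exists (`|k| + 1); first by rewrite addr_ge0.
move=> x xs; apply: (kf (`|k| + 1)); first by rewrite (le_lt_trans (ler_norm _))// ltrDl.
by exists x => //; exact: eball0_sub_closedbox.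
Qed.

Lemma is_derive_line (f : 'rV[R]_d -> R) i (x : 'rV[R]_d) (s : R) :
  derivable f (x + s *: delta i) (delta i) ->
  is_derive s (1 : R) (fun t => f (x + t *: delta i)) (partial i f (x + s *: delta i)).
Proof.
move=> df.
have E : (fun h : R => h^-1 *: (((fun t => f (x + t *: delta i)) \o shift s) (h *: 1)
      - f (x + s *: delta i))) =
    (fun h => h^-1 *: ((f \o shift (x + s *: delta i)) (h *: delta i)
      - f (x + s *: delta i))).
  apply/funext => h; congr (_ *: (f _ - _)) => /=.
  by rewrite -[h%:A]/(h * 1) mulr1 scalerDl addrCA.
apply: DeriveDef; first by rewrite /derivable E.
by rewrite /partial /derive E.
Qed.

Variables (r0 : R) (f : 'rV[R]_d -> R).
Hypothesis ft : test_function (eball 0 r0) f.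

Lemma test_function_continuous : continuous f.
Proof. by have [/(_ [::])[]] := ft. Qed.

Lemma test_function_partial_continuous i : continuous (partial i f).
Proof. by have [/(_ [:: i])[]] := ft. Qed.

Lemma test_function_derivable i x : derivable f x (delta i).
Proof. by have [/(_ [::])[_]] := ft. Qed.

Lemma test_function_support : exists2 r, r < r0 & forall x, ~ eball 0 r x -> f x = 0.
Proof.
have [_ cK KB] := ft; set K := closure _ in cK KB.
have fK x : ~ K x -> f x = 0.
  move=> nK; apply: contrapT => /eqP fx; apply: nK; exact: subset_closure.
have [K0|/set0P K0] := eqVneq K set0.
  exists (r0 - 1); first by rewrite ltrBlDr ltrDl.
  by move=> x _; apply: fK; rewrite K0.
have [c cK' cmax] := @compact_EVT_max _ R enorm K K0 cK
  (continuous_subspaceT (@enorm_continuous R d)).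
have : eball 0 r0 c by apply: KB; exact/set_mem.
rewrite eball0E/= => cr0; exists ((enorm c + r0) / 2); first by lra.
move=> x nx; apply: fK => Kx; apply: nx; rewrite eball0E/=.
have := cmax x (mem_set Kx); lra.
Qed.

Lemma test_function_increment_bound (s : R) : exists2 L : R, 0 <= L &
  forall i (x : 'rV[R]_d) (t : R), 0 <= t -> (forall t' : R, 0 <= t' <= t -> eball 0 s (x + t' *: delta i)) ->
    `|f (x + t *: delta i) - f x| <= L * t.
Proof.
have [L L0 Lf] : exists2 L : R, 0 <= L & forall i x, eball 0 s x -> `|partial i f x| <= L.
  have := fun i => cid2 (closedbox_bounded s (@test_function_partial_continuous i)).
  move=> b; exists (\sum_i s2val (b i)).
    by apply: sumr_ge0 => i _; exact: (s2valP (b i)).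
  move=> i x xs; rewrite (le_trans (s2valP' (b i) x xs))// (bigD1 i)//= lerDl.
  by apply: sumr_ge0 => j _; exact: (s2valP (b j)).
exists L => // i x t t0 line.
have df (q : R) := is_derive_line (@test_function_derivable i (x + q *: delta i)).
have [c ct] := @MVT_segment _ (fun t => f (x + t *: delta i))
  (fun t => partial i f (x + t *: delta i)) 0 t t0 (fun q _ => df q)
  (derivable_within_continuous (fun q _ => ex_derive (is_derive := df q))).
rewrite scale0r addr0 subr0 => ->; rewrite normrM (ger0_norm t0) ler_wpM2r//.
by apply/Lf/line; move: ct; rewrite in_itv.
Qed.

Lemma test_function_quotient i (h : R ^nat) x :
  (forall n, h n != 0) -> h n @[n --> \oo] --> (0 : R) ->
  ((h n)^-1 * (f (x + h n *: delta i) - f x)) @[n --> \oo] --> (partial i f x : R).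
Proof.
move=> hn0 h0; have df : is_derive (0 : R) (1 : R) (fun t => f (x + t *: delta i))
    (partial i f x).
  have := @is_derive_line f i x 0; rewrite scale0r addr0.
  by apply; exact: test_function_derivable.
have := ex_derive (is_derive := df); rewrite /derivable.
move=> /cvg_ex[l lP].
have lE : l = partial i f x.
  by rewrite -(derive_val (is_derive := df)); apply/esym/cvg_lim.
rewrite lE in lP; have /cvgr_dnbhsP/(_ h (conj hn0 h0)) := lP.
rewrite /=; under eq_fun do rewrite scale0r !addr0 /GRing.scale/= mulr1.
exact.
Qed.

End test_function_facts.

(** * A regularized positive part *)

Section truncation_function.
Context {R : realType}.
Variable dl : R.
Hypothesis dl0 : 0 < dl.

Definition clamp (z : R) : R := Num.max 0 (Num.min 1 (z / dl)).

(** A C^{1,1} approximation of the positive part whose derivative is [clamp];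
    by convexity it is also the supremum over c in [0, 1] of c z - dl c^2 / 2. *)
Definition huber (z : R) : R := clamp z * z - dl / 2 * clamp z ^+ 2.

Lemma clampP z : exists2 y, z = y * dl &
  [\/ (y <= 0 /\ clamp z = 0), (0 <= y <= 1 /\ clamp z = y) |
      (1 <= y /\ clamp z = 1)].
Proof.
exists (z / dl); first by rewrite divfK ?gt_eqF.
rewrite /clamp; move: (z / dl) => y; have [y0|y0] := leP y 0.
  apply: Or31; split => //; apply/max_idPl; rewrite ge_min; apply/orP; by right.
have [y1|y1] := leP y 1.
  apply: Or32; split; first by rewrite (ltW y0).
  by rewrite ?(min_idPr y1); apply/max_idPr; exact: ltW.
by apply: Or33; split; [exact: ltW|]; apply/max_idPr.
Qed.

Lemma clamp_itv z : 0 <= clamp z <= 1.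
Proof. by rewrite /clamp le_max lexx/= ge_max ler01/= ge_min lexx. Qed.

Lemma clamp_lip a b : `|clamp a - clamp b| <= `|a - b| / dl.
Proof.
have idl : 0 < dl^-1 by rewrite invr_gt0.
have sub_le x y : x <= y -> 0 <= clamp y - clamp x <= (y - x) / dl.
  move=> xy; have [p xE cx] := clampP x; have [q yE cy] := clampP y.
  have pq : p <= q by move: xy; rewrite xE yE ler_pM2r.
  rewrite (_ : (y - x) / dl = q - p); last by rewrite xE yE -mulrBl mulfK// gt_eqF.
  case: cx => -[px ->]; case: cy => -[qy ->]; apply/andP; split; lra.
wlog ab : a b / a <= b => [hw|].
  have [/hw//|/ltW/hw] := leP a b.
  by rewrite distrC (distrC b).
have /andP[ge0 le] := sub_le _ _ ab.
by rewrite distrC (ger0_norm ge0) distrC ger0_norm ?subr_ge0.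
Qed.

Lemma huber_ge z c : 0 <= c <= 1 -> c * z - dl / 2 * c ^+ 2 <= huber z.
Proof.
move=> /andP[c0 c1]; rewrite /huber; have [y -> cz] := clampP z.
have half : 0 < dl / 2 by rewrite divr_gt0.
have E (t : R) : t * (y * dl) - dl / 2 * t ^+ 2 = dl / 2 * (2 * t * y - t ^+ 2) by field.
rewrite !E ler_pM2l//; case: cz => [[y0 ->]|[/andP[y0 y1] ->]|[y1 ->]].
- have := mulr_ge0 c0 (_ : 0 <= - y); rewrite oppr_ge0 => /(_ y0); have := sqr_ge0 c; nra.
- by have := sqr_ge0 (y - c); nra.
- have := @mulr_ge0 R (1 - c) (y - 1); rewrite !subr_ge0 => /(_ c1 y1).
  by have := sqr_ge0 (1 - c); nra.
Qed.

Lemma huber_taylor a b :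
  `|huber b - huber a - clamp a * (b - a)| <= (b - a) ^+ 2 / dl.
Proof.
have lo := huber_ge b (clamp_itv a); have hi := huber_ge a (clamp_itv b).
have nonneg : 0 <= huber b - huber a - clamp a * (b - a).
  by rewrite [huber a]/huber; lra.
have le : huber b - huber a - clamp a * (b - a) <= (clamp b - clamp a) * (b - a).
  by rewrite [huber b]/huber; lra.
rewrite ger0_norm// (le_trans le)// (le_trans (ler_norm _))// normrM expr2.
rewrite -[X in _ <= X / _]ger0_norm -?expr2 ?sqr_ge0// normrX expr2 mulrAC ler_wpM2r//.
by rewrite clamp_lip.
Qed.

Lemma huber_itv z : 0 <= huber z <= Num.max z 0.
Proof.
have zlt : 0 <= huber z.
  by have := @huber_ge z 0; rewrite lexx ler01 mul0r expr0n mulr0 subr0; apply.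
rewrite zlt/= /huber; have [y -> cz] := clampP z.
rewrite le_max; case: cz => [[y0 ->]|[/andP[y0 y1] ->]|[y1 ->]]; apply/orP.
- by right; rewrite mul0r expr0n mulr0 subr0.
- left; rewrite -subr_ge0 (_ : _ - _ = dl * (y * (2 - y)) / 2 ); last by field.
  by rewrite divr_ge0// mulr_ge0 ?(ltW dl0)// mulr_ge0//; lra.
- by left; rewrite mul1r lerBlDr lerDl expr1n mulr1 divr_ge0// ltW.
Qed.

Lemma huber_approx z : `|huber z - Num.max z 0| <= dl.
Proof.
rewrite /huber; have [y -> cz] := clampP z.
have [z0|z0] := leP (y * dl) 0.
  have y0 : y <= 0 by rewrite -(pmulr_lle0 y dl0).
  have -> : clamp (y * dl) = 0 by case: cz => -[yc ->]; lra.
  by rewrite mul0r expr0n mulr0 !subr0 normr0 ltW.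
case: cz => [[y0 _]|[/andP[y0 y1] ->]|[y1 ->]].
- by move: z0; rewrite pmulr_lgt0// ltNge y0.
- rewrite (_ : _ - _ - _ = - (dl * (y * (2 - y) / 2))); last by field.
  rewrite normrN ger0_norm; last by rewrite mulr_ge0 ?(ltW dl0)// divr_ge0// mulr_ge0//; lra.
  by rewrite ler_piMr ?(ltW dl0)// ler_pdivrMr//; nra.
- rewrite mul1r expr1n mulr1 addrAC subrr sub0r normrN ger0_norm ?divr_ge0 ?(ltW dl0)//.
  by rewrite ler_pdivrMr// ler_peMr ?(ltW dl0)// ler1n.
Qed.

End truncation_function.

(** * Weak derivatives from difference quotients *)

Section weak_derivative_criterion.
Context {R : realType} {d : nat}.
Local Notation mu := (@lebesgue_row R d).
Local Notation delta := (delta_mx ord0).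

Lemma Rintegral_dominated_cvg (f_ : nat -> 'rV[R]_d -> R) (f g : 'rV[R]_d -> R) :
  (forall n, measurable_fun setT (f_ n)) -> measurable_fun setT f ->
  (forall x, f_ ^~ x @ \oo --> f x) -> mu.-integrable setT (EFin \o g) ->
  (forall n x, `|f_ n x| <= g x) ->
  (\int[mu]_x f_ n x) @[n --> \oo] --> (\int[mu]_x f x).
Proof.
move=> mf_ mf ff ig fg.
have [||||| fi _ lim] := @dominated_convergence _ _ _ mu setT measurableT
  (fun n x => (f_ n x)%:E) (fun x => (f x)%:E) (EFin \o g).
- by move=> n; exact/measurable_EFinP.
- exact/measurable_EFinP.
- apply: aeW => x _; apply: cvg_EFin; [by near=> n|exact: ff].
- exact: ig.
- by apply: aeW => x n _; rewrite /= lee_fin.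
apply: fine_cvg; rewrite /Rintegral fineK//; exact: integrable_fin_num.
Unshelve. all: by end_near. Qed.

Variables (r0 : R) (f : 'rV[R]_d -> R).
Hypothesis ft : test_function (eball 0 r0) f.

Lemma test_function_out x : ~ eball 0 r0 x -> f x = 0.
Proof.
have [r rr0 f0] := test_function_support ft => nx; apply: f0 => xr; apply: nx.
by apply: eball0S xr; exact: ltW.
Qed.

Lemma test_function_bounded : exists2 M : R, 0 <= M & forall x, `|f x| <= M.
Proof.
have [M M0 fM] := closedbox_bounded r0 (test_function_continuous ft).
exists M => // x; have [/fM//|nx] := pselect (eball 0 r0 x).
by rewrite test_function_out// normr0.
Qed.

Let mf : measurable_fun setT f.
Proof. by apply: continuous_measurable_row; exact: test_function_continuous ft. Qed.

(** Translation invariance moves the translation from W to f, whose difference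
    quotients converge boundedly to the partial derivative; the hypothesis identifies
    the limit. *)
Lemma weak_derivative_criterion (W V : 'rV[R]_d -> R) (C h1 : R) i :
  mu.-integrable setT (EFin \o W) -> mu.-integrable setT (EFin \o V) ->
  (forall x, ~ eball 0 r0 x -> W x = 0) -> 0 < h1 ->
  (forall h, 0 < h < h1 ->
    `|\int[mu]_x (f x * (W (x + h *: delta i) - W x)) - h * \int[mu]_x (f x * V x)|
    <= C * h ^+ 2) ->
  \int[mu]_x (W x * partial i f x) = - \int[mu]_x (f x * V x).
Proof.
move=> iW iV W0 h10 est.
have /measurable_EFinP mW := measurable_int _ iW.
have [M M0 fM] := test_function_bounded.
have [L L0 fL] := test_function_increment_bound ft (r0 + 1).
pose h n : R := Num.min (h1 / 2) 1 * harmonic n.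
have hh n : 0 < h n <= Num.min (h1 / 2) 1.
  have m0 : 0 < Num.min (h1 / 2) 1 by rewrite lt_min ltr01 andbT divr_gt0.
  rewrite /h mulr_gt0 ?harmonic_gt0//= ler_piMr ?(ltW m0)// /harmonic/=.
  by rewrite invf_le1 ?ltr0n// ler1n.
have h0 : h n @[n --> \oo] --> (0 : R).
  rewrite -(mulr0 (Num.min (h1 / 2) 1)); apply: cvgMl_tmp; exact: cvg_harmonic.
have mshift t : measurable_fun setT (fun x : 'rV[R]_d => f (x - t *: delta i)).
  by apply: (measurableT_comp mf); exact: measurable_row_shift.
pose Q n x := W x * ((h n)^-1 * (f (x - h n *: delta i) - f x)).
have Q_partial : (\int[mu]_x Q n x) @[n --> \oo] -->
    (\int[mu]_x (- (W x * partial i f x))).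
  apply: (@Rintegral_dominated_cvg Q _ (fun x => L * `|W x|)).
  - move=> n; apply: measurable_funM => //; apply: measurable_funM => //.
    exact: measurable_funB.
  - apply: measurable_funN; apply: measurable_funM => //; apply: continuous_measurable_row.
    exact: test_function_partial_continuous ft _.
  - move=> x; rewrite -mulrN; apply: cvgMl_tmp.
    have hN0 : - h n @[n --> \oo] --> (0 : R) by rewrite -oppr0; exact: cvgN.
    have hNn0 n : - h n != 0 by rewrite oppr_eq0 gt_eqF//; case/andP: (hh n).
    have := @test_function_quotient R d r0 f ft i (fun n => - h n) x hNn0 hN0.
    have E n : (h n)^-1 * (f (x - h n *: delta i) - f x) =
        - ((- h n)^-1 * (f (x + (- h n) *: delta i) - f x)).
      by rewrite invrN mulNr opprK scaleNr.
    by under [in X in _ -> X]eq_fun do rewrite E; move=> ?; exact: cvgN.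
  - rewrite (_ : EFin \o _ = fun x => (L%:E * `|(W x)%:E|)%E); last exact/funext.
    by apply: integrableZl => //; exact: integrable_abse.
  - move=> n x; rewrite /Q normrM mulrC.
    have [xB|nx] := pselect (eball 0 r0 x); last by rewrite (W0 _ nx) normr0 !mulr0.
    have /andP[hn0 hn1] := hh n.
    rewrite ler_wpM2r// normrM normfV (gtr0_norm hn0) ler_pdivrMl// mulrC -normrN opprB.
    have := fL i (x - h n *: delta i) (h n) (ltW hn0); rewrite subrK; apply.
    move=> t /andP[t0 th]; rewrite -addrA -scaleNr -scalerDl.
    apply: eball0D => //; rewrite enorm_delta addrC ler0_norm ?subr_le0// opprB.
    by rewrite lerBlDr (le_trans hn1)// (le_trans (y := 1)) ?ge_min ?lexx ?orbT// lerDl.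
have iWf (g : 'rV[R]_d -> R) : measurable_fun setT g -> (forall x, `|g x| <= M) ->
    mu.-integrable setT (EFin \o (fun x => W x * g x)).
  move=> mg gM; apply: (@integrable_dominated R d _ W M) => //.
    exact: measurable_funM.
  by move=> x; rewrite normrM mulrC ler_wpM2r.
have QE n : \int[mu]_x Q n x =
    (h n)^-1 * \int[mu]_x (f x * (W (x + h n *: delta i) - W x)).
  have i1 : mu.-integrable setT (EFin \o (fun x => W x * f (x - h n *: delta i))).
    by apply: iWf.
  have i2 : mu.-integrable setT (EFin \o (fun x => W x * f x)) by exact: iWf.
  have i3 := integrable_shift (h n *: delta i) i1.
  have E3 : \int[mu]_x (W x * f (x - h n *: delta i)) =
      \int[mu]_x (W (x + h n *: delta i) * f x).
    rewrite /Rintegral -(integral_shift (h n *: delta i) i1); congr fine.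
    by apply: eq_integral => x _ /=; rewrite addrK.
  rewrite (_ : \int[mu]_x Q n x = \int[mu]_x ((h n)^-1 *
      (W x * f (x - h n *: delta i) - W x * f x))); last first.
    by apply: eq_Rintegral => x _; rewrite /Q mulrCA mulrBr.
  rewrite RintegralZl//; last first.
    have := integrableB measurableT i1 i2.
    by apply: eq_integrable => // x _; rewrite /= -EFinB.
  congr (_ * _); rewrite RintegralB// E3.
  rewrite (_ : \int[mu]_x (f x * _) = \int[mu]_x
    (W (x + h n *: delta i) * f x - W x * f x)); last first.
    by apply: eq_Rintegral => x _; rewrite mulrBr mulrC (mulrC (f x)).
  rewrite RintegralB//; apply: eq_integrable i3 => // x _ /=.
  by rewrite addrK.
have Q_V : (\int[mu]_x Q n x) @[n --> \oo] --> (\int[mu]_x (f x * V x)).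
  apply/cvgrPdist_le => e e0; near=> n.
  have /andP[hn0 hn1] := hh n.
  have hnh1 : 0 < h n < h1.
    rewrite hn0/= (le_lt_trans hn1)// (le_lt_trans (y := h1 / 2)) ?ge_min ?lexx//.
    by rewrite ltr_pdivrMr// ltr_pMr// ltr1n.
  rewrite QE distrC (_ : _ - _ = (h n)^-1 * (\int[mu]_x
      (f x * (W (x + h n *: delta i) - W x)) - h n * \int[mu]_x (f x * V x))); last first.
    by rewrite mulrBr mulKf// gt_eqF.
  rewrite normrM normfV (gtr0_norm hn0) ler_pdivrMl//.
  rewrite (le_trans (est _ hnh1))// expr2 mulrA mulrC ler_wpM2l ?(ltW hn0)//.
  have C1 : 0 < `|C| + 1 by rewrite ltr_pwDr.
  apply: (@le_trans _ _ ((`|C| + 1) * h n)).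
    by rewrite ler_wpM2r ?(ltW hn0)// (le_trans (ler_norm _))// lerDl.
  rewrite -ler_pdivlMl//; near: n.
  have /cvgrPdist_le/(_ (e / (`|C| + 1)))  := h0; rewrite divr_gt0// => /(_ isT).
  apply: filterS => n; rewrite sub0r normrN mulrC => le.
  by rewrite (le_trans (ler_norm _)).
have := cvg_unique _ Q_V Q_partial => /(_ (@Rhausdorff R)) ->.
have iWp : mu.-integrable setT (EFin \o (fun x => W x * partial i f x)).
  have [N N0 pN] := closedbox_bounded r0 (@test_function_partial_continuous _ _ _ _ ft i).
  apply: (@integrable_dominated R d _ W N) => //.
    apply: measurable_funM => //; apply: continuous_measurable_row.
    exact: test_function_partial_continuous ft _.
  move=> x; have [/pN xN|nx] := pselect (eball 0 r0 x); last first.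
    by rewrite (W0 _ nx) mul0r normr0 mulr0.
  by rewrite normrM mulrC ler_wpM2r.
under [in RHS]eq_Rintegral do rewrite -mulN1r.
by rewrite RintegralZl// mulN1r opprK.
Unshelve. all: by end_near. Qed.

End weak_derivative_criterion.

(** * Weak gradient of a truncation *)

Section truncation_estimate.
Context {R : realType} {d : nat}.
Local Notation mu := (@lebesgue_row R d).
Local Notation lam := (@lebesgue_measure R).
Local Notation delta := (delta_mx ord0).

Lemma normr_Rintegral_le (a : 'rV[R]_d -> R) (K : R) :
  mu.-integrable setT (EFin \o a) ->
  (\int[mu]_x (`|a x|)%:E <= K%:E)%E -> `|\int[mu]_x a x| <= K.
Proof.
move=> ia aK; rewrite -lee_fin EFin_normr_Rintegral//; apply: le_trans aK.
by apply: le_abse_integral => //; exact: measurable_int ia.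
Qed.

Lemma integral_supported (a : 'rV[R]_d -> R) (A : set 'rV[R]_d) :
  (forall x, ~ A x -> a x = 0) ->
  (\int[mu]_x (a x)%:E = \int[mu]_(x in A) (a x)%:E)%E.
Proof.
move=> a0; rewrite [RHS]integral_mkcond; apply: eq_integral => x _.
by rewrite /patch; case: ifPn => // /negP xA; rewrite a0// => Ax; apply: xA; rewrite inE.
Qed.

Variables (r0 : R) (u : 'rV[R]_d -> R) (G : 'I_d -> 'rV[R]_d -> R).
Hypothesis uG : weak_gradient (eball 0 r0) u G.

Let B : set 'rV[R]_d := eball 0 r0.
Let U := u \_ B.
Let D i := G i \_ B.

Let mB : measurable B. Proof. exact: measurable_eball0. Qed.

Let Boo : (mu B < +oo)%E. Proof. exact: eball0_lty. Qed.

Let U_int : mu.-integrable setT (EFin \o U).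
Proof. by have [uL2 _ _] := uG; exact: L2_restrict_integrable. Qed.

Let D_int i : mu.-integrable setT (EFin \o D i).
Proof. by have [_ GL2 _] := uG; exact: L2_restrict_integrable. Qed.

Let mU : measurable_fun setT U.
Proof. by have /measurable_EFinP := measurable_int _ U_int. Qed.

Let mD i : measurable_fun setT (D i).
Proof. by have /measurable_EFinP := measurable_int _ (D_int i). Qed.

Let energy : R := fine (\int[mu]_(x in B) (\sum_(j < d) G j x ^+ 2)%:E)%E.

Let mG2 j : measurable_fun B (fun x => (G j x ^+ 2)%:E).
Proof.
have [_ /(_ j)[mG _] _] := uG.
by apply/measurable_EFinP; exact: measurable_funX.
Qed.

Let energyE : (\int[mu]_(x in B) (\sum_(j < d) G j x ^+ 2)%:E = energy%:E)%E.
Proof.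
rewrite /energy fineK// ge0_fin_numE; last first.
  by apply: integral_ge0 => x _; rewrite lee_fin sumr_ge0// => j _; exact: sqr_ge0.
under eq_integral do rewrite -sumEFin.
rewrite ge0_integral_sum//; last by move=> j x _; rewrite lee_fin sqr_ge0.
by apply: lte_sum_pinfty => j _; have [_ /(_ j)[_]] := uG.
Qed.

Let energy_ge0 : 0 <= energy.
Proof.
by rewrite -lee_fin -energyE; apply: integral_ge0 => x _;
  rewrite lee_fin sumr_ge0// => j _; exact: sqr_ge0.
Qed.

Let D2_le i : (\int[mu]_x (D i x ^+ 2)%:E <= energy%:E)%E.
Proof.
rewrite (integral_supported (A := B)); last first.
  by move=> x nx; rewrite /D /patch memNset// expr0n.
rewrite -energyE; apply: ge0_le_integral => //.
- by move=> x _; rewrite lee_fin sqr_ge0.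
- by apply/measurable_EFinP; apply: measurable_funTS; exact: measurable_funX.
- by under eq_fun do rewrite -sumEFin; exact: emeasurable_sum.
- move=> x Bx; rewrite lee_fin /D /patch mem_set// (bigD1 i)//= lerDl.
  by apply: sumr_ge0 => j _; exact: sqr_ge0.
Qed.

Let increment_le i (s t : R) : 0 <= t -> s + d.+2%:R * t <= r0 ->
  (\int[mu]_(x in eball 0 s) ((U (x + t *: delta i) - U x) ^+ 2)%:E <=
   (d%:R * t ^+ 2 * energy)%:E)%E.
Proof.
move=> t0 st; rewrite [leRHS]EFinM -energyE; apply: (translation_estimate uG) st _ => //.
by move=> j; rewrite !mxE/= normrM ger0_norm// ler_piMr//; case: eqP; rewrite ?normr1 ?normr0.
Qed.

Variables (f : 'rV[R]_d -> R) (i : 'I_d) (k dl : R).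
Hypotheses (ft : test_function (eball 0 r0) f) (dl0 : 0 < dl).

Let c x := clamp dl (k - U x).
Let alpha x := f x * c x.
Let W := (fun x => huber dl (k - U x)) \_ B.
Let V x := - (c x * D i x).

Let mf : measurable_fun setT f.
Proof. by apply: continuous_measurable_row; exact: test_function_continuous ft. Qed.

Let mz : measurable_fun setT (fun x => k - U x).
Proof. by apply: measurable_funB => //; exact: measurable_cst. Qed.

Let mc : measurable_fun setT c.
Proof.
apply: measurable_maxr; first exact: measurable_cst.
apply: measurable_minr; first exact: measurable_cst.
by apply: measurable_funM => //; exact: measurable_cst.
Qed.

Let malpha : measurable_fun setT alpha. Proof. exact: measurable_funM. Qed.

Let mW : measurable_fun setT W.
Proof.
apply/(measurable_restrictT _ mB); apply: measurable_funTS.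
rewrite /huber; apply: measurable_funB; first exact: measurable_funM.
by apply: measurable_funM; [exact: measurable_cst|exact: measurable_funX].
Qed.

Lemma restricted_excess_integrable :
  mu.-integrable setT (EFin \o (fun x => k * \1_B x - U x)).
Proof.
have := integrableB measurableT
  (integrableZl measurableT k (integrable_indicator mB Boo)) U_int.
by apply: eq_integrable => // x _; rewrite /= -EFinM -EFinB.
Qed.

Let W_int : mu.-integrable setT (EFin \o W).
Proof.
apply: (@integrable_dominated R d _ (fun x => k * \1_B x - U x) 1) => //.
  exact: restricted_excess_integrable.
move=> x; rewrite mul1r /W indicE /patch; case: ifPn => [xB|_]; last by rewrite normr0.
have /andP[h0 h1] := huber_itv dl0 (k - U x).
rewrite (ger0_norm h0) mulr1 (le_trans h1)// ge_max normr_ge0 andbT.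
exact: ler_norm.
Qed.

Let c_itv x : 0 <= c x <= 1. Proof. exact: clamp_itv. Qed.

Let V_int : mu.-integrable setT (EFin \o V).
Proof.
apply: (@integrable_dominated R d _ (D i) 1) => //.
  by apply: measurable_funN; exact: measurable_funM.
move=> x; rewrite normrN normrM ler_wpM2r//.
by have /andP[c0 c1] := c_itv x; rewrite ger0_norm.
Qed.

Section step.
Variables (M L r h : R).
Hypotheses (M0 : 0 <= M) (fM : forall x, `|f x| <= M) (L0 : 0 <= L).
Hypothesis fL : forall x (t : R), 0 <= t ->
  (forall t' : R, 0 <= t' <= t -> eball 0 r0 (x + t' *: delta i)) ->
  `|f (x + t *: delta i) - f x| <= L * t.
Hypothesis fr : forall x, ~ eball 0 r x -> f x = 0.
Hypotheses (h0 : 0 < h) (rhr0 : r + h + d.+2%:R * h <= r0).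

Let Delta t x := U (x + t *: delta i) - U x.

Let rh : r + h <= r0.
Proof. by rewrite (le_trans _ rhr0)// lerDl mulr_ge0// ltW. Qed.

Let rr0 : r <= r0.
Proof. by rewrite (le_trans _ rh)// lerDl ltW. Qed.

Let alphaM x : `|alpha x| <= M.
Proof.
rewrite normrM; have /andP[c0 c1] := c_itv x.
by rewrite -[leRHS]mulr1 ler_pM// ger0_norm.
Qed.

Let alpha_r x : ~ eball 0 r x -> alpha x = 0.
Proof. by move=> xr; rewrite /alpha fr// mul0r. Qed.

Let mDelta t : measurable_fun setT (Delta t).
Proof.
by apply: measurable_funB => //; apply: (measurableT_comp mU); exact: measurable_row_shift.
Qed.

(* The derivative of [huber] is Lipschitz, hence a quadratic remainder. *)
Let first_order x : `|f x * (W (x + h *: delta i) - W x) + alpha x * Delta h x| <=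
  M / dl * Delta h x ^+ 2.
Proof.
have [xr|nxr] := pselect (eball 0 r x); last first.
  by rewrite /alpha fr// !mul0r addr0 normr0 mulr_ge0 ?sqr_ge0// divr_ge0// ltW.
have xB : B x by exact: eball0S xr.
have xhB : B (x + h *: delta i).
  by apply: (eball0S rh); apply: eball0D => //; rewrite enorm_delta gtr0_norm.
rewrite /W /patch !mem_set// /alpha -mulrA -mulrDr normrM -mulrA ler_pM//.
have := huber_taylor dl0 (k - U x) (k - U (x + h *: delta i)).
rewrite (_ : k - U (x + h *: delta i) - (k - U x) = - Delta h x); last first.
  by rewrite /Delta; ring.
by rewrite mulrN opprK sqrrN => /le_trans; apply; rewrite mulrC.
Qed.

Let F1 (p : 'rV[R]_d * measurableTypeR R) :=
  (alpha p.1 * (D i (p.1 + (p.2 : R) *: delta i) * I0 h p.2))%:E.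

Let F2 (p : 'rV[R]_d * measurableTypeR R) :=
  ((alpha \* D i) (p.1 + (p.2 : R) *: delta i) * I0 h p.2)%:E.

Let F1_int : (mu \x lam)%E.-integrable setT F1.
Proof. exact: (integrable_mul_translate (delta i) (ltW h0) (D_int i) malpha alphaM). Qed.

Let alphaD_int : mu.-integrable setT (EFin \o (alpha \* D i)).
Proof.
apply: (@integrable_dominated R d _ (D i) M) => //; first exact: measurable_funM.
by move=> x; rewrite normrM ler_wpM2r.
Qed.

Let F2_int : (mu \x lam)%E.-integrable setT F2.
Proof. exact: integrable_translate (ltW h0) alphaD_int. Qed.

Let alphaDelta_int : mu.-integrable setT (EFin \o (fun x => alpha x * Delta h x)).
Proof.
have iDelta : mu.-integrable setT (EFin \o Delta h).
  have := integrableB measurableT (integrable_shift (h *: delta i) U_int) U_int.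
  by apply: eq_integrable => // x _; rewrite /= -EFinB.
apply: (@integrable_dominated R d _ (Delta h) M) => //; first exact: measurable_funM.
by move=> x; rewrite normrM ler_wpM2r.
Qed.

(* F1 is the linearized increment of W, spread along the segment from x to x + h. *)
Let J1 : (\int[mu \x lam]_p F1 p = \int[mu]_x (alpha x * Delta h x)%:E)%E.
Proof.
rewrite -(integral12_prod_meas1 F1_int); apply: ae_eq_integral => //.
- exact: (measurable_int _ (integrable_fubini_F F1_int)).
- exact: (measurable_int _ alphaDelta_int).
have := ae_integrable1 (integrable_translate (delta i : 'rV[R]_d) (ltW h0) (D_int i)).
apply: filterS2 (difference_identity i uG h0 rh) => x dx ix _ /=.
rewrite /fubini_F /F1/=.
have [xr|nxr] := pselect (eball 0 r x); last first.
  by under eq_integral do rewrite alpha_r// mul0r; rewrite integral0 alpha_r// mul0r.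
rewrite [RHS]EFinM /Delta dx// -(integralZl measurableT ix).
by apply: eq_integral => t _; rewrite -?EFinM.
Qed.

(* F2 carries the weight alpha along with D, so that its shift integrates out. *)
Let J2 : (\int[mu \x lam]_p F2 p = h%:E * \int[mu]_x (alpha x * D i x)%:E)%E.
Proof.
rewrite -(integral21_prod_meas1 F2_int) /fubini_G.
have slice (t : R) : (\int[mu]_x F2 (x, t) =
    (I0 h t)%:E * \int[mu]_x (alpha x * D i x)%:E)%E.
  rewrite -(integral_shift (t *: delta i) alphaD_int).
  rewrite -integralZl//; last exact: integrable_shift.
  by apply: eq_integral => x _; rewrite /F2 /= mulrC EFinM.
under eq_integral do rewrite slice.
have c_fin : (\int[mu]_x (alpha x * D i x)%:E)%E \is a fin_num.
  exact: (integrable_fin_num measurableT alphaD_int).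
rewrite -(fineK c_fin); move: (fine _) => a.
under eq_integral do rewrite muleC.
rewrite integralZl//; first by rewrite integral_I0 1?muleC// ltW.
apply: ge0_integrable.
- by apply/measurable_EFinP; apply: measurable_indic; exact: measurable_itv.
- by move=> t _; rewrite lee_fin I0_ge0.
- by rewrite integral_I0 ?ltry// ltW.
Qed.

Let K : R := L ^+ 2 * fine (mu B) + (M / dl) ^+ 2 * (d%:R * energy) + energy / 2.

Let alpha_increment x (t : R) : 0 <= t <= h -> eball 0 (r + h) x ->
  (alpha x - alpha (x + t *: delta i)) ^+ 2 <=
  2 * L ^+ 2 * h ^+ 2 + 2 * (M / dl) ^+ 2 * Delta t x ^+ 2.
Proof.
move=> /andP[t0 th] xr; set y := x + t *: delta i.
have line t' : 0 <= t' <= t -> eball 0 r0 (x + t' *: delta i).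
  move=> /andP[t'0 t't]; apply: (@eball0S R d (r + h + h)).
    by rewrite (le_trans _ rhr0)// lerD2l ler_peMl ?ltW// ltr1n.
  by apply: eball0D => //; rewrite enorm_delta ger0_norm// (le_trans t't).
have fxy : `|f y - f x| <= L * h.
  by rewrite (le_trans (fL t0 line))// ler_wpM2l.
have cxy : `|c y - c x| <= `|Delta t x| / dl.
  rewrite (le_trans (clamp_lip dl0 _ _))// /Delta -/y.
  by rewrite (_ : k - U y - (k - U x) = - (U y - U x)) ?normrN//; ring.
have /andP[cy0 cy1] := c_itv y.
have : `|alpha x - alpha y| <= L * h + M / dl * `|Delta t x|.
  rewrite (_ : _ - _ = - ((f y - f x) * c y + f x * (c y - c x))); last first.
    by rewrite /alpha; ring.
  rewrite normrN (le_trans (ler_normD _ _))// lerD// normrM.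
    by rewrite (ger0_norm cy0) (le_trans _ fxy)// ler_piMr.
  by rewrite mulrAC -mulrA ler_pM.
set A := alpha x - alpha y; set p := L * h; set q := M / dl * `|_| => Apq.
rewrite -(real_normK (num_real A)) -(real_normK (num_real (Delta t x))).
rewrite (_ : _ + _ = 2 * p ^+ 2 + 2 * q ^+ 2); last by rewrite /p /q; ring.
have p0 : 0 <= p by rewrite mulr_ge0// ltW.
have q0 : 0 <= q by rewrite mulr_ge0// divr_ge0// ltW.
apply: (@le_trans _ _ ((p + q) ^+ 2)); first by rewrite ler_pXn2r ?nnegrE ?addr_ge0.
by have := sqr_ge0 (p - q); nra.
Qed.

Let alpha_increment_out x (t : R) : 0 <= t <= h -> ~ eball 0 (r + h) x ->
  alpha x - alpha (x + t *: delta i) = 0.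
Proof.
move=> /andP[t0 th] nx; rewrite !alpha_r ?subr0//.
  move=> xr; apply: nx; rewrite -(addrK (t *: delta i) x).
  apply: (@eball0S R d (r + t)); first by rewrite lerD2l.
  by apply: eball0D => //; rewrite enormN enorm_delta ger0_norm.
by move=> xr; apply: nx; apply: eball0S xr; rewrite lerDl ltW.
Qed.

(* The difference of the two weights is itself of the order of an increment of f
   or of U, so that the product with D is of the order of h after integration. *)
Let slice_bound (t : R) : 0 <= t <= h ->
  (\int[mu]_x (`|(alpha x - alpha (x + t *: delta i)) * D i (x + t *: delta i)|)%:E
   <= (K * h)%:E)%E.
Proof.
move=> tI; have /andP[t0 th] := tI; set Br : set 'rV[R]_d := eball 0 (r + h).
have mBr : measurable Br by exact: measurable_eball0.
have mD' : measurable_fun setT (fun x : 'rV[R]_d => D i (x + t *: delta i)).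
  by apply: (measurableT_comp (mD i)); exact: measurable_row_shift.
have malpha' : measurable_fun setT (fun x : 'rV[R]_d => alpha (x + t *: delta i)).
  by apply: (measurableT_comp malpha); exact: measurable_row_shift.
rewrite (integral_supported (A := Br)); last first.
  by move=> x nx; rewrite alpha_increment_out// mul0r normr0.
pose a1 : R := L ^+ 2 * h.
pose a2 : R := (M / dl) ^+ 2 / h.
have a10 : 0 <= a1 by rewrite mulr_ge0 ?sqr_ge0// ltW.
have a20 : 0 <= a2 by rewrite divr_ge0 ?sqr_ge0// ltW.
apply: (@le_trans _ _ (\int[mu]_(x in Br) (a1%:E + (a2%:E * (Delta t x ^+ 2)%:E +
    (h / 2)%:E * (D i (x + t *: delta i) ^+ 2)%:E)))%E).
  apply: ge0_le_integral => //.
  - apply/measurable_EFinP; apply: measurable_funTS.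
    apply: (measurableT_comp (@normr_measurable R setT)).
    by apply: measurable_funM => //; exact: measurable_funB.
  - apply: emeasurable_funD; first exact: measurable_cst.
    apply: emeasurable_funD; apply: emeasurable_funM; first exact: measurable_cst.
    + by apply/measurable_EFinP; apply: measurable_funTS; apply: measurable_funX.
    + exact: measurable_cst.
    + by apply/measurable_EFinP; apply: measurable_funTS; apply: measurable_funX.
  - move=> x xBr; rewrite -!EFinM -!EFinD lee_fin normrM.
    have := alpha_increment tI xBr; set A := alpha x - _; set D' := D i _ => A2.
    (* 2 |A| |D'| <= A^2 / h + h D'^2 *)
    have : `|A| * `|D'| <= A ^+ 2 / (2 * h) + h / 2 * D' ^+ 2.
      rewrite -subr_ge0 -(real_normK (num_real A)) -(real_normK (num_real D')).
      rewrite (_ : _ - _ = (`|A| - h * `|D'|) ^+ 2 / (2 * h)).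
        by rewrite divr_ge0 ?sqr_ge0// mulr_ge0// ltW.
      by field; rewrite gt_eqF.
    move/le_trans; apply; rewrite addrA lerD2r ler_pdivrMr ?mulr_gt0//.
    rewrite (le_trans A2)// le_eqVlt; apply/orP; left; apply/eqP.
    by rewrite /a1 /a2; field; rewrite gt_eqF// gt_eqF.
have n2 x : (0 <= (Delta t x ^+ 2)%:E :> \bar R)%E by rewrite lee_fin sqr_ge0.
have n3 x : (0 <= (D i (x + t *: delta i) ^+ 2)%:E :> \bar R)%E.
  by rewrite lee_fin sqr_ge0.
have h20 : 0 <= h / 2 by rewrite divr_ge0// ltW.
have m2 : measurable_fun Br (fun x => (Delta t x ^+ 2)%:E).
  by apply/measurable_EFinP; apply: measurable_funTS; apply: measurable_funX.
have m3 : measurable_fun Br (fun x => (D i (x + t *: delta i) ^+ 2)%:E).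
  by apply/measurable_EFinP; apply: measurable_funTS; apply: measurable_funX.
rewrite ge0_integralD//; last 2 first.
- by move=> x _; rewrite adde_ge0// mule_ge0.
- by apply: emeasurable_funD; apply: emeasurable_funM => //; exact: measurable_cst.
rewrite ge0_integralD//; last 4 first.
- by move=> x _; rewrite mule_ge0.
- by apply: emeasurable_funM => //; exact: measurable_cst.
- by move=> x _; rewrite mule_ge0.
- by apply: emeasurable_funM => //; exact: measurable_cst.
rewrite integral_cst// ge0_integralZl// ge0_integralZl//.
have muB : mu B = (fine (mu B))%:E by rewrite fineK// ge0_fin_numE.
apply: (@le_trans _ _ (a1%:E * (fine (mu B))%:E + (a2%:E * (d%:R * h ^+ 2 * energy)%:E +
    (h / 2)%:E * energy%:E)))%E.
  apply: leeD.
    rewrite lee_wpmul2l// -muB; apply: le_measure; rewrite ?inE//.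
    exact: eball0S.
  apply: leeD; rewrite lee_wpmul2l//.
    apply: (le_trans (@increment_le i (r + h) t t0 _)).
      by rewrite (le_trans _ rhr0)// lerD2l ler_wpM2l.
    rewrite lee_fin ler_wpM2r// ler_wpM2l// ler_pXn2r ?nnegrE//.
    by rewrite ltW.
  apply: le_trans (D2_le i).
  rewrite -(@ge0_integral_shift R d (t *: delta i) (fun x => (D i x ^+ 2)%:E))//; last 2 first.
  - by apply/measurable_EFinP; exact: measurable_funX.
  - by move=> x; rewrite lee_fin sqr_ge0.
  apply: ge0_subset_integral => //.
  by apply/measurable_EFinP; exact: measurable_funX.
rewrite -!EFinM -!EFinD lee_fin le_eqVlt; apply/orP; left; apply/eqP.
by rewrite /K /a1 /a2; field; rewrite gt_eqF// gt_eqF.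
Qed.

(** The increments of the regularized truncation W, tested against f, are those of
    its candidate derivative V up to O(h^2).  The error consists of products of two
    increments, or of an increment with the gradient over a time h; both are
    controlled by [translation_estimate].  The constant blows up as dl -> 0, so
    that h -> 0 has to be taken first. *)
Lemma truncation_step :
  `|\int[mu]_x (f x * (W (x + h *: delta i) - W x)) - h * \int[mu]_x (f x * V x)|
   <= (M / dl * (d%:R * energy) + K) * h ^+ 2.
Proof.
have iW' : mu.-integrable setT (EFin \o (fun x : 'rV[R]_d => W (x + h *: delta i) - W x)).
  have := integrableB measurableT (integrable_shift (h *: delta i) W_int) W_int.
  by apply: eq_integrable => // x _; rewrite /= -EFinB.
have /measurable_EFinP mW' := measurable_int _ iW'.
have ifW : mu.-integrable setT (EFin \o (fun x => f x * (W (x + h *: delta i) - W x))).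
  apply: (integrable_dominated (k := M) _ iW') => //; first exact: measurable_funM.
  by move=> x; rewrite normrM ler_wpM2r.
pose a x := f x * (W (x + h *: delta i) - W x) + alpha x * Delta h x.
have ia : mu.-integrable setT (EFin \o a).
  have := integrableD measurableT ifW alphaDelta_int.
  by apply: eq_integrable => // x _; rewrite /= -EFinD.
have fV : \int[mu]_x (f x * V x) = - \int[mu]_x (alpha x * D i x).
  transitivity (-1 * \int[mu]_x (alpha x * D i x)); last by rewrite mulN1r.
  rewrite -(RintegralZl (-1) measurableT alphaD_int).
  by apply: eq_Rintegral => x _; rewrite /= /V /alpha mulN1r mulrN mulrA.
have aE : \int[mu]_x (f x * (W (x + h *: delta i) - W x)) =
    \int[mu]_x a x - \int[mu]_x (alpha x * Delta h x).
  by rewrite RintegralD// addrK.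
have a_small : `|\int[mu]_x a x| <= M / dl * (d%:R * energy) * h ^+ 2.
  apply: normr_Rintegral_le => //.
  rewrite (integral_supported (A := eball 0 r)); last first.
    by move=> x nx; rewrite /a alpha_r// fr// !mul0r addr0 normr0.
  have Md : 0 <= M / dl by rewrite divr_ge0// ltW.
  apply: (@le_trans _ _ (\int[mu]_(x in eball 0 r) ((M / dl)%:E * (Delta h x ^+ 2)%:E))%E).
    apply: ge0_le_integral => //.
    - exact: measurable_eball0.
    - apply/measurable_EFinP; apply: measurable_funTS.
      apply: (measurableT_comp (@normr_measurable R setT)).
      by have /measurable_EFinP := measurable_int _ ia.
    - apply: emeasurable_funM; first exact: measurable_cst.
      by apply/measurable_EFinP; apply: measurable_funTS; apply: measurable_funX.
    - by move=> x _; rewrite -EFinM lee_fin first_order.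
  have mr : measurable (eball (0 : 'rV[R]_d) r) by exact: measurable_eball0.
  have m2 : measurable_fun (eball 0 r) (fun x => (Delta h x ^+ 2)%:E).
    by apply/measurable_EFinP; apply: measurable_funTS; apply: measurable_funX.
  have n2 x : (0 <= (Delta h x ^+ 2)%:E :> \bar R)%E by rewrite lee_fin sqr_ge0.
  rewrite ge0_integralZl//.
  rewrite -(mulrA (M / dl)) [leRHS]EFinM lee_wpmul2l// mulrAC.
  apply: (le_trans (@increment_le i r h (ltW h0) _)); last by [].
  by rewrite (le_trans _ rhr0)// lerD2r lerDl ltW.
have J_small : `|\int[mu]_x (alpha x * Delta h x) - h * \int[mu]_x (alpha x * D i x)|
    <= K * h ^+ 2.
  have -> : \int[mu]_x (alpha x * Delta h x) - h * \int[mu]_x (alpha x * D i x) =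
      fine (\int[mu \x lam]_p (F1 p - F2 p))%E.
    rewrite integralB// J1 J2 fineB//.
    - by rewrite fineM//; exact: integrable_fin_num alphaD_int.
    - exact: integrable_fin_num alphaDelta_int.
    - by rewrite fin_numM//; exact: integrable_fin_num alphaD_int.
  have iF := integrableB measurableT F1_int F2_int.
  have mF := measurable_int _ iF.
  rewrite -lee_fin -abse_EFin fineK; last exact: integrable_fin_num iF.
  apply: (le_trans (le_abse_integral _ _ mF)) => //.
  rewrite (fubini_tonelli2 (fun p => `|F1 p - F2 p|%E))//; last exact: measurableT_comp.
  apply: (@le_trans _ _ (\int[lam]_t ((K * h)%:E * (I0 h t)%:E))%E).
    apply: ge0_le_integral => //.
    - by move=> t _; exact: integral_ge0.
    - apply: (measurable_fun_fubini_tonelli_G (fun p => `|F1 p - F2 p|%E)) => //.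
      exact: measurableT_comp.
    - apply: emeasurable_funM; first exact: measurable_cst.
      by apply/measurable_EFinP; apply: measurable_indic; exact: measurable_itv.
    - move=> t _; rewrite /fubini_G /F1 /F2 /= I0E.
      have [th|_] := boolP (0 <= (t : R) <= h); last first.
        rewrite mule0; under eq_integral do rewrite !mulr0 subrr normr0.
        by rewrite integral0.
      rewrite mule1; apply: le_trans (slice_bound th); rewrite le_eqVlt.
      apply/orP; left; apply/eqP; apply: eq_integral => x _.
      by rewrite !mulr1 -mulrBl.
  have K0 : 0 <= K.
    have dlV : 0 <= dl^-1 by rewrite invr_ge0 ltW.
    by rewrite /K !addr_ge0// ?divr_ge0// ?mulr_ge0// ?sqr_ge0// ?fine_ge0.
  have mI0 : measurable_fun setT (fun t : measurableTypeR R => (I0 h t)%:E).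
    by apply/measurable_EFinP; apply: measurable_indic; exact: measurable_itv.
  have nI0 t : (0 <= (I0 h t)%:E :> \bar R)%E by rewrite lee_fin I0_ge0.
  have Kh0 : (0 <= (K * h)%:E :> \bar R)%E by rewrite lee_fin mulr_ge0// ltW.
  rewrite ge0_integralZl//.
  by rewrite integral_I0 ?(ltW h0)// -EFinM lee_fin expr2 mulrA.
rewrite aE fV mulrN opprK -addrA.
rewrite (_ : - _ + _ = - (\int[mu]_x (alpha x * Delta h x)
    - h * \int[mu]_x (alpha x * D i x))); last by rewrite opprB addrC.
by rewrite (le_trans (ler_normB _ _))// mulrDl lerD.
Qed.

End step.
End truncation_estimate.

Section weak_gradient_truncation.
Context {R : realType} {d : nat}.
Local Notation mu := (@lebesgue_row R d).
Local Notation delta := (delta_mx ord0).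

Let harmonic_pos n : 0 < harmonic n :> R. Proof. exact: harmonic_gt0. Qed.

(** At z = 0 the limit is 0, which is why the gradient of the truncation vanishes on
    the level set u = k. *)
Lemma clamp_cvg (z : R) :
  clamp (harmonic n) z @[n --> \oo] --> ((0 < z)%R%:R : R).
Proof.
have [z0|z0] := ltP 0 z; last first.
  rewrite (_ : (fun n => _) = cst 0); first exact: cvg_cst.
  apply/funext => n; have [y zE [[_ ->]|[yI _]|[y1 _]]//] := clampP (harmonic_pos n) z.
  - have y0 : y = 0.
      apply/eqP; rewrite eq_le; case/andP: yI => -> _; rewrite andbT.
      by move: z0; rewrite zE pmulr_lle0// harmonic_gt0.
    by rewrite zE y0 mul0r /clamp mul0r (min_idPr _) ?ler01// maxxx.
  - by move: z0; rewrite zE pmulr_lle0 ?harmonic_gt0// => /(le_trans y1); rewrite ler10.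
apply: (@cvg_trans _ (cst 1 @ \oo)); last exact: cvg_cst.
apply: near_eq_cvg; near=> n.
have hz : harmonic n <= z.
  near: n; have /cvgrPdist_le/(_ z z0) := @cvg_harmonic R.
  by apply: filterS => n; rewrite sub0r normrN; exact: le_trans (ler_norm _).
have [y zE] := clampP (harmonic_pos n) z; have y1 : 1 <= y.
  by rewrite -(ler_pM2r (harmonic_pos n)) mul1r -zE.
case=> -[yI ->] /=.
- by move: (le_trans y1 yI); rewrite ler10.
- by case/andP: yI => _ y1'; apply/eqP; rewrite eq_le y1 y1'.
- by [].
Unshelve. all: by end_near. Qed.

Variables (r0 k : R) (u : 'rV[R]_d -> R) (G : 'I_d -> 'rV[R]_d -> R).
Hypothesis uG : weak_gradient (eball 0 r0) u G.

Let B : set 'rV[R]_d := eball 0 r0.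
Let U := u \_ B.
Let D i := G i \_ B.

Let mB : measurable B. Proof. exact: measurable_eball0. Qed.

Let Boo : (mu B < +oo)%E. Proof. exact: eball0_lty. Qed.

Let D_int i : mu.-integrable setT (EFin \o D i).
Proof. by have [_ GL2 _] := uG; exact: L2_restrict_integrable. Qed.

Let U_int : mu.-integrable setT (EFin \o U).
Proof. by have [uL2 _ _] := uG; exact: L2_restrict_integrable. Qed.

Let mU : measurable_fun setT U.
Proof. by have /measurable_EFinP := measurable_int _ U_int. Qed.

Let mD i : measurable_fun setT (D i).
Proof. by have /measurable_EFinP := measurable_int _ (D_int i). Qed.

Let w : 'rV[R]_d -> R := ((fun x => u x - k)^\-)%R.

(** This is the weak gradient of (u - k)_-. *)
Definition truncated_gradient (i : 'I_d) (x : 'rV[R]_d) : R :=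
  - ((u x < k)%R%:R * G i x).

Let wE x : w x = Num.max (k - u x) 0.
Proof. by rewrite /w /funrneg opprB. Qed.

Let exc : 'rV[R]_d -> R := fun x => k * \1_B x - U x.

Let exc_int : mu.-integrable setT (EFin \o exc).
Proof. exact: (restricted_excess_integrable uG k). Qed.

Let excE x : B x -> exc x = k - U x.
Proof. by move=> Bx; rewrite /exc indicE mem_set// mulr1. Qed.

Let UE x : B x -> U x = u x.
Proof. by move=> Bx; rewrite /U /patch mem_set. Qed.

Section tested_truncation.
Variables (f : 'rV[R]_d -> R) (i : 'I_d).
Hypothesis ft : test_function (eball 0 r0) f.

Let mf : measurable_fun setT f.
Proof. by apply: continuous_measurable_row; exact: test_function_continuous ft. Qed.

Let mpf : measurable_fun setT (partial i f).
Proof. apply: continuous_measurable_row; exact: test_function_partial_continuous ft _. Qed.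

Let Wn (dl : R) := (fun x => huber dl (k - U x)) \_ B.
Let Vn (dl : R) x := - (clamp dl (k - U x) * D i x).

Let mz : measurable_fun setT (fun x => k - U x).
Proof. by apply: measurable_funB => //; exact: measurable_cst. Qed.

Let mc dl : measurable_fun setT (fun x => clamp dl (k - U x)).
Proof.
apply: measurable_maxr; first exact: measurable_cst.
apply: measurable_minr; first exact: measurable_cst.
by apply: measurable_funM => //; exact: measurable_cst.
Qed.

Let mW dl : measurable_fun setT (Wn dl).
Proof.
apply/(measurable_restrictT _ mB); apply: measurable_funTS.
rewrite /huber; apply: measurable_funB; first exact: measurable_funM.
apply: measurable_funM; first exact: measurable_cst.
by apply: measurable_funX; exact: mc.
Qed.

Let W_exc (dl : R) : 0 < dl -> forall x, `|Wn dl x| <= 1 * `|exc x|.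
Proof.
move=> dl0 x; rewrite mul1r /Wn /patch; case: ifPn => [/set_mem Bx|_]; last first.
  by rewrite normr0.
rewrite excE//; have /andP[h0 h1] := huber_itv dl0 (k - U x).
rewrite (ger0_norm h0) (le_trans h1)// ge_max normr_ge0 andbT; exact: ler_norm.
Qed.

Let V_D (dl : R) : forall x, `|Vn dl x| <= 1 * `|D i x|.
Proof.
move=> x; rewrite normrN normrM ler_wpM2r//.
by have /andP[c0 c1] := clamp_itv dl (k - U x); rewrite ger0_norm.
Qed.

Let smoothed (dl : R) : 0 < dl ->
  \int[mu]_x (Wn dl x * partial i f x) = - \int[mu]_x (f x * Vn dl x).
Proof.
move=> dl0.
have iW : mu.-integrable setT (EFin \o Wn dl).
  exact: (integrable_dominated (mW dl) exc_int (W_exc dl0)).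
have iV : mu.-integrable setT (EFin \o Vn dl).
  apply: (integrable_dominated _ (D_int i) (V_D dl)).
  by apply: measurable_funN; exact: measurable_funM.
have [M M0 fM] := test_function_bounded ft.
have [L L0 fL] := test_function_increment_bound ft r0.
have [r rr0 fr] := test_function_support ft.
have den : 0 < d.+3%:R :> R by rewrite ltr0n.
apply: (@weak_derivative_criterion R d r0 f ft (Wn dl) (Vn dl) _
  ((r0 - r) / d.+3%:R)  i iW iV).
- by move=> x nx; rewrite /Wn /patch memNset.
- by rewrite divr_gt0// subr_gt0.
- move=> h /andP[h0 hh]; apply: (truncation_step uG k ft dl0 M0 fM L0 (fL i) fr h0).
  move: hh; rewrite ltr_pdivlMr// -natr1 mulrDr mulr1 mulrC => hh.
  by rewrite -addrA (addrC h) -lerBrDl ltW.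
Qed.

(** Dominated convergence as the regularization parameter tends to 0. *)
Lemma weak_identity_truncation :
  (\int[mu]_(x in B) (w x * partial i f x)%:E =
   - \int[mu]_(x in B) (truncated_gradient i x * f x)%:E)%E.
Proof.
have [M M0 fM] := test_function_bounded ft.
have [N N0 pN] := closedbox_bounded r0 (@test_function_partial_continuous _ _ _ _ ft i).
pose W := w \_ B; pose V x := - ((0 < k - U x)%R%:R * D i x).
have iexc g (K : R) : mu.-integrable setT (EFin \o g) ->
    mu.-integrable setT (EFin \o (fun x : 'rV[R]_d => K * `|g x|)).
  move=> ig; rewrite (_ : EFin \o _ = fun x => (K%:E * `|(g x)%:E|)%E); last exact/funext.
  by apply: integrableZl => //; exact: integrable_abse.
have mWl : measurable_fun setT W.
  apply/(measurable_restrictT _ mB).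
  have mw : measurable_fun setT (fun x => Num.max (k - U x) 0).
    by apply: measurable_maxr => //; exact: measurable_cst.
  apply: (eq_measurable_fun (fun x => Num.max (k - U x) 0)); last exact: measurable_funTS.
  by move=> x /set_mem Bx; rewrite wE UE.
have mV : measurable_fun setT V.
  apply: measurable_funN; apply: measurable_funM => //.
  rewrite (_ : (fun x => _) = fun x => if 0 < k - U x then 1 else 0 : R); last first.
    by apply/funext => x; case: ifP.
  apply: measurable_fun_ifT; [|exact: measurable_cst|exact: measurable_cst].
  by apply: measurable_fun_ltr => //; exact: measurable_cst.
have limW : (\int[mu]_x (Wn (harmonic n) x * partial i f x)) @[n --> \oo] -->
    (\int[mu]_x (W x * partial i f x)).
  apply: (@Rintegral_dominated_cvg R d _ _ (fun x => N * `|exc x|)) => //.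
  - by move=> n; exact: measurable_funM.
  - exact: measurable_funM.
  - move=> x; apply: cvgMr_tmp; rewrite /Wn /W /patch; case: ifPn => [/set_mem Bx|_].
      rewrite wE -(UE Bx); apply/cvgrPdist_le => e e0; near=> n.
      rewrite distrC (le_trans (huber_approx (harmonic_pos n) _))//; near: n.
      have /cvgrPdist_le/(_ e e0) := @cvg_harmonic R.
      by apply: filterS => n; rewrite sub0r normrN; exact: le_trans (ler_norm _).
    exact: cvg_cst.
  - exact: iexc.
  - move=> n x; have [Bx|nB] := pselect (B x); last first.
      by rewrite /Wn /patch memNset// mul0r normr0 mulr_ge0.
    rewrite normrM mulrC ler_pM// ?pN//.
    by have := W_exc (harmonic_pos n) x; rewrite mul1r.
have limV : (- \int[mu]_x (f x * Vn (harmonic n) x)) @[n --> \oo] -->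
    (- \int[mu]_x (f x * V x)).
  apply: cvgN; apply: (@Rintegral_dominated_cvg R d _ _ (fun x => M * `|D i x|)).
  - by move=> n; apply: measurable_funM => //; apply: measurable_funN; exact: measurable_funM.
  - exact: measurable_funM.
  - move=> x; apply: cvgMl_tmp; apply: cvgN; apply: cvgMr_tmp; exact: clamp_cvg.
  - exact: iexc.
  - move=> n x; rewrite normrM ler_pM// ?fM//.
    by have := V_D (harmonic n) x; rewrite mul1r.
have limW' : (- \int[mu]_x (f x * Vn (harmonic n) x)) @[n --> \oo] -->
    (\int[mu]_x (W x * partial i f x)).
  by under eq_fun do rewrite -smoothed ?harmonic_gt0//.
have key : \int[mu]_x (W x * partial i f x) = - \int[mu]_x (f x * V x).
  exact: (cvg_unique _ limW' limV).
rewrite integral_restrict_mul -/W (integral_restrict_mul B (truncated_gradient i) f).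
have VE : (fun x => ((truncated_gradient i \_ B) x * f x)%:E) =
    (fun x => (f x * V x)%:E).
  apply/funext => x; rewrite /patch /V /D /patch; case: ifPn => [/set_mem Bx|_].
    by rewrite UE// subr_gt0 mulrC.
  by rewrite mulr0 oppr0 mul0r mulr0.
rewrite VE.
have iWp : mu.-integrable setT (EFin \o (fun x => W x * partial i f x)).
  apply: (@integrable_dominated R d _ exc N) => //; first exact: measurable_funM.
  move=> x; have [Bx|nB] := pselect (B x); last first.
    by rewrite /W /patch memNset// mul0r normr0 mulr_ge0.
  rewrite normrM mulrC ler_pM// ?pN// /W /patch mem_set// wE -(UE Bx) excE//.
  by rewrite ger0_norm ?le_max ?lexx ?orbT// ge_max normr_ge0 andbT ler_norm.
have ifV : mu.-integrable setT (EFin \o (fun x => f x * V x)).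
  apply: (@integrable_dominated R d _ (D i) M) => //; first exact: measurable_funM.
  move=> x; rewrite normrM ler_pM// ?fM// normrN normrM ler_piMl//.
  by case: (0 < _); rewrite ?normr1 ?normr0.
rewrite -[LHS]fineK; last exact: integrable_fin_num iWp.
rewrite -[in RHS](fineK (integrable_fin_num measurableT ifV)).
by rewrite -EFinN; congr EFin; exact: key.
Unshelve. all: by end_near. Qed.

End tested_truncation.

Lemma weak_gradient_truncation : weak_gradient B w truncated_gradient.
Proof.
have [[mu_ uoo] GL2 _] := uG.
have iU2 := L2_restrict_sqr_integrable mB (conj mu_ uoo).
split; last by move=> f ft i; exact: weak_identity_truncation.
- split.
    apply: measurable_funrneg; apply: measurable_funB => //; exact: measurable_cst.
  have iK : mu.-integrable setT (fun x => ((2 * k ^+ 2)%:E * (\1_B x)%:E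
      + 2%:E * ((U x) ^+ 2)%:E)%E).
    by apply: integrableD => //; apply: integrableZl => //; exact: integrable_indicator.
  have fin := integral_fune_lt_pinfty measurableT iK.
  rewrite integral_mkcond; apply: le_lt_trans fin; apply: ge0_le_integral => //.
  + by move=> x _; rewrite /patch; case: ifP => // _; rewrite lee_fin sqr_ge0.
  + apply/(measurable_restrictT _ mB); apply/measurable_EFinP; apply: measurable_funX.
    by apply: measurable_funrneg; apply: measurable_funB => //; exact: measurable_cst.
  + exact: (measurable_int _ iK).
  + move=> x _; rewrite -!EFinM -EFinD /patch indicE; case: ifPn => [/set_mem Bx|_].
      rewrite lee_fin mulr1 wE UE//.
      have : Num.max (k - u x) 0 ^+ 2 <= (k - u x) ^+ 2.
        by case: (lerP (k - u x) 0) => _; rewrite ?expr0n/= ?sqr_ge0 ?lexx.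
      by move/le_trans; apply; have := sqr_ge0 (k + u x); nra.
    by rewrite lee_fin mulr0 add0r mulr_ge0// sqr_ge0.
- move=> i; have [mG Goo] := GL2 i.
  have mt : measurable_fun B (truncated_gradient i).
    apply: measurable_funN; apply: measurable_funM => //.
    rewrite (_ : (fun x => _) = fun x => if u x < k then 1 else 0 : R); last first.
      by apply/funext => x; case: ifP.
    apply: (eq_measurable_fun (fun x => if U x < k then 1 else 0 : R)).
      by move=> x /set_mem Bx; rewrite UE.
    apply: measurable_funTS.
    apply: measurable_fun_ifT; [|exact: measurable_cst|exact: measurable_cst].
    by apply: measurable_fun_ltr => //; exact: measurable_cst.
  split => //; apply: le_lt_trans Goo; apply: ge0_le_integral => //.
  + by move=> x _; rewrite lee_fin sqr_ge0.
  + by apply/measurable_EFinP; exact: measurable_funX.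
  + by apply/measurable_EFinP; exact: measurable_funX.
  + move=> x _; rewrite lee_fin sqrrN exprMn ler_piMl ?sqr_ge0//.
    by case: (u x < k); rewrite ?expr1n ?expr0n.
Qed.

End weak_gradient_truncation.

(** * The isoperimetric inequality of De Giorgi *)

Section correlation.
Context {R : realType} {d : nat}.
Local Notation mu := (@lebesgue_row R d).

Lemma measurable_row_add :
  measurable_fun setT (fun p : 'rV[R]_d * 'rV[R]_d => p.1 + p.2).
Proof.
apply: measurable_fun_row => i; rewrite (_ : (fun _ => _) =
    (fun p : 'rV[R]_d * 'rV[R]_d => p.1 ord0 i + p.2 ord0 i)); last first.
  by apply/funext => p; rewrite !mxE.
apply: measurable_funD.
  by apply: (measurableT_comp (measurable_coord i)); exact: measurable_fst.
by apply: (measurableT_comp (measurable_coord i)); exact: measurable_snd.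
Qed.

Variables f g : 'rV[R]_d -> \bar R.
Hypotheses (mf : measurable_fun setT f) (mg : measurable_fun setT g).
Hypotheses (f0 : forall x, (0 <= f x)%E) (g0 : forall x, (0 <= g x)%E).

Let mfg : measurable_fun setT
  (fun p : 'rV[R]_d * 'rV[R]_d => f p.1 * g (p.1 + p.2)%R)%E.
Proof.
apply: emeasurable_funM; first by apply: (measurableT_comp mf); exact: measurable_fst.
by apply: (measurableT_comp mg); exact: measurable_row_add.
Qed.

Lemma measurable_correlation :
  measurable_fun setT (fun h : 'rV[R]_d => \int[mu]_x (f x * g (x + h)%R))%E.
Proof.
apply: (@measurable_fun_fubini_tonelli_G _ _ _ _ R mu
  (fun p : 'rV[R]_d * 'rV[R]_d => f p.1 * g (p.1 + p.2)%R)%E) => //.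
by move=> p; rewrite mule_ge0.
Qed.

(** Averaging over translations decouples two functions: Fubini and translation
    invariance.  This replaces Sobolev and Poincare inequalities in what follows. *)
Lemma integral_correlation :
  (\int[mu]_h \int[mu]_x (f x * g (x + h)%R) = \int[mu]_x f x * \int[mu]_x g x)%E.
Proof.
rewrite -(fubini_tonelli (fun p => f p.1 * g (p.1 + p.2)%R)%E mfg)/=; last first.
  by move=> p; rewrite mule_ge0.
have shift (x : 'rV[R]_d) : (\int[mu]_h (f x * g (x + h)%R) = f x * \int[mu]_x g x)%E.
  rewrite -(@ge0_integral_shift R d x g)//.
  under [in RHS]eq_integral do rewrite addrC.
  rewrite ge0_integralZl//.
  have -> : (fun h : 'rV[R]_d => g (x + h)%R) = (g \o (fun h => h + x)%R).
    by apply/funext => h /=; rewrite addrC.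
  by apply: (measurableT_comp mg); exact: measurable_row_shift.
under eq_integral do rewrite shift.
by rewrite ge0_integralZr//; apply: integral_ge0.
Qed.

End correlation.

Section crossing.
Context {R : realType} {d : nat}.
Local Notation mu := (@lebesgue_row R d).

(** A jump between two values in [0, l] is controlled by its square if it goes all
    the way from 0 to l, and otherwise one of its ends lies strictly inside, where
    the arithmetic-geometric inequality with weight c applies. *)
Lemma increment_le (l c a b : R) : 0 < l -> 0 < c -> 0 <= a <= l -> 0 <= b <= l ->
  b - a <= (c / 2 + l^-1) * (b - a) ^+ 2 +
           (2 * c)^-1 * ((0 < a < l)%R%:R + (0 < b < l)%R%:R).
Proof.
move=> l0 c0 /andP[a0 al] /andP[b0 bl].
have sq0 := sqr_ge0 (b - a); have lV0 : 0 < l^-1 by rewrite invr_gt0.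
have cV0 : 0 < c^-1 by rewrite invr_gt0.
have cc : c * c^-1 = 1 by rewrite divff ?gt_eqF.
have ll : l * l^-1 = 1 by rewrite divff ?gt_eqF.
have cut (z : R) : 1 <= z -> b - a <= (c / 2 + l^-1) * (b - a) ^+ 2 + (2 * c)^-1 * z.
  move=> z1; rewrite invfM.
  have h : (b - a) <= c / 2 * (b - a) ^+ 2 + 2^-1 * c^-1.
    have := sqr_ge0 (c * (b - a) - 1) => h.
    have : 0 <= c^-1 * (c * (b - a) - 1) ^+ 2 by rewrite mulr_ge0// ltW.
    have -> : c^-1 * (c * (b - a) - 1) ^+ 2 =
      (c * c^-1) * (c * (b - a) ^+ 2) - 2 * (c * c^-1) * (b - a) + c^-1 by ring.
    rewrite cc; lra.
  have h1 : 0 <= l^-1 * (b - a) ^+ 2 by rewrite mulr_ge0// ltW.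
  have h2 : 2^-1 * c^-1 <= 2^-1 * c^-1 * z by rewrite ler_peMr// mulr_ge0// ?invr_ge0 ltW.
  by rewrite mulrDl; lra.
have [|] := boolP (0 < a < l).
  by move=> _; apply: cut; case: (0 < b < l); rewrite ?addr0// lerDl.
have [|] := boolP (0 < b < l); first by move=> _ _; apply: cut; rewrite add0r.
rewrite addr0 mulr0 addr0 => b' a'.
have full : (b - a) <= l^-1 * (b - a) ^+ 2.
  have [->|aN0] := eqVneq a 0.
    have [->|bN0] := eqVneq b 0; first by rewrite subrr expr0n mulr0.
    have -> : b = l.
      by apply/eqP; rewrite eq_le bl leNgt; apply: contra b' => ->; rewrite lt_neqAle eq_sym bN0 b0.
    by rewrite subr0 expr2 mulrA mulVf ?gt_eqF// mul1r.
  have al' : a = l.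
    by apply/eqP; rewrite eq_le al leNgt; apply: contra a' => ->; rewrite lt_neqAle eq_sym aN0 a0.
  by apply: (@le_trans _ _ 0); [rewrite al' subr_le0|rewrite mulr_ge0// ltW].
rewrite mulrDl (le_trans full)// lerDr mulr_ge0// mulr_ge0// ?invr_ge0//; exact: ltW.
Qed.

Variables (v : 'rV[R]_d -> R) (l D r e : R).
Hypotheses (mv : measurable_fun setT v) (l0 : 0 < l) (D0 : 0 <= D) (r0 : 0 < r) (e0 : 0 < e).
Hypothesis vl : forall x, 0 <= v x <= l.
Hypothesis osc : forall (h : 'rV[R]_d) eta, 0 <= eta <= e ->
  (forall i, `|h ord0 i| <= eta) ->
  (\int[mu]_(x in eball 0 r) ((v (x + h) - v x) ^+ 2)%:E <= (D * eta ^+ 2)%:E)%E.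

Let E : set 'rV[R]_d := eball 0 r.
Let Z := E `&` [set x | v x = 0].
Let T := E `&` [set x | v x = l].
Let A := E `&` [set x | 0 < v x < l].

Let mE : measurable E. Proof. exact: measurable_eball0. Qed.

Let mlev (P : set R) : measurable P -> measurable (E `&` v @^-1` P).
Proof. by move=> mP; apply: measurableI => //; rewrite -[X in measurable X]setTI; exact: mv. Qed.

Let mZ : measurable Z. Proof. exact: (mlev (measurable_set1 0)). Qed.

Let mT : measurable T. Proof. exact: (mlev (measurable_set1 l)). Qed.

Let mA : measurable A.
Proof.
have -> : A = E `&` v @^-1` `]0, l[%classic; last exact: (mlev (measurable_itv _)).
by rewrite /A; congr (_ `&` _); apply/seteqP; split => x; rewrite /= in_itv.
Qed.

Let mshift (h : 'rV[R]_d) (f : 'rV[R]_d -> R) : measurable_fun setT f ->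
  measurable_fun setT (fun x : 'rV[R]_d => f (x + h)).
Proof. by move=> mf; apply: (measurableT_comp mf); exact: measurable_row_shift. Qed.

Let mEFin (f : 'rV[R]_d -> R) : measurable_fun setT f ->
  measurable_fun setT (fun x : 'rV[R]_d => (f x)%:E).
Proof. by move=> mf; apply/measurable_EFinP. Qed.

(** If v passes from 0 at x to l at x + h, cut the segment from x to x + h, which
    stays in the ball by convexity, into N equal steps: the increments of v add up
    to l.  By [increment_le] each is controlled by its square, whose integral is of
    order N^-2, or by the presence of an end point in the intermediate set.  The
    weight c = t N balances the two contributions, and N is taken large enough to
    absorb the contribution of full jumps. *)
Lemma crossing_measure (h : 'rV[R]_d) (t : R) : 0 < t ->
  (forall i, `|h ord0 i| <= 2 * r) ->
  (l%:E * mu (Z `&` (fun x => (x + h)%R) @^-1` T) <=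
   (4 * t * D * r ^+ 2)%:E + (t^-1)%:E * mu A)%E.
Proof.
move=> t0 hr.
have [N [N0 Ne Nt]] : exists N : nat, [/\ (0 < N)%N, 2 * r / N%:R <= e &
    (l * N%:R)^-1 <= t / 2 :> R].
  pose z := 2 * r / e + 2 / (l * t).
  have z0 : 0 < z by rewrite addr_gt0// divr_gt0// mulr_gt0.
  have := archi_boundP (ltW z0); set N := Num.bound z => zN.
  have N0 : 0 < N%:R :> R by exact: lt_trans z0 zN.
  exists N; split; first by rewrite ltr0n in N0.
  - rewrite ler_pdivrMr// (mulrC e) -ler_pdivrMr//; apply: ltW; apply: le_lt_trans zN; rewrite lerDl.
    by rewrite divr_ge0// ltW// mulr_gt0.
  - have lt0 : 0 < l * t by exact: mulr_gt0.
    have : 2 / (l * t) < N%:R by rewrite (le_lt_trans _ zN)// lerDr divr_ge0 ?mulr_ge0 ?ltW.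
    rewrite ltr_pdivrMr// => /ltW hN.
    rewrite -[leLHS]mul1r ler_pdivrMr ?mulr_gt0//; lra.
have N0' : 0 < N%:R :> R by rewrite ltr0n.
pose s := N%:R^-1 *: h; pose c := t * N%:R.
have c0 : 0 < c by exact: mulr_gt0.
have ind01 (B : set 'rV[R]_d) x : 0 <= \1_B x :> R by rewrite indicE.
pose F (x : 'rV[R]_d) : R := (c / 2 + l^-1) * ((v (x + s) - v x) ^+ 2 * \1_E x) +
  (2 * c)^-1 * (\1_A x + \1_A (x + s)).
have k0 : 0 <= c / 2 + l^-1 by rewrite addr_ge0 ?divr_ge0 ?invr_ge0 ?ltW.
have k1 : 0 <= (2 * c)^-1 by rewrite invr_ge0 mulr_ge0// ltW.
have F0 x : 0 <= F x.
  by rewrite /F addr_ge0// mulr_ge0// ?addr_ge0// mulr_ge0// sqr_ge0.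
have m1 B : measurable B -> measurable_fun setT (\1_B : 'rV[R]_d -> R).
  by move=> mB; exact: measurable_indic.
have msq : measurable_fun setT (fun x : 'rV[R]_d => (v (x + s) - v x) ^+ 2 * \1_E x).
  apply: measurable_funM; last exact: m1.
  by apply: measurable_funX; apply: measurable_funB => //; exact: mshift.
have mAA : measurable_fun setT (fun x : 'rV[R]_d => \1_A x + \1_A (x + s) : R).
  by apply: measurable_funD; [exact: m1|apply: mshift; exact: m1].
have mF : measurable_fun setT F.
  by apply: measurable_funD; apply: measurable_funM => //; exact: measurable_cst.
have seta i : `|s ord0 i| <= 2 * r / N%:R.
  have NV : 0 <= N%:R^-1 :> R by rewrite invr_ge0 ler0n.
  by rewrite mxE normrM mulrC (ger0_norm NV) ler_wpM2r.
have etage : 0 <= 2 * r / N%:R by rewrite divr_ge0// mulr_ge0// ltW.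
have etae : 0 <= 2 * r / N%:R <= e by rewrite etage.
have intF : (\int[mu]_x (F x)%:E <=
    ((c / 2 + l^-1) * (D * (2 * r / N%:R) ^+ 2))%:E + (c^-1)%:E * mu A)%E.
  under eq_integral do rewrite EFinD (EFinM (c / 2 + l^-1)) (EFinM (2 * c)^-1).
  rewrite ge0_integralD//; last 4 first.
  - by move=> x _; rewrite -EFinM lee_fin mulr_ge0// mulr_ge0// sqr_ge0.
  - by apply/measurable_EFinP; apply: measurable_funM => //; exact: measurable_cst.
  - by move=> x _; rewrite -EFinM lee_fin mulr_ge0// addr_ge0.
  - by apply/measurable_EFinP; apply: measurable_funM => //; exact: measurable_cst.
  have msqE := mEFin msq.
  have mAAE := mEFin mAA.
  have p1 x : [set: 'rV[R]_d] x -> (0 <= ((v (x + s) - v x) ^+ 2 * \1_E x)%:E)%E.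
    by move=> _; rewrite lee_fin mulr_ge0// sqr_ge0.
  have p2 x : [set: 'rV[R]_d] x -> (0 <= (\1_A x + \1_A (x + s) : R)%:E)%E.
    by move=> _; rewrite lee_fin addr_ge0.
  rewrite ge0_integralZl// ge0_integralZl//.
  apply: leeD.
    rewrite EFinM lee_wpmul2l//; apply: le_trans (osc etae seta).
    rewrite [leRHS]integral_mkcond le_eqVlt; apply/orP; left; apply/eqP.
    apply: eq_integral => x _; rewrite /patch indicE -/E.
    by case: (x \in E); rewrite ?mulr1 ?mulr0.
  under eq_integral do rewrite EFinD.
  have m1A := mEFin (m1 _ mA).
  have m1As := mEFin (mshift s (m1 _ mA)).
  rewrite ge0_integralD//.
  rewrite (@ge0_integral_shift R d s (fun x => (\1_A x)%:E))//.
  rewrite integral_indic// setIT.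
  rewrite -[X in (X + X)%E]mul1e -ge0_muleDl// muleA lee_wpmul2r// -EFinM lee_fin.
  by rewrite invfM; lra.
pose xj (x : 'rV[R]_d) (j : nat) := x + j%:R *: s.
have xjS x j : xj x j.+1 = xj x j + s by rewrite /xj -addrA -natr1 scalerDl scale1r.
have pw x : l * \1_(Z `&` (fun x => x + h) @^-1` T) x <= \sum_(0 <= j < N) F (xj x j).
  rewrite indicE; case: (boolP (x \in _)) => [|_]; last first.
    by rewrite mulr0 sumr_ge0// => j _; exact: F0.
  move=> /set_mem[[xE vx] [xhE vxh]]; rewrite mulr1.
  have xjE j : (j <= N)%N -> E (xj x j).
    move=> jN; have := @eball0_convex R d r x (x + h) (j%:R / N%:R).
    rewrite (addrC x h) addrK /xj /s scalerA; apply => //; last by rewrite addrC.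
    by rewrite divr_ge0//= ler_pdivrMr// mul1r ler_nat.
  have -> : l = v (xj x N) - v (xj x 0).
    rewrite {2}/xj scale0r addr0 [v x]vx subr0 /xj /s scalerA divff ?gt_eqF// scale1r.
    by rewrite [v _]vxh.
  rewrite -(@telescope_sumr _ _ _ (fun j => v (xj x j)))// !big_nat.
  apply: ler_sum => j /andP[_ jN]; rewrite /F.
  have -> : \1_E (xj x j) = 1 :> R by rewrite indicE mem_set//; exact/xjE/ltnW.
  rewrite mulr1.
  have indA y : E y -> \1_A y = (0 < v y < l)%R%:R :> R.
    move=> Ey; rewrite indicE; congr (nat_of_bool _)%:R; apply/idP/idP.
      by move=> /set_mem[].
    by move=> ?; apply/mem_set.
  rewrite -xjS (indA _ (xjE _ jN)) (indA _ (xjE _ (ltnW jN))).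
  exact: increment_le.
have mZT : measurable (Z `&` (fun x : 'rV[R]_d => x + h) @^-1` T).
  apply: measurableI => //; rewrite -[X in measurable X]setTI.
  exact: measurable_row_shift.
rewrite -[X in mu X]setIT -(integral_indic mu measurableT mZT).
have mP := mEFin (m1 _ mZT).
have P0 x : [set: 'rV[R]_d] x ->
    (0 <= (\1_(Z `&` (fun x => (x + h)%R) @^-1` T) x : R)%:E)%E.
  by move=> _; rewrite lee_fin.
have l0' : (0 <= l%:E :> \bar R)%E by rewrite lee_fin ltW.
rewrite -ge0_integralZl//.
apply: (@le_trans _ _ (\int[mu]_x (\sum_(0 <= j < N) (F (xj x j))%:E)%E)%E).
  apply: ge0_le_integral => //.
  - by move=> x _; rewrite -EFinM lee_fin mulr_ge0// ltW.
  - by apply: emeasurable_funM => //; exact: measurable_cst.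
  - apply: emeasurable_sum => j; apply/measurable_EFinP; exact: (mshift _ mF).
  - by move=> x _; rewrite -EFinM sumEFin lee_fin.
rewrite (@ge0_integral_sum _ _ _ mu setT measurableT nat (fun j x => (F (xj x j))%:E)); last 2 first.
- by move=> j; apply/measurable_EFinP; exact: (mshift _ mF).
- by move=> j x _; rewrite lee_fin.
have mFE := mEFin mF.
have intFj j : (\int[mu]_x (F (xj x j))%:E = \int[mu]_x (F x)%:E)%E.
  by apply: (@ge0_integral_shift R d (j%:R *: s) (fun x => (F x)%:E)).
under eq_bigr do rewrite intFj.
have Aoo : mu A \is a fin_num.
  rewrite ge0_fin_numE//; apply: le_lt_trans (eball0_lty r).
  by apply: le_measure; rewrite ?inE//; exact: subIsetl.
rewrite -(fineK Aoo) -EFinM -EFinD in intF *; set a := fine _ in intF *.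
apply: le_trans (lee_sum _ _) _; first by move=> j _; exact: intF.
rewrite -EFinM -EFinD sumEFin lee_fin sumr_const_nat subn0 -[leLHS]mulr_natr mulrDl lerD//; last first.
  by rewrite /c invfM mulrAC -(mulrA t^-1) mulVf ?gt_eqF// mulr1.
have -> : (c / 2 + l^-1) * (D * (2 * r / N%:R) ^+ 2) * N%:R =
    (2 * t * D * r ^+ 2) * (N%:R * N%:R^-1) ^+ 2 +
    4 * (D * r ^+ 2) * ((l^-1 * N%:R^-1) * (N%:R * N%:R^-1)).
  rewrite /c; move: (N%:R : R) (gt_eqF N0') => n nN0.
  by field; rewrite nN0 gt_eqF.
rewrite divff ?gt_eqF// expr1n !mulr1 -invfM.
have : 4 * (D * r ^+ 2) * (l * N%:R)^-1 <= 4 * (D * r ^+ 2) * (t / 2).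
  by rewrite ler_wpM2l// mulr_ge0// mulr_ge0// sqr_ge0.
lra.
Qed.

(** A function of finite energy cannot pass from 0 to l without spending measure on
    the intermediate values.  Summing [crossing_measure] over all translations h
    turns its left-hand side into a product of measures. *)
Lemma isoperimetric (t : R) : 0 < t ->
  (l%:E * (mu Z * mu T) <=
   mu (eball 0 (2 * r)) * ((4 * t * D * r ^+ 2)%:E + (t^-1)%:E * mu A))%E.
Proof.
move=> t0; have ind01 (B : set 'rV[R]_d) x : (0 <= (\1_B x : R)%:E)%E.
  by rewrite indicE lee_fin.
have mi B : measurable B -> measurable_fun setT (fun x : 'rV[R]_d => (\1_B x : R)%:E).
  by move=> mB; apply: mEFin; exact: measurable_indic.
have mB : measurable (eball (0 : 'rV[R]_d) (2 * r)) by exact: measurable_eball0.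
pose K := ((4 * t * D * r ^+ 2)%:E + (t^-1)%:E * mu A)%E.
have K0 : (0 <= K)%E.
  rewrite adde_ge0 ?mule_ge0 ?lee_fin ?invr_ge0 ?(ltW t0)//.
  by rewrite !mulr_ge0 ?sqr_ge0// ltW.
pose m (h : 'rV[R]_d) := (\int[mu]_x ((\1_Z x : R)%:E * (\1_T (x + h) : R)%:E))%E.
have mE' (h : 'rV[R]_d) : m h = mu (Z `&` (fun x => (x + h)%R) @^-1` T).
  have mh : measurable ((fun x : 'rV[R]_d => x + h) @^-1` T).
    by rewrite -[X in measurable X]setTI; exact: measurable_row_shift.
  rewrite -[X in mu X]setIT -(integral_indic mu measurableT); last exact: measurableI.
  apply: eq_integral => x _; rewrite !indicE -EFinM [in RHS](in_setI x Z) -mulnb natrM.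
  by congr ((_ * (nat_of_bool _)%:R)%:E); apply/idP/idP => /set_mem ?; apply/mem_set.
have mm : measurable_fun setT m.
  by exact: (measurable_correlation (mi _ mZ) (mi _ mT) (ind01 Z) (ind01 T)).
have m0 h : (0 <= m h)%E by rewrite mE'.
have -> : (mu Z * mu T = \int[mu]_h m h)%E.
  rewrite /m (integral_correlation (mi _ mZ) (mi _ mT) (ind01 Z) (ind01 T)).
  by rewrite !(integral_indic mu measurableT)// !setIT.
rewrite -ge0_integralZl//; last by rewrite lee_fin ltW.
apply: (@le_trans _ _ (\int[mu]_h (K * (\1_(eball 0 (2 * r)) h)%:E))%E); last first.
  rewrite ge0_integralZl//; last exact: mi.
  by rewrite (integral_indic mu measurableT)// setIT muleC.
apply: ge0_le_integral => //.
- by move=> h _; rewrite mule_ge0// lee_fin ltW.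
- by apply: emeasurable_funM => //; exact: measurable_cst.
- by apply: emeasurable_funM; [exact: measurable_cst|exact: mi].
move=> h _; have [hB|hB] := pselect (eball 0 (2 * r) h).
  rewrite indicE mem_set// mule1 mE'; apply: crossing_measure => // i.
  by apply: le_trans (coord_le_enorm h i) _; move: hB; rewrite eball0E => /ltW.
rewrite indicE memNset// mule0 mE' (_ : _ `&` _ = set0) ?measure0 ?mule0//.
apply/seteqP; split => // x [[xE _] [xhE _]]; apply: hB.
move: xE xhE; rewrite /E !eball0E /= => xE xhE.
rewrite -(addrK x h) (addrC h) (le_lt_trans (enormD _ _))// enormN.
by rewrite mulrDl mul1r ltrD.
Qed.

End crossing.

(** * Energy estimates at a level *)

Section de_giorgi_levels.
Context {R : realType} {d : nat}.
Local Notation mu := (@lebesgue_row R d).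

Variables (C : R) (S u : 'rV[R]_d -> R).
Hypothesis C1 : 1 <= C.
Hypothesis uDG : DG_minus C (eball 0 4) S u.
Hypothesis S1 : {ae mu, forall x, eball 0 4 x -> `|S x| <= 1}.
Hypothesis u0 : {ae mu, forall x, eball 0 4 x -> 0 <= u x}.

Let B : set 'rV[R]_d := eball 0 4.

Definition sublevel (r k : R) : set 'rV[R]_d := eball 0 r `&` [set x | u x < k].

Definition truncation (k : R) : 'rV[R]_d -> R := ((fun x => u x - k)^\-)%R \_ B.

Local Notation W := truncation.

Let mu_ : measurable_fun B u. Proof. by have [_ [G [[]]]] := uDG. Qed.

Let subB r : r <= 4 -> eball 0 r `<=` B. Proof. exact: eball0S. Qed.

Let WE k x : B x -> W k x = Num.max (k - u x) 0.
Proof. by move=> Bx; rewrite /truncation /patch mem_set// /funrneg opprB. Qed.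

Lemma truncation_ge0 k x : 0 <= W k x.
Proof.
have [Bx|nB] := pselect (B x); first by rewrite WE// le_max lexx orbT.
by rewrite /truncation /patch memNset.
Qed.

Lemma measurable_truncation k : measurable_fun setT (W k).
Proof.
apply/(measurable_restrictT _ (measurable_eball0 4)).
by apply: measurable_funrneg; apply: measurable_funB => //; exact: measurable_cst.
Qed.

Lemma measurable_sublevel r k : r <= 4 -> measurable (sublevel r k).
Proof.
move=> r4; rewrite /sublevel.
have -> : eball 0 r `&` [set x | u x < k] = eball 0 r `&` (B `&` u @^-1` `]-oo, k[%classic).
  apply/seteqP; split => x /= [xr xk]; move: (subB r4 xr) => xB; rewrite !in_itv/= in xk *.
    by split.
  by case: xk.
apply: measurableI; first exact: measurable_eball0.
by apply: mu_; [exact: measurable_eball0|exact: measurable_itv].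
Qed.

Lemma sublevel_fin_num r k : r <= 4 -> mu (sublevel r k) \is a fin_num.
Proof.
move=> r4; rewrite ge0_fin_numE//; apply: le_lt_trans (eball0_lty r).
apply: le_measure; rewrite ?inE; [exact: measurable_sublevel|exact: measurable_eball0|].
exact: subIsetl.
Qed.

Lemma truncation_le k : 0 <= k ->
  {ae mu, forall x, B x -> W k x <= k * \1_(sublevel 4 k) x}.
Proof.
move=> k0; apply: filterS u0 => x ux Bx; rewrite WE// indicE.
have [xk|xk] := ltP (u x) k.
  by rewrite mem_set ?mulr1//; rewrite ge_max k0 andbT gerBl; exact: ux.
by rewrite max_r ?subr_le0// mulr_ge0.
Qed.

(** Both terms on the right-hand side of the defining inequality are at most k^2
    times the measure of a sublevel set: 0 <= u bounds the truncation by k, and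
    |S| <= 1 <= k makes the source term comparable to the main one. *)
Lemma level_energy G (k r rho : R) : weak_gradient B u G ->
  1 <= k -> 0 < r < rho -> rho <= 4 ->
  (\int[mu]_(x in eball 0 r) (\sum_(i < d) truncated_gradient k u G i x ^+ 2)%:E <=
   ((C / (rho - r) ^+ 2 + C) * k ^+ 2)%:E * mu (sublevel rho k))%E.
Proof.
move=> uG k1 /[dup] rrho /andP[r0 rho_r] rho4.
have k0 : 0 <= k by exact: le_trans k1.
have C0 : 0 <= C by exact: le_trans C1.
have [[mS _] _ dg] := uDG.
have := dg 0 rho k r (lt_trans r0 rho_r) (subB rho4) rrho _
  (weak_gradient_truncation k uG).
move/le_trans; apply.
have mE : measurable (eball (0 : 'rV[R]_d) rho) by exact: measurable_eball0.
have ms := measurable_sublevel k rho4.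
have bound (f : 'rV[R]_d -> R) : measurable_fun (eball 0 rho) f ->
    {ae mu, forall x, eball 0 rho x -> 0 <= f x <= k ^+ 2 * \1_(sublevel rho k) x} ->
    (forall x, 0 <= f x) ->
    (\int[mu]_(x in eball 0 rho) (f x)%:E <= (k ^+ 2)%:E * mu (sublevel rho k))%E.
  move=> mf fle f0.
  have mi : measurable_fun (eball (0 : 'rV[R]_d) rho) (fun x => (\1_(sublevel rho k) x)%:E : \bar R).
    by apply/measurable_EFinP; apply: measurable_funTS; exact: measurable_indic.
  apply: (@le_trans _ _ (\int[mu]_(x in eball 0 rho)
      ((k ^+ 2)%:E * (\1_(sublevel rho k) x)%:E))%E).
    apply: ae_ge0_le_integral => //.
    - by move=> x _; rewrite lee_fin.
    - exact/measurable_EFinP.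
    - by move=> x _; rewrite -EFinM lee_fin mulr_ge0// sqr_ge0.
    - by apply: emeasurable_funM => //; exact: measurable_cst.
    - by apply: filterS fle => x fx /fx /andP[_]; rewrite -EFinM lee_fin.
  rewrite ge0_integralZl//; last by rewrite lee_fin sqr_ge0.
  rewrite (integral_indic mu)// lee_wpmul2l ?lee_fin ?sqr_ge0//.
  by apply: le_measure; rewrite ?inE//; exact: measurableI.
have indS x : eball 0 rho x -> \1_(sublevel 4 k) x = \1_(sublevel rho k) x :> R.
  move=> xr; rewrite !indicE; congr (nat_of_bool _)%:R; apply/idP/idP => /set_mem[xa xb].
    by apply/mem_set.
  by apply/mem_set; split => //; exact: (subB rho4).
have wW x : eball 0 rho x -> ((fun x => u x - k)^\- x)%R = W k x.
  by move=> xr; rewrite /truncation /patch mem_set//; exact: (subB rho4).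
have mW : measurable_fun (eball 0 rho) (fun x => ((fun x => u x - k)^\- x)%R).
  apply: (@eq_measurable_fun _ _ _ _ _ (W k)); first by move=> x /set_mem /wW.
  by apply: measurable_funTS; exact: measurable_truncation.
have w0 x : 0 <= ((fun x => u x - k)^\- x)%R by rewrite /funrneg le_max lexx orbT.
have mSr : measurable_fun (eball 0 rho) S.
  by apply: measurable_funS mS; [exact: measurable_eball0|exact: subB].
rewrite mulrDl EFinD ge0_muleDl ?lee_fin ?mulr_ge0 ?invr_ge0 ?sqr_ge0//.
rewrite (EFinM (C / (rho - r) ^+ 2) (k ^+ 2)) (EFinM C (k ^+ 2)) -!muleA; apply: leeD.
- apply: lee_wpmul2l; first by rewrite lee_fin divr_ge0// sqr_ge0.
  apply: bound.
  + exact: measurable_funX.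
  + apply: filterS (truncation_le k0) => x Wx xr; rewrite sqr_ge0/= wW//.
    have := Wx (subB rho4 xr); rewrite indS// => {}Wx.
    rewrite (le_trans (y := (k * \1_(sublevel rho k) x) ^+ 2))//.
      by rewrite ler_pXn2r ?nnegrE ?truncation_ge0 ?mulr_ge0.
    rewrite exprMn ler_wpM2l ?sqr_ge0// indicE.
    by case: (x \in _); rewrite ?expr1n ?expr0n.
  + by move=> x; exact: sqr_ge0.
- apply: lee_wpmul2l; first by rewrite lee_fin.
  apply: bound.
  + by apply: measurable_funM => //; exact: measurableT_comp.
  + have := truncation_le k0; move/(filterI S1); apply: filterS => x [Sx Wx] xr.
    rewrite mulr_ge0//= wW//.
    have := Wx (subB rho4 xr); rewrite indS// => {}Wx; have {}Sx := Sx (subB rho4 xr).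
    apply: (@le_trans _ _ (1 * W k x)); first by rewrite ler_wpM2r// truncation_ge0.
    rewrite mul1r (le_trans Wx)// ler_wpM2r//.
    by rewrite expr2 ler_peMl.
  + by move=> x; rewrite mulr_ge0.
Qed.

Lemma level_increment (k r r' rho eta : R) (h : 'rV[R]_d) :
  1 <= k -> 0 < r' -> 0 <= eta -> (forall i, `|h ord0 i| <= eta) ->
  r + d.+2%:R * eta <= r' -> r' < rho -> rho <= 4 ->
  (\int[mu]_(x in eball 0 r) ((W k (x + h) - W k x) ^+ 2)%:E <=
   (d%:R * eta ^+ 2 * ((C / (rho - r') ^+ 2 + C) * k ^+ 2))%:E * mu (sublevel rho k))%E.
Proof.
move=> k1 r'0 eta0 heta rr' r'rho rho4.
have [_ [G uG] _] := uDG.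
have := translation_estimate (weak_gradient_truncation k uG) heta eta0 rr' (ltW (lt_le_trans r'rho rho4)).
move/le_trans; apply; rewrite [X in (_ <= X * _)%E]EFinM -muleA lee_wpmul2l//.
  by rewrite lee_fin mulr_ge0// sqr_ge0.
by apply: level_energy => //; rewrite r'0.
Qed.

End de_giorgi_levels.

(** * Decay of the sublevel sets through dyadic levels *)

Section level_decay.
Context {R : realType} {d : nat}.
Local Notation mu := (@lebesgue_row R d).

Variables (C : R) (S u : 'rV[R]_d -> R).
Hypothesis C1 : 1 <= C.
Hypothesis uDG : DG_minus C (eball 0 4) S u.
Hypothesis S1 : {ae mu, forall x, eball 0 4 x -> `|S x| <= 1}.
Hypothesis u0 : {ae mu, forall x, eball 0 4 x -> 0 <= u x}.

Local Notation W := (truncation u).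

Let beta : R := fine (mu (eball (0 : 'rV[R]_d) 4)).

Let betaE : mu (eball 0 4) = beta%:E.
Proof. by rewrite fineK// ge0_fin_numE// eball0_lty. Qed.

Let beta0 : 0 <= beta. Proof. exact: fine_ge0. Qed.

Definition sublevel_measure (r k : R) : R := fine (mu (sublevel u r k)).

Local Notation g := sublevel_measure.

Lemma sublevel_measureE r k : r <= 4 -> mu (sublevel u r k) = (g r k)%:E.
Proof. by move=> r4; rewrite /g fineK//; exact: sublevel_fin_num uDG _ _ r4. Qed.

Lemma sublevel_measure_ge0 r k : 0 <= g r k. Proof. exact: fine_ge0. Qed.

Lemma sublevel_measure_le r r' k k' : r <= r' -> r' <= 4 -> k <= k' -> g r k <= g r' k'.
Proof.
move=> rr' r'4 kk'; rewrite -lee_fin -!sublevel_measureE//; last exact: le_trans r'4.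
apply: le_measure; rewrite ?inE; try exact: (measurable_sublevel uDG).
  by apply: (measurable_sublevel uDG); exact: le_trans r'4.
by move=> x [xr xk]; split; [exact: eball0S xr|exact: lt_le_trans kk'].
Qed.

Let two4 : (2 : R) <= 4. Proof. by rewrite ler_nat. Qed.

Lemma measurable_superlevel r k : r <= 4 ->
  measurable (eball 0 r `&` [set x | k <= u x]).
Proof.
move=> r4; have -> : eball 0 r `&` [set x | k <= u x] = eball 0 r `\` sublevel u r k.
  apply/seteqP; split => x [x2 /= xk]; split => //.
    by move=> [_ /=]; rewrite ltNge xk.
  by rewrite leNgt; apply/negP => xk'; apply: xk.
by apply: measurableD; [exact: measurable_eball0|exact: (measurable_sublevel uDG)].
Qed.

(** [isoperimetric] for the truncation at level k, cut at height k / 2.  The parameter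
    t = tau / k makes the inequality homogeneous in k. *)
Lemma level_step (k tau zeta : R) : 1 <= k -> 0 < tau -> 0 <= zeta ->
  (zeta%:E <= mu (eball 0 2 `&` [set x | (k <= u x)%R]))%E ->
  2^-1 * (zeta * g 2 (k / 2)) <=
  beta * (32 * tau * d%:R * C * beta + (g 2 k - g 2 (k / 2)) / tau).
Proof.
move=> k1 tau0 zeta0 hzeta.
have k0 : 0 < k by exact: lt_le_trans k1.
have C0 : 0 <= C by exact: le_trans C1.
pose v (x : 'rV[R]_d) := Num.min (W k x) (k / 2).
have mW := measurable_truncation uDG k.
have mv : measurable_fun setT v.
  by apply: measurable_minr => //; exact: measurable_cst.
have l0 : 0 < k / 2 by rewrite divr_gt0.
pose D := d%:R * (2 * C) * k ^+ 2 * beta.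
have D0 : 0 <= D.
  by rewrite /D mulr_ge0// mulr_ge0 ?sqr_ge0// mulr_ge0// mulr_ge0.
have e0 : 0 < d.+2%:R^-1 :> R by rewrite invr_gt0 ltr0n.
have vl x : 0 <= v x <= k / 2.
  by rewrite /v ge_min lexx orbT le_min truncation_ge0 ltW.
have osc (h : 'rV[R]_d) eta : 0 <= eta <= d.+2%:R^-1 -> (forall i, `|h ord0 i| <= eta) ->
    (\int[mu]_(x in eball 0 2) ((v (x + h) - v x) ^+ 2)%:E <= (D * eta ^+ 2)%:E)%E.
  move=> /andP[eta0 etae] heta.
  have mh : measurable_fun setT (fun x : 'rV[R]_d => x + h) by exact: measurable_row_shift.
  have mdiff (f : 'rV[R]_d -> R) : measurable_fun setT f ->
      measurable_fun (eball 0 2) (fun x : 'rV[R]_d => ((f (x + h) - f x) ^+ 2)%:E).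
    move=> mf; apply/measurable_EFinP; apply: measurable_funTS; apply: measurable_funX.
    by apply: measurable_funB => //; exact: (measurableT_comp mf mh).
  apply: (@le_trans _ _ (\int[mu]_(x in eball 0 2) ((W k (x + h) - W k x) ^+ 2)%:E)%E).
    apply: ge0_le_integral => //; [exact: measurable_eball0|..].
    - by move=> x _; rewrite lee_fin sqr_ge0.
    - exact: mdiff.
    - exact: mdiff.
    - move=> x _; rewrite lee_fin -(real_normK (num_real (v _ - v _))).
      rewrite -(real_normK (num_real (W k _ - _))) ler_pXn2r ?nnegrE//.
      rewrite ler_norml /v; have := ler_norm (W k (x + h) - W k x).
      have := ler_norm (W k x - W k (x + h)); rewrite distrC.
      by case: (leP (W k (x + h))); case: (leP (W k x)); lra.
  (* increments on the ball of radius 2, gradient on 3, sublevel set in 4 *)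
  have dh : 2 + d.+2%:R * eta <= 3.
    have : d.+2%:R * eta <= 1 by rewrite mulrC -ler_pdivlMr ?ltr0n// div1r.
    lra.
  have three0 : 0 < 3 :> R by rewrite ltr0n.
  have := level_increment C1 uDG S1 u0 k1 three0 eta0 heta dh _ (lexx 4).
  rewrite ltr_nat => /(_ isT)/le_trans; apply.
  apply: (@le_trans _ _ ((d%:R * eta ^+ 2 * ((C / (4 - 3) ^+ 2 + C) * k ^+ 2))%:E * beta%:E)%E).
    apply: lee_wpmul2l.
      rewrite lee_fin mulr_ge0 ?(mulr_ge0 _ (sqr_ge0 _))//.
      by rewrite addr_ge0// divr_ge0 ?sqr_ge0.
    rewrite -betaE; apply: le_measure; rewrite ?inE; last exact: subIsetl.
      exact: (measurable_sublevel uDG).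
    exact: measurable_eball0.
  rewrite -EFinM lee_fin (_ : 4 - 3 = 1); last by ring.
  by rewrite expr1n divr1 /D le_eqVlt; apply/orP; left; apply/eqP; ring.
have t0 : 0 < tau / k by rewrite divr_gt0.
have := isoperimetric mv l0 D0 (ltr0n R 2) e0 vl osc t0.
set Z := _ `&` [set x | v x = 0]; set T := _ `&` [set x | v x = _].
set A := _ `&` [set x | _ < v x < _] => iso.
have mE : measurable (eball (0 : 'rV[R]_d) 2) by exact: measurable_eball0.
have mlev (P : set R) : measurable P -> measurable (eball 0 2 `&` v @^-1` P).
  by move=> mP; apply: measurableI => //; rewrite -[X in measurable X]setTI; exact: mv.
have mA : measurable A.
  have -> : A = eball 0 2 `&` v @^-1` `]0, (k / 2)[%classic; last exact: (mlev _ (measurable_itv _)).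
  by rewrite /A; congr (_ `&` _); apply/seteqP; split => x; rewrite /= in_itv.
have WE x : eball 0 2 x -> W k x = Num.max (k - u x) 0.
  move=> x2; rewrite /truncation /patch mem_set ?/funrneg ?opprB//.
  exact: eball0S x2.
have ZE : (zeta%:E <= mu Z)%E.
  apply: le_trans hzeta _; apply: le_measure; rewrite ?inE.
  - exact: measurable_superlevel.
  - exact: (mlev _ (measurable_set1 0)).
  - move=> x [x2 /= xk]; split => //=; rewrite /v WE// max_r ?subr_le0//.
    by rewrite min_l// ltW.
have TE : ((g 2 (k / 2))%:E <= mu T)%E.
  rewrite -sublevel_measureE//; apply: le_measure; rewrite ?inE.
  - exact: (measurable_sublevel uDG).
  - exact: (mlev _ (measurable_set1 _)).
  - move=> x [x2 /= xk]; split => //=; rewrite /v WE// max_l; last by lra.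
    by rewrite min_r//; lra.
have AE : (mu A <= (g 2 k - g 2 (k / 2))%:E)%E.
  apply: (@le_trans _ _ (mu (sublevel u 2 k `\` sublevel u 2 (k / 2)))).
    apply: le_measure; rewrite ?inE//.
      by apply: measurableD; exact: (measurable_sublevel uDG).
    move=> x [x2 /=]; rewrite /v WE// => /andP[].
    rewrite lt_min l0 andbT lt_max ltxx orbF subr_gt0 => uk.
    rewrite gt_min ltxx orbF gt_max l0 andbT => uk2; split => //.
    by move=> [_ /=]; lra.
  rewrite measureD; try exact: (measurable_sublevel uDG).
    rewrite setIidr; last first.
      by move=> x [x2 /= xk]; split => //=; lra.
    by rewrite EFinB -!sublevel_measureE.
  by apply: le_lt_trans (ltry (g 2 k)); rewrite -sublevel_measureE.
have fin : k / 2 * (zeta * g 2 (k / 2)) <=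
    beta * (4 * (tau / k) * D * 2 ^+ 2 + (tau / k)^-1 * (g 2 k - g 2 (k / 2))).
  rewrite -lee_fin (EFinM (k / 2)) (EFinM zeta) (EFinM beta) EFinD (EFinM (tau / k)^-1).
  apply: (@le_trans _ _ ((k / 2)%:E * (mu Z * mu T))%E).
    rewrite lee_wpmul2l ?lee_fin ?(ltW l0)//; apply: lee_pmul => //.
    by rewrite lee_fin sublevel_measure_ge0.
  apply: (le_trans iso); rewrite (_ : 2 * 2 = 4) -?betaE; last by ring.
  rewrite lee_wpmul2l// leeD2l// lee_wpmul2l// lee_fin invr_ge0 ltW//.
rewrite -(ler_pM2l k0); apply: (le_trans _ (le_trans fin _)).
  by rewrite le_eqVlt; apply/orP; left; apply/eqP; field.
rewrite le_eqVlt; apply/orP; left; apply/eqP; rewrite /D; field.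
by rewrite !gt_eqF.
Qed.

(** The sets {k / 2 < u < k} of the successive levels are disjoint, so that the last
    terms of [level_step] telescope while the left-hand sides stay bounded below. *)
Lemma level_sum (J : nat) (M tau zeta : R) : 1 <= M / 2 ^+ J -> 0 < tau -> 0 <= zeta ->
  (zeta%:E <= mu (eball 0 2 `&` [set x | (M <= u x)%R]))%E ->
  J%:R * (2^-1 * (zeta * g 2 (M / 2 ^+ J))) <=
  beta * (J%:R * (32 * tau * d%:R * C * beta) + beta / tau).
Proof.
move=> MJ tau0 zeta0 hzeta.
have pow2 n : 0 < 2 ^+ n :> R by rewrite exprn_gt0.
have M0 : 0 < M by have := lt_le_trans ltr01 MJ; rewrite pmulr_lgt0 ?invr_gt0.
pose k j := M / 2 ^+ j.
have kdecr i j : (i <= j)%N -> k j <= k i.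
  move=> ij; rewrite /k ler_wpM2l ?(ltW M0)// lef_pV2 ?posrE//.
  by rewrite ler_weXn2l// ler1n.
pose K := 32 * tau * d%:R * C * beta.
have step j : (j < J)%N -> 2^-1 * (zeta * g 2 (k J)) <=
    beta * (K + (g 2 (k j) - g 2 (k j.+1)) / tau).
  move=> jJ; have kE : k j.+1 = k j / 2 by rewrite /k exprS invfM mulrCA mulrC.
  apply: le_trans (_ : 2^-1 * (zeta * g 2 (k j.+1)) <= _).
    by rewrite ler_wpM2l// ler_wpM2l// sublevel_measure_le// kdecr.
  rewrite kE; apply: level_step => //; first by rewrite (le_trans MJ)// kdecr// ltnW.
  apply: le_trans hzeta _; apply: le_measure; rewrite ?inE.
  - exact: measurable_superlevel.
  - exact: measurable_superlevel.
  - by move=> x [x2 /= xM]; split => //=; rewrite (le_trans _ xM)// -[leRHS]divr1; exact: (kdecr 0).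
have : \sum_(0 <= j < J) (2^-1 * (zeta * g 2 (k J))) <=
    \sum_(0 <= j < J) (beta * (K + (g 2 (k j) - g 2 (k j.+1)) / tau)).
  by rewrite !big_nat; apply: ler_sum => j /andP[_ jJ]; exact: step.
rewrite sumr_const_nat subn0 -[leLHS]mulr_natl => /le_trans; apply.
rewrite -mulr_sumr ler_wpM2l// big_split/= sumr_const_nat subn0 -[K *+ J]mulr_natl lerD2l.
rewrite -mulr_suml ler_wpM2r ?invr_ge0 ?(ltW tau0)//.
under eq_bigr do rewrite -opprB.
rewrite sumrN (telescope_sumr (fun j => g 2 (k j)))// opprB.
rewrite lerBlDr (le_trans _ (_ : beta <= _))//; last by rewrite lerDl sublevel_measure_ge0.
rewrite -lee_fin -sublevel_measureE// -betaE; apply: le_measure; rewrite ?inE.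
- exact: (measurable_sublevel uDG).
- exact: measurable_eball0.
- by move=> x [x2 _]; exact: eball0S x2.
Qed.

End level_decay.

(** * From small measure to a pointwise bound *)

Section pointwise_bound.
Context {R : realType} {d : nat}.
Local Notation mu := (@lebesgue_row R d).

Variables (C : R) (S u : 'rV[R]_d -> R).
Hypothesis C1 : 1 <= C.
Hypothesis uDG : DG_minus C (eball 0 4) S u.
Hypothesis S1 : {ae mu, forall x, eball 0 4 x -> `|S x| <= 1}.
Hypothesis u0 : {ae mu, forall x, eball 0 4 x -> 0 <= u x}.

Local Notation W := (truncation u).
Local Notation g := (sublevel_measure u).

Let sublevelE r k : r <= 4 -> mu (sublevel u r k) = (g r k)%:E.
Proof. exact: (sublevel_measureE uDG). Qed.

(** From W(x)^2 = W(x) (W(x) - W(x + h)) + W(x) W(x + h) one gets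
    W(x)^2 <= (W(x + h) - W(x))^2 + 2 W(x) W(x + h).  Averaging over a cube of side
    eta of translations h, the first term is controlled by the energy and the second
    one, by [integral_correlation], by the square of the integral of W; this square
    is what makes the recursion superlinear. *)
Lemma sublevel_measure_step (r r' rho k k' eta : R) :
  1 <= k -> k' <= k -> 0 < r -> 0 < eta -> r + d.+2%:R * eta <= r' ->
  r' < rho -> rho <= 4 ->
  (k - k') ^+ 2 * g r k' <=
  d%:R * eta ^+ 2 * ((C / (rho - r') ^+ 2 + C) * k ^+ 2) * g rho k +
  2 * k ^+ 2 * g rho k ^+ 2 / eta ^+ d.
Proof.
move=> k1 k'k r0 eta0 rr' r'rho rho4.
have k0 : 0 <= k by exact: le_trans k1.
have r'0 : 0 < r'.
  by rewrite (lt_le_trans r0)// (le_trans _ rr')// lerDl mulr_ge0// ltW.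
have r_rho : r <= rho.
  by rewrite (le_trans _ (ltW r'rho))// (le_trans _ rr')// lerDl mulr_ge0// ltW.
have r4 : r <= 4 by exact: le_trans rho4.
have ind0 (A D : set 'rV[R]_d) x : D x -> (0 <= (\1_A x)%:E :> \bar R)%E.
  by move=> _; rewrite lee_fin indicE.
have k0E : (0 <= k%:E :> \bar R)%E by rewrite lee_fin.
have kk0E : (0 <= ((k - k') ^+ 2)%:E :> \bar R)%E by rewrite lee_fin sqr_ge0.
set K := d%:R * _ * _ * _.
have mW := measurable_truncation uDG k.
have W0 x : 0 <= W k x by exact: truncation_ge0.
pose E : set 'rV[R]_d := eball 0 r.
have mE : measurable E by exact: measurable_eball0.
have mErho : measurable (eball (0 : 'rV[R]_d) rho) by exact: measurable_eball0.
pose I := (\int[mu]_(x in E) (W k x ^+ 2)%:E)%E.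
pose f (x : 'rV[R]_d) := (W k x * \1_(eball 0 rho) x)%:E : \bar R.
have f0 x : (0 <= f x)%E by rewrite lee_fin mulr_ge0// indicE.
have mf : measurable_fun setT f.
  by apply/measurable_EFinP; apply: measurable_funM => //; exact: measurable_indic.
pose c (h : 'rV[R]_d) := (\int[mu]_x (f x * f (x + h)%R))%E.
have c0 h : (0 <= c h)%E by apply: integral_ge0 => x _; rewrite mule_ge0.
have mc : measurable_fun setT c by exact: (measurable_correlation mf mf f0 f0).
have intf : (\int[mu]_x f x <= (k * g rho k)%:E)%E.
  rewrite EFinM -sublevelE//.
  have ms := measurable_sublevel uDG k rho4.
  rewrite -[X in (_ <= _ * mu X)%E]setIT -(integral_indic mu measurableT ms).
  have mi : measurable_fun setT (fun x : 'rV[R]_d => (\1_(sublevel u rho k) x)%:E : \bar R).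
    by apply/measurable_EFinP; exact: measurable_indic.
  rewrite -ge0_integralZl//.
  apply: ae_ge0_le_integral => //.
  - by move=> x _; rewrite -EFinM lee_fin mulr_ge0.
  - by apply: emeasurable_funM => //; exact: measurable_cst.
  - apply: filterS (truncation_le u0 k0) => x Wx _; rewrite /f -EFinM lee_fin.
    have [xr|xr] := pselect (eball 0 rho x); last first.
      by rewrite [in leLHS]indicE memNset// mulr0 mulr_ge0// indicE.
    have := Wx (eball0S rho4 xr).
    rewrite [X in _ -> _ * X <= _]indicE mem_set// mulr1 => /le_trans; apply.
    rewrite ler_wpM2l// !indicE; case: (boolP (x \in sublevel u 4 k)) => //.
    by move=> /set_mem[_ xk]; rewrite mem_set.
pose Q : set 'rV[R]_d := halfbox 0 (const_mx eta).
have mQ : measurable Q by exact: measurable_halfbox.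
have key h : Q h -> (I <= K%:E + 2%:E * c h)%E.
  move=> Qh; have heta i : `|h ord0 i| <= eta.
    by have := Qh i; rewrite !mxE => /andP[h0 h1]; rewrite gtr0_norm.
  have shift x : E x -> eball 0 rho (x + h).
    move=> xE; apply: (@eball0S _ _ (r + d%:R * eta)).
      rewrite (le_trans _ (ltW r'rho))// (le_trans _ rr')// lerD2l ler_wpM2r ?(ltW eta0)//.
      by rewrite ler_nat; exact: leq_trans (leqnSn _) (leqnSn _).
    apply: eball0D => //; rewrite (le_trans (enorm_le_sum h))//.
    rewrite (le_trans (ler_sum _ (fun i _ => heta i)))// sumr_const card_ord.
    by rewrite -[leLHS]mulr_natl.
  have mWh : measurable_fun setT (fun x : 'rV[R]_d => W k (x + h)).
    by apply: (measurableT_comp mW); exact: measurable_row_shift.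
  have mD : measurable_fun E (fun x : 'rV[R]_d => ((W k (x + h) - W k x) ^+ 2)%:E).
    apply/measurable_EFinP; apply: measurable_funTS; apply: measurable_funX.
    exact: measurable_funB.
  have mP : measurable_fun E (fun x : 'rV[R]_d => (W k x * W k (x + h))%:E).
    by apply/measurable_EFinP; apply: measurable_funTS; exact: measurable_funM.
  have P0 x : E x -> (0 <= (W k x * W k (x + h))%:E)%E.
    by move=> _; rewrite lee_fin mulr_ge0.
  have m2P : measurable_fun E (fun x : 'rV[R]_d => (2%:E * (W k x * W k (x + h))%:E)%E).
    by apply: emeasurable_funM => //; exact: measurable_cst.
  apply: (@le_trans _ _ (\int[mu]_(x in E) (((W k (x + h) - W k x) ^+ 2)%:E +
      2%:E * (W k x * W k (x + h))%:E))%E).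
    apply: ge0_le_integral => //.
    - by move=> x _; rewrite lee_fin sqr_ge0.
    - by apply/measurable_EFinP; apply: measurable_funTS; exact: measurable_funX.
    - exact: emeasurable_funD.
    - move=> x _; rewrite -EFinM -EFinD lee_fin.
      by have := sqr_ge0 (W k (x + h)); nra.
  rewrite ge0_integralD//; last 2 first.
  - by move=> x _; rewrite lee_fin sqr_ge0.
  - by move=> x Ex; rewrite mule_ge0// P0.
  rewrite ge0_integralZl//; apply: leeD.
    rewrite /K EFinM -sublevelE//.
    exact: (level_increment C1 uDG S1 u0 k1 r'0 (ltW eta0) heta rr' r'rho rho4).
  rewrite lee_wpmul2l//.
  apply: (@le_trans _ _ (\int[mu]_(x in E) (f x * f (x + h)%R))%E).
    rewrite le_eqVlt; apply/orP; left; apply/eqP; apply: eq_integral => x /set_mem Ex.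
    by rewrite /f !indicE !mem_set ?mulr1//; [exact: shift|exact: eball0S Ex].
  apply: ge0_subset_integral => //.
  - apply: emeasurable_funM => //.
    by apply: (measurableT_comp mf); exact: measurable_row_shift.
  - by move=> x _; rewrite mule_ge0.
have I0 : (0 <= I)%E by apply: integral_ge0 => x _; rewrite lee_fin sqr_ge0.
have K0 : 0 <= K.
  have C0 : 0 <= C by exact: le_trans C1.
  rewrite /K mulr_ge0 ?fine_ge0// mulr_ge0 ?(mulr_ge0 _ (sqr_ge0 _))//.
  by rewrite addr_ge0// divr_ge0 ?sqr_ge0.
have mQi : measurable_fun setT (fun h : 'rV[R]_d => (\1_Q h)%:E : \bar R).
  by apply/measurable_EFinP; exact: measurable_indic.
have Qi0 h : (0 <= (\1_Q h)%:E :> \bar R)%E by rewrite lee_fin indicE.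
have intQ : (\int[mu]_h (\1_Q h)%:E = (eta ^+ d)%:E :> \bar R)%E.
  by rewrite (integral_indic mu measurableT mQ) setIT; apply: lebesgue_cube; exact: ltW.
have avg : (I * (eta ^+ d)%:E <= K%:E * (eta ^+ d)%:E + 2%:E * (\int[mu]_x f x * \int[mu]_x f x))%E.
  rewrite -intQ -(integral_correlation mf mf f0 f0) -/c.
  have K0' : (0 <= K%:E :> \bar R)%E by rewrite lee_fin.
  have m1 : measurable_fun setT (fun h : 'rV[R]_d => K%:E * (\1_Q h)%:E)%E.
    by apply: emeasurable_funM => //; exact: measurable_cst.
  have m2 : measurable_fun setT (fun h : 'rV[R]_d => 2%:E * c h)%E.
    by apply: emeasurable_funM => //; exact: measurable_cst.
  have p1 h : [set: 'rV[R]_d] h -> (0 <= K%:E * (\1_Q h)%:E)%E by rewrite mule_ge0.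
  have p2 h : [set: 'rV[R]_d] h -> (0 <= 2%:E * c h)%E by rewrite mule_ge0.
  rewrite -(ge0_integralZl mu measurableT mQi (fun h _ => Qi0 h) I0).
  rewrite -(ge0_integralZl mu measurableT mQi (fun h _ => Qi0 h) K0').
  rewrite -(ge0_integralZl mu measurableT mc (fun h _ => c0 h))//.
  rewrite -ge0_integralD//.
  apply: ge0_le_integral => //.
  - by move=> h _; rewrite mule_ge0.
  - by apply: emeasurable_funM => //; exact: measurable_cst.
  - exact: emeasurable_funD.
  move=> h _; have [Qh|Qh] := pselect (Q h).
    by rewrite indicE mem_set// !mule1; exact: key.
  by rewrite indicE memNset// !mule0 add0e mule_ge0.
have level : (((k - k') ^+ 2 * g r k')%:E <= I)%E.
  have ms := measurable_sublevel uDG k' r4.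
  have sE : sublevel u r k' `&` E = sublevel u r k' by apply: setIidl; exact: subIsetl.
  rewrite EFinM -sublevelE// -[X in (_ * mu X)%E]sE -(integral_indic mu mE ms).
  have mi : measurable_fun E (fun x : 'rV[R]_d => (\1_(sublevel u r k') x)%:E : \bar R).
    by apply/measurable_EFinP; apply: measurable_funTS; exact: measurable_indic.
  rewrite -ge0_integralZl//.
  apply: ge0_le_integral => //.
  - by move=> x _; rewrite -EFinM lee_fin mulr_ge0// sqr_ge0.
  - by apply: emeasurable_funM => //; exact: measurable_cst.
  - by apply/measurable_EFinP; apply: measurable_funTS; exact: measurable_funX.
  - move=> x Ex; rewrite -EFinM lee_fin indicE.
    case: (boolP (x \in sublevel u r k')) => [/set_mem[_ /= xk']|_]; last first.
      by rewrite mulr0 sqr_ge0.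
    rewrite mulr1 ler_pXn2r ?nnegrE// ?subr_ge0//.
    rewrite /truncation /patch mem_set; last by exact: eball0S Ex.
    by rewrite /funrneg opprB le_max lerD2l lerN2 ltW.
have etad : 0 < eta ^+ d by rewrite exprn_gt0.
rewrite -(ler_pM2r etad) mulrDl divfK ?gt_eqF// -lee_fin.
apply: le_trans (_ : I * (eta ^+ d)%:E <= _)%E.
  by rewrite EFinM lee_wpmul2r// lee_fin ltW.
apply: (le_trans avg); rewrite [leRHS]EFinD (EFinM K) leeD2l// -mulrA (EFinM 2).
rewrite lee_wpmul2l//.
apply: (@le_trans _ _ ((k * g rho k)%:E * (k * g rho k)%:E)%E).
  by apply: lee_pmul => //; apply: integral_ge0.
by rewrite -EFinM lee_fin -expr2 exprMn.
Qed.

End pointwise_bound.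

Section iteration_constants.
Context {R : realType}.
Variables (d : nat) (C : R).
Hypothesis C1 : 1 <= C.

(** The ratio is q = 4^-(d+1): at the n-th step the side of the cube is proportional
    to 4^-n, the radii and the levels change by multiples of 2^-n, and the quadratic
    term is multiplied by 4^(n(d+1)). *)
Definition decay_ratio : R := 2^-1 ^+ (2 * d.+1).

(** The cube of the n-th step has side shift_scale * 4^-n; this value makes the linear
    term of the recursion contribute at most q / 2. *)
Definition shift_scale : R := decay_ratio / (640 * d.+2%:R * C).

(** This value makes the quadratic term of the recursion contribute at most q / 2. *)
Definition small_measure : R := decay_ratio * shift_scale ^+ d / 64.

Let C0 : 0 < C. Proof. exact: lt_le_trans C1. Qed.

Lemma decay_ratio_itv : 0 < decay_ratio < 1.
Proof.
have h2 : 2^-1 < 1 :> R by lra.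
by rewrite /decay_ratio exprn_gt0//= exprn_ilt1.
Qed.

Let den : 0 < 640 * d.+2%:R * C. Proof. by apply: mulr_gt0 C0; apply: mulr_gt0; rewrite ltr0n. Qed.

Lemma shift_scale_gt0 : 0 < shift_scale.
Proof. by have /andP[q0 _] := decay_ratio_itv; exact: (divr_gt0 q0 den). Qed.

Lemma small_measure_gt0 : 0 < small_measure.
Proof.
have /andP[q0 _] := decay_ratio_itv.
by rewrite divr_gt0// mulr_gt0// exprn_gt0// shift_scale_gt0.
Qed.

Let dC : d.+2%:R * C * shift_scale = decay_ratio / 640.
Proof.
rewrite /shift_scale; field.
by rewrite (gt_eqF C0) -natr1 -natr1 gt_eqF// ltr_wpDl.
Qed.

Lemma shift_scale_le : d.+2%:R * shift_scale <= 4^-1.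
Proof.
have /andP[q0 q1] := decay_ratio_itv; have s0 := shift_scale_gt0.
apply: (@le_trans _ _ (d.+2%:R * C * shift_scale)).
  by rewrite ler_wpM2r ?(ltW s0)// ler_peMr.
rewrite dC; lra.
Qed.

Lemma shift_scale_sqr_le : 272 * d%:R * C * shift_scale ^+ 2 <= decay_ratio / 2.
Proof.
have /andP[q0 q1] := decay_ratio_itv; have s0 := shift_scale_gt0.
have s1 : shift_scale <= 1.
  have h : 1 * shift_scale <= d.+2%:R * shift_scale by rewrite ler_wpM2r ?(ltW s0)// ler1n.
  have := shift_scale_le; lra.
apply: (@le_trans _ _ (272 * (d.+2%:R * C * shift_scale))); last by rewrite dC; lra.
rewrite (_ : 272 * _ * _ * _ = 272 * (d%:R * C * shift_scale * shift_scale)); last by ring.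
rewrite ler_wpM2l// (le_trans (y := d%:R * C * shift_scale))//.
  rewrite ler_piMr// mulr_ge0 ?(ltW s0)// mulr_ge0// ltW//.
rewrite ler_wpM2r ?(ltW s0)// ler_wpM2r ?(ltW C0)// ler_nat.
exact: leq_trans (leqnSn _) (leqnSn _).
Qed.

(** With y = 2^-n, the bound small_measure * q^n is preserved up to a factor q: the
    linear term and the quadratic term each contribute half of it. *)
Lemma iteration_step (y a a' k : R) : 0 < y <= 1 -> 0 <= k <= 4 ->
  0 <= a <= small_measure * y ^+ (2 * d.+1) ->
  y ^+ 2 * a' <=
    d%:R * (shift_scale * y ^+ 2) ^+ 2 * ((C / (y / 4) ^+ 2 + C) * k ^+ 2) * a +
    2 * k ^+ 2 * a ^+ 2 / (shift_scale * y ^+ 2) ^+ d ->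
  a' <= small_measure * y ^+ (2 * d.+1) * decay_ratio.
Proof.
move=> /andP[y0 y1] /andP[k0 k4] /andP[a0 ale] step.
have /andP[q0 q1] := decay_ratio_itv; have s0 := shift_scale_gt0.
have y20 : 0 < y ^+ 2 by rewrite exprn_gt0.
have k2 : k ^+ 2 <= 16.
  by rewrite (_ : 16 = 4 ^+ 2) ?ler_pXn2r ?nnegrE//; ring.
set s := shift_scale in step *; set q := decay_ratio in q0 q1 *.
have sd0 : 0 < s ^+ d by rewrite exprn_gt0.
pose P := (y ^+ 2) ^+ d; have P0 : 0 < P by rewrite exprn_gt0.
have yE : y ^+ (2 * d.+1) = y ^+ 2 * P by rewrite /P -exprM -exprD mulnS.
have y2n : y ^+ 2 != 0 by rewrite gt_eqF.
have yn : y != 0 by rewrite gt_eqF.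
have X0 : 0 <= C / (y / 4) ^+ 2 + C.
  by rewrite addr_ge0 ?(ltW C0)//; exact: divr_ge0 (ltW C0) (sqr_ge0 _).
have X1 : C / (y / 4) ^+ 2 + C <= 17 * (C / y ^+ 2).
  have -> : C / (y / 4) ^+ 2 = 16 * (C / y ^+ 2) by field.
  have : C <= C / y ^+ 2.
    by rewrite ler_pdivlMr// ler_piMr ?(ltW C0)// expr_le1// ltW.
  lra.
have T1 : d%:R * (s * y ^+ 2) ^+ 2 * ((C / (y / 4) ^+ 2 + C) * k ^+ 2) * a <=
    q / 2 * y ^+ 2 * a.
  apply: ler_wpM2r a0 _ _ _.
  have h := ler_pM X0 (sqr_ge0 k) X1 k2.
  have h' := ler_wpM2l (mulr_ge0 (ler0n R d) (sqr_ge0 (s * y ^+ 2))) h.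
  apply: (le_trans h').
  have -> : d%:R * (s * y ^+ 2) ^+ 2 * (17 * (C / y ^+ 2) * 16) =
      272 * d%:R * C * s ^+ 2 * y ^+ 2 by field.
  exact: (ler_wpM2r (ltW y20) (shift_scale_sqr_le)).
have T2 : 2 * k ^+ 2 * a ^+ 2 / (s * y ^+ 2) ^+ d <= q / 2 * y ^+ 2 * a.
  have sP0 : 0 < s ^+ d * P := mulr_gt0 sd0 P0.
  rewrite exprMn -/P (ler_pdivrMr _ _ sP0).
  have aE : small_measure * y ^+ (2 * d.+1) = (q * y ^+ 2 / 64) * (s ^+ d * P).
    by rewrite yE /small_measure -/q -/s; ring.
  rewrite aE in ale; set t := s ^+ d * P in sP0 ale *.
  have -> : 2 * k ^+ 2 * a ^+ 2 = (2 * a) * (a * k ^+ 2) by ring.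
  have -> : q / 2 * y ^+ 2 * a * t = (2 * a) * (q * y ^+ 2 / 64 * t * 16) by field.
  exact: (ler_wpM2l (mulr_ge0 (ler0n R 2) a0) (ler_pM a0 (sqr_ge0 k) ale k2)).
have fin : y ^+ 2 * a' <= y ^+ 2 * (a * q).
  apply: (le_trans step); apply: (le_trans (lerD T1 T2)).
  by rewrite le_eqVlt; apply/orP; left; apply/eqP; field.
rewrite ler_pM2l// in fin; apply: (le_trans fin).
by rewrite ler_wpM2r// ltW.
Qed.

End iteration_constants.

Section pointwise_bound_iteration.
Context {R : realType} {d : nat}.
Local Notation mu := (@lebesgue_row R d).

Variables (C : R) (S u : 'rV[R]_d -> R).
Hypothesis C1 : 1 <= C.
Hypothesis uDG : DG_minus C (eball 0 4) S u.
Hypothesis S1 : {ae mu, forall x, eball 0 4 x -> `|S x| <= 1}.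
Hypothesis u0 : {ae mu, forall x, eball 0 4 x -> 0 <= u x}.

Local Notation g := (sublevel_measure u).

Lemma de_giorgi_iteration (n : nat) : g 2 4 <= small_measure d C ->
  g (1 + 2^-1 ^+ n) (2 * (1 + 2^-1 ^+ n)) <= small_measure d C * decay_ratio d ^+ n.
Proof.
move=> small; elim: n => [|n IH].
  have -> : g (1 + 2^-1 ^+ 0) (2 * (1 + 2^-1 ^+ 0)) = g 2 4.
    by congr (g _ _); rewrite expr0; ring.
  by rewrite expr0 mulr1.
set y := 2^-1 ^+ n in IH *.
have y0 : 0 < y by rewrite exprn_gt0.
have y1 : y <= 1 by rewrite exprn_ile1 ?invr_ge0// invf_le1// ler1n.
have qE m : decay_ratio d ^+ m = (2^-1 ^+ m) ^+ (2 * d.+1) :> R.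
  by rewrite /decay_ratio -!exprM mulnC.
have s0 := @shift_scale_gt0 R d C C1.
have eta0 : 0 < shift_scale d C * y ^+ 2 by rewrite mulr_gt0// exprn_gt0.
have y2y : y ^+ 2 <= y by rewrite expr2 ler_piMl// ltW.
have dist : 1 + y / 2 + d.+2%:R * (shift_scale d C * y ^+ 2) <= 1 + 3 / 4 * y.
  have : d.+2%:R * shift_scale d C * y ^+ 2 <= 4^-1 * y.
    exact: (ler_pM (mulr_ge0 (ler0n R _) (ltW s0)) (sqr_ge0 y) (@shift_scale_le R d C C1) y2y).
  rewrite -mulrA; lra.
have -> : 2^-1 ^+ n.+1 = y / 2 :> R by rewrite exprSr.
have k1 : 1 <= 2 * (1 + y) by lra.
have kk : 2 * (1 + y / 2) <= 2 * (1 + y) by lra.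
have r0 : 0 < 1 + y / 2 by lra.
have rr : 1 + 3 / 4 * y < 1 + y by lra.
have r4 : 1 + y <= 4 by lra.
have step := sublevel_measure_step C1 uDG S1 u0 k1 kk r0 eta0 dist rr r4.
rewrite exprSr mulrA qE -/y.
apply: (@iteration_step R d C C1 y (g (1 + y) (2 * (1 + y))) _ (2 * (1 + y))).
- by rewrite y0.
- lra.
- by rewrite sublevel_measure_ge0 -qE.
- move: step; rewrite (_ : 2 * (1 + y) - 2 * (1 + y / 2) = y); last by field.
  by rewrite (_ : 1 + y - (1 + 3 / 4 * y) = y / 4); last by field.
Qed.

Lemma ge2_of_small_sublevel : g 2 4 <= small_measure d C ->
  {ae mu, forall x, eball 0 1 x -> 2 <= u x}.
Proof.
move=> small.
have /andP[q0 q1] := @decay_ratio_itv R d.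
have g0 : g 1 2 = 0.
  apply/eqP; rewrite eq_le sublevel_measure_ge0 andbT.
  have lim : small_measure d C * decay_ratio d ^+ n @[n --> \oo] --> (0 : R).
    rewrite -(mulr0 (small_measure d C)); apply: cvgMl_tmp.
    by apply: cvg_expr; rewrite gtr0_norm.
  rewrite -(cvg_lim (@Rhausdorff R) lim); apply: limr_ge; first exact: cvgP lim.
  apply: nearW => n /=; apply: le_trans (de_giorgi_iteration n small).
  have y0 : 0 <= 2^-1 ^+ n :> R by rewrite exprn_ge0.
  have y1 : 2^-1 ^+ n <= 1 :> R by rewrite exprn_ile1//; lra.
  by apply: (sublevel_measure_le uDG); lra.
have one4 : (1 : R) <= 4 by lra.
exists (sublevel u 1 2); split.
- exact: (measurable_sublevel uDG).
- by rewrite (sublevel_measureE uDG)// g0.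
- move=> x /= /not_implyP[x1 /negP]; rewrite -ltNge => x2; by split.
Qed.

End pointwise_bound_iteration.

Section critical_density.
Context {R : realType} {d : nat}.
Local Notation mu := (@lebesgue_row R d).

(** The parameter tau makes the first term of [level_sum] small, after which the
    number J of dyadic levels between M and 4 makes the second one small. *)
Lemma critical_density (C zeta : R) : (1 <= d)%N -> 1 <= C -> 0 < zeta ->
  exists2 M : R, 1 < M & forall u S : 'rV[R]_d -> R,
    DG_minus C (eball 0 4) S u ->
    {ae mu, forall x, eball 0 4 x -> `|S x| <= 1} ->
    {ae mu, forall x, eball 0 4 x -> 0 <= u x} ->
    (zeta%:E <= mu (eball 0 2 `&` [set x | (M <= u x)%R]))%E ->
    {ae mu, forall x, eball 0 1 x -> 2 <= u x}.
Proof.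
move=> d1 C1 zeta0.
have nu0 := @small_measure_gt0 R d C C1; set nu := small_measure d C in nu0.
have C0 : 0 < C by exact: lt_le_trans C1.
have dR : 0 < d%:R :> R by rewrite ltr0n.
pose beta : R := fine (mu (eball (0 : 'rV[R]_d) 4)).
have beta0 : 0 < beta.
  apply: fine_gt0; rewrite eball0_lty andbT; apply: eball0_gt0; exact: ltr0n.
pose tau := nu * zeta / (128 * d%:R * C * beta ^+ 2).
have tau0 : 0 < tau.
  apply: divr_gt0; first exact: mulr_gt0.
  apply: mulr_gt0; last exact: exprn_gt0.
  by apply: mulr_gt0 C0; apply: mulr_gt0 dR; rewrite ltr0n.
have tauE : tau * (128 * d%:R * C * beta ^+ 2) = nu * zeta.
  by rewrite divfK// gt_eqF//; apply: mulr_gt0; rewrite ?exprn_gt0//;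
    apply: mulr_gt0 C0; apply: mulr_gt0 dR; rewrite ltr0n.
clearbody tau.
pose z := 4 * beta ^+ 2 / (zeta * tau * nu).
have zz : 0 < zeta * tau * nu by apply: mulr_gt0 nu0; exact: mulr_gt0.
have z0 : 0 <= z.
  by apply: divr_ge0; [exact: mulr_ge0 (ler0n R 4) (sqr_ge0 beta)|exact: ltW].
pose J := Num.bound z; have zJ : z < J%:R := archi_boundP z0.
have J0 : 0 < J%:R :> R by exact: le_lt_trans zJ.
exists (4 * 2 ^+ J).
  have J1 : 1 <= 2 ^+ J :> R by rewrite exprn_ege1// ler1n.
  by apply: (@lt_le_trans _ _ 4); [rewrite ltr1n|rewrite ler_peMr].
move=> u S uDG S1 u0 hzeta; apply: (ge2_of_small_sublevel C1 uDG S1 u0).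
have ME : 4 * 2 ^+ J / 2 ^+ J = 4 :> R by rewrite mulfK// expf_neq0.
have four1 : 1 <= 4 * 2 ^+ J / 2 ^+ J :> R by rewrite ME ler1n.
have := level_sum C1 uDG S1 u0 four1 tau0 (ltW zeta0) hzeta.
rewrite ME -/beta; set G := sublevel_measure u 2 4 => sum.
move: zJ; rewrite /z ltr_pdivrMr// => zJ.
have e1 : beta * (J%:R * (32 * tau * d%:R * C * beta)) = J%:R * (zeta * nu / 4).
  have -> : beta * (J%:R * (32 * tau * d%:R * C * beta)) =
    J%:R * (tau * (128 * d%:R * C * beta ^+ 2) / 4) by field.
  by rewrite tauE; ring.
have e2 : beta * (beta / tau) <= J%:R * (zeta * nu / 4).
  rewrite mulrA -expr2 ler_pdivrMr// (_ : _ * tau = J%:R * (zeta * tau * nu) / 4); last by field.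
  by rewrite ler_pdivlMr ?ltr0n// mulrC ltW.
clear tauE four1 ME hzeta.
have : J%:R * (zeta * G) <= J%:R * (zeta * nu) by move: sum; rewrite mulrDr e1; lra.
by rewrite ler_pM2l// ler_pM2l.
Qed.

End critical_density.

Theorem corollary2p5p5 (R : realType) (d : nat) (C : R) (hd : (1 <= d)%N)
    (hC : 1 <= C) :
  exists iota M eps : R,
    [/\ 0 < iota < 1, 1 < M, 0 < eps < 1 &
      forall u S : 'rV[R]_d -> R,
        DG_minus C (eball 0 4) S u ->
        (Linfty_norm (eball 0 4) S <= eps%:E)%E ->
        {ae lebesgue_row d, forall x, eball 0 4 x -> 0 <= u x} ->
        (((1 - iota)%:E * lebesgue_row d (eball (0 : 'rV[R]_d) 1) <=
            lebesgue_row d ([set x | (M <= u x)%R] `&` eball 0 1))%E ->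
          {ae lebesgue_row d, forall x, eball 0 1 x -> 1 <= u x}) /\
        ((essinf_on (eball 0 1) u <= 1)%E ->
          (lebesgue_row d ([set x | (M <= u x)%R] `&` eball 0 1) <
            (1 - iota)%:E * lebesgue_row d (eball (0 : 'rV[R]_d) 1))%E)].
Proof.
pose mu := @lebesgue_row R d; pose b := fine (mu (eball (0 : 'rV[R]_d) 1)).
have b0 : 0 < b.
  by apply: fine_gt0; rewrite eball0_lty andbT; apply: eball0_gt0.
have bE : mu (eball 0 1) = b%:E by rewrite fineK// ge0_fin_numE// eball0_lty.
have zeta0 : 0 < (1 - 2^-1) * b by rewrite mulr_gt0//; lra.
have [M M1 dens] := critical_density hd hC zeta0.
exists 2^-1, M, 2^-1; split => //; try lra.
move=> u S uDG Seps u0.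
have B4_0 : (0 < mu (eball 0 4))%E by apply: eball0_gt0; rewrite ltr0n.
have S1 : {ae mu, forall x, eball 0 4 x -> `|S x| <= 1}.
  have muT : (0 < mu setT)%E.
    by apply: lt_le_trans B4_0 _; apply: le_measure; rewrite ?inE//; exact: measurable_eball0.
  move: Seps; rewrite /Linfty_norm unlock muT => /ess_supP; apply: filterS => x.
  by rewrite /= /patch => Sx xB; move: Sx; rewrite mem_set//= lee_fin => /le_trans; apply; lra.
have ge2 : ((1 - 2^-1)%:E * mu (eball 0 1) <=
    mu ([set x | (M <= u x)%R] `&` eball 0 1))%E ->
    {ae mu, forall x, eball 0 1 x -> 2 <= u x}.
  rewrite bE -EFinM => h; apply: (dens u S uDG S1 u0); apply: (le_trans h).
  rewrite setIC; apply: le_measure; rewrite ?inE.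
  - by apply: (measurable_superlevel uDG); rewrite ler1n.
  - by apply: (measurable_superlevel uDG); rewrite ler_nat.
  - by move=> x [x1 xM]; split => //; apply: eball0S x1; rewrite ler1n.
split => [/ge2|inf1].
  by apply: filterS => x ux /ux; apply: le_trans; rewrite ler1n.
rewrite ltNge; apply/negP => /ge2 u2.
have : (2%:E <= essinf_on (eball 0 1) u)%E.
  apply/ess_infP; apply: filterS u2 => x ux; rewrite /patch; case: ifPn => [/set_mem/ux|_].
    by rewrite /= lee_fin.
  exact: leey.
by move=> /le_trans/(_ inf1); rewrite lee_fin leNgt ltr1n.
Qed.
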